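(* The functions $g_1^4(\tau)$ and $g_2^4(\tau)$ are modular functions on $\Gamma_1(10)$, and the functions $T_1(\tau)$ and $T_2(\tau)$ are modular functions on $\Gamma_1(40)$.
   Context: $\tau\in\mathbb{H}$, $q=e^{2\pi i\tau}$, $(a;q)_\infty=\prod_{n\ge0}(1-aq^n)$. Define $T_1(\tau)=\dfrac{(-q;q^5)_\infty(-q^4;q^5)_\infty-(q;q^5)_\infty(q^4;q^5)_\infty}{(-q;q^5)_\infty(-q^4;q^5)_\infty+(q;q^5)_\infty(q^4;q^5)_\infty}$, $T_2(\tau)=\dfrac{(-q^2;q^5)_\infty(-q^3;q^5)_\infty-(q^2;q^5)_\infty(q^3;q^5)_\infty}{(-q^2;q^5)_\infty(-q^3;q^5)_\infty+(q^2;q^5)_\infty(q^3;q^5)_\infty}$, $g_1(\tau)=\dfrac{(-q;q^5)_\infty(-q^4;q^5)_\infty}{(q;q^5)_\infty(q^4;q^5)_\infty}$, $g_2(\tau)=\dfrac{(-q^2;q^5)_\infty(-q^3;q^5)_\infty}{(q^2;q^5)_\infty(q^3;q^5)_\infty}$. $\Gamma_1(N)$ is the group of $\begin{bmatrix} a&b\\ c&d\end{bmatrix}\in\mathrm{SL}_2(\mathbb{Z})$ with $a\equiv d\equiv1$, $c\equiv0\pmod N$. A modular function on $\Gamma$ is a function meromorphic on $\mathbb{H}$, invariant under $\Gamma$, and meromorphic at all cusps. *)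

(* Defs.v *)
From Stdlib Require Import Reals ZArith.
From Coquelicot Require Import Coquelicot.

Open Scope C_scope.

Definition Cexp (z : C) : C :=
  (exp (Re z) * cos (Im z), exp (Re z) * sin (Im z))%R.

Definition Czpow (z : C) (n : Z) : C :=
  match n with
  | Z0 => 1
  | Zpos p => Cpow z (Pos.to_nat p)
  | Zneg p => / Cpow z (Pos.to_nat p)
  end.

Definition in_H (tau : C) : Prop := (0 < Im tau)%R.

Definition qe (tau : C) : C := Cexp (2 * RtoC PI * Ci * tau).

(** (a; b)_infinity = prod_{n >= 0} (1 - a b^n), defined as the limit of
    the partial products (which converge for |b| < 1). *)
Fixpoint qpoch_part (a b : C) (N : nat) : C :=
  match N with
  | O => 1
  | S n => qpoch_part a b n * (1 - a * Cpow b n)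
  end.

Definition qpoch_inf (a b : C) : C :=
  @lim (CompleteNormedModule.CompleteSpace C_AbsRing C_CompleteNormedModule)
    (filtermap (qpoch_part a b) eventually).

Definition T1 (tau : C) : C :=
  let q := qe tau in
  let P := qpoch_inf (- q) (Cpow q 5) * qpoch_inf (- Cpow q 4) (Cpow q 5) in
  let M := qpoch_inf q (Cpow q 5) * qpoch_inf (Cpow q 4) (Cpow q 5) in
  (P - M) / (P + M).

Definition T2 (tau : C) : C :=
  let q := qe tau in
  let P := qpoch_inf (- Cpow q 2) (Cpow q 5) * qpoch_inf (- Cpow q 3) (Cpow q 5) in
  let M := qpoch_inf (Cpow q 2) (Cpow q 5) * qpoch_inf (Cpow q 3) (Cpow q 5) in
  (P - M) / (P + M).

Definition g1 (tau : C) : C :=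
  let q := qe tau in
  (qpoch_inf (- q) (Cpow q 5) * qpoch_inf (- Cpow q 4) (Cpow q 5))
  / (qpoch_inf q (Cpow q 5) * qpoch_inf (Cpow q 4) (Cpow q 5)).

Definition g2 (tau : C) : C :=
  let q := qe tau in
  (qpoch_inf (- Cpow q 2) (Cpow q 5) * qpoch_inf (- Cpow q 3) (Cpow q 5))
  / (qpoch_inf (Cpow q 2) (Cpow q 5) * qpoch_inf (Cpow q 3) (Cpow q 5)).

Definition SL2Z (a b c d : Z) : Prop := (a * d - b * c = 1)%Z.

Definition Gamma1 (N : Z) (a b c d : Z) : Prop :=
  SL2Z a b c d /\ (a mod N = 1 mod N)%Z /\ (d mod N = 1 mod N)%Z
  /\ (c mod N = 0)%Z.

Definition mob (a b c d : Z) (tau : C) : C :=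
  (RtoC (IZR a) * tau + RtoC (IZR b)) / (RtoC (IZR c) * tau + RtoC (IZR d)).

Definition holo_at (g : C -> C) (z : C) : Prop :=
  @ex_derive C_AbsRing C_NormedModule g z.

(** f is meromorphic at z0: near z0, f(z) = (z - z0)^m g(z) with g holomorphic
    on a disk around z0; the identity is required on the punctured disk, and
    also at z0 itself when m >= 0 (so f is a genuine function where it has no
    pole; its value at a pole is irrelevant). *)
Definition meromorphic_at (f : C -> C) (z0 : C) : Prop :=
  exists (m : Z) (r : R) (g : C -> C), (0 < r)%R /\
    (forall z, (Cmod (z - z0) < r)%R -> holo_at g z) /\
    (forall z, (Cmod (z - z0) < r)%R -> (z <> z0 \/ (0 <= m)%Z) ->
       f z = Czpow (z - z0) m * g z).

Definition meromorphic_on_H (f : C -> C) : Prop :=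
  forall z0, in_H z0 -> meromorphic_at f z0.

(** Invariance under Gamma, as an identity of meromorphic functions on H:
    f(gamma tau) = f(tau) for all tau near any point of H, except possibly
    at that point (poles). *)
Definition invariant_under (Gamma : Z -> Z -> Z -> Z -> Prop) (f : C -> C) :=
  forall a b c d, Gamma a b c d ->
  forall z0, in_H z0 -> exists r, (0 < r)%R /\
    forall z, (0 < Cmod (z - z0) < r)%R -> f (mob a b c d z) = f z.

(** Meromorphic at every cusp: for every alpha in SL_2(Z), f(alpha tau) has
    an expansion q_h^{n0} * sum_{n>=0} c_n q_h^n, q_h = e^{2 pi i tau / h},
    valid for Im tau large, for some positive integer width h. *)
Definition meromorphic_at_cusps (f : C -> C) : Prop :=
  forall a b c d, SL2Z a b c d ->
  exists (h : positive) (n0 : Z) (coef : nat -> C) (y0 : R),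
    forall tau, (y0 < Im tau)%R ->
      let qh := Cexp (2 * RtoC PI * Ci * tau / RtoC (IZR (Zpos h))) in
      exists s, @is_series C_AbsRing C_NormedModule
                  (fun n => coef n * Cpow qh n) s
             /\ f (mob a b c d tau) = Czpow qh n0 * s.

Definition modular_function (Gamma : Z -> Z -> Z -> Z -> Prop) (f : C -> C) :=
  meromorphic_on_H f /\ invariant_under Gamma f /\ meromorphic_at_cusps f.

(* Main.v *)
Require Import Defs.
From Stdlib Require Import Reals ZArith Lra Lia Psatz Classical ClassicalEpsilon FunctionalExtensionality.
From Coquelicot Require Import Coquelicot.

(** By the Jacobi triple product, (-y;Q)(-Q/y;Q) is, up to a factor that only depends on Q, the
    theta series Th(z|t) = sum_k y^k Q^{k(k-1)/2} with y = e^{2 pi i z}, Q = e^{2 pi i t}.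
    Hence g1 and g2 are quotients Th(a tau|5 tau) / Th(a tau + 1/2|5 tau) with a = 1, 2.
    Splitting the series according to the parity of k turns P - M and P + M into single theta
    series over the lattice Z + 20 tau Z, so T1 and T2 are theta quotients as well and have
    no poles on H.

    All four are constant multiples of quotients of Klein forms, and these depend
    only on the lattice up to a common factor.  The action of S on Th is obtained without
    complex integration: a function with the quasi-periodicity of Th(.|t) is a multiple of it,
    because its finite Fourier inversion at N equidistant points converges to a multiple of the
    theta series.  Invariance then reduces to the root of unity produced by translating
    a Klein form by a lattice vector, and the expansions at the cusps are obtained by bringing
    the lattice Z + N gamma(tau) Z to Hermite normal form. *)

Open Scope C_scope.

(** * Series of complex numbers indexed by the naturals and by the integers *)

(** The factor by which an element of SL2(Z) multiplies a Klein form depends on t but not on (x1,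
    x2), so it cancels in every quotient. Hence the square root of t in the theta inversion is never
    computed, and no multiplier system appears: each constant only has to be nonzero.

    Holomorphy enters as [taylor2], a second-order Taylor bound with one constant on a whole region.
    It passes termwise to dominated series. It also yields the O(1/N^2) error per step of a Riemann
    mean and the 1/k^2 decay of discrete Fourier coefficients, which stand in for contour shifts.

    The levels come from the coordinates (u/N, v/2) of the Klein forms. A matrix of the group has to
    move them by an integer vector. For v = -1 an even c/N ensures this, which turns N = 5 into 10
    and N = 20 into 40. The remaining phase is a multiple of 1/4 for g1 and g2, whence the fourth
    powers, and an integer for T1 and T2. *)

Definition Ccv (u : nat -> C) (l : C) : Prop :=
  forall eps : R, (0 < eps)%R -> exists n0 : nat, forall n, (n0 <= n)%nat -> (Cmod (u n - l) < eps)%R.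

Fixpoint csum (a : nat -> C) (n : nat) : C :=
  match n with O => 0 | S m => csum a m + a m end.

Fixpoint rsum (b : nat -> R) (n : nat) : R :=
  match n with O => 0%R | S m => (rsum b m + b m)%R end.

Definition Cser (a : nat -> C) (s : C) : Prop := Ccv (csum a) s.

Definition summable (b : nat -> R) : Prop :=
  (forall n, (0 <= b n)%R) /\ exists B, forall n, (rsum b n <= B)%R.

Lemma Cmod_sub_sym (x y : C) : Cmod (x - y) = Cmod (y - x).
Proof. replace (x - y) with (- (y - x)) by ring. apply Cmod_opp. Qed.

Lemma Cmod_triangle_minus (x y : C) : (Cmod (x - y) <= Cmod x + Cmod y)%R.
Proof. unfold Cminus. rewrite <- (Cmod_opp y). apply Cmod_triangle. Qed.

Lemma Cmod_triangle_via (x y z : C) : (Cmod (x - z) <= Cmod (x - y) + Cmod (y - z))%R.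
Proof. replace (x - z) with ((x - y) + (y - z)) by ring. apply Cmod_triangle. Qed.

Lemma Ccv_ext (u v : nat -> C) (l : C) : (forall n, u n = v n) -> Ccv u l -> Ccv v l.
Proof. intros H Hu eps He. destruct (Hu eps He) as [n0 Hn]. exists n0. intros n Hle. rewrite <- H. auto. Qed.

Lemma Ccv_const (c : C) : Ccv (fun _ => c) c.
Proof. intros eps He. exists O. intros n _. replace (c - c) with (RtoC 0) by ring. rewrite Cmod_0. exact He. Qed.

Lemma Ccv_unique (u : nat -> C) (l l' : C) : Ccv u l -> Ccv u l' -> l = l'.
Proof.
  intros H H'. apply Ceq_minus, Cmod_eq_0.
  destruct (Req_dec (Cmod (l - l')) 0) as [E|E]; [exact E|exfalso].
  assert (P : (0 < Cmod (l - l') / 2)%R) by (pose proof (Cmod_ge_0 (l - l')); lra).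
  destruct (H _ P) as [n1 H1]. destruct (H' _ P) as [n2 H2].
  specialize (H1 (max n1 n2) ltac:(lia)). specialize (H2 (max n1 n2) ltac:(lia)).
  pose proof (Cmod_triangle_via l (u (max n1 n2)) l').
  rewrite (Cmod_sub_sym l (u (max n1 n2))) in H0. lra.
Qed.

Lemma Ccv_plus (u v : nat -> C) (l m : C) : Ccv u l -> Ccv v m -> Ccv (fun n => u n + v n) (l + m).
Proof.
  intros Hu Hv eps He. destruct (Hu (eps/2)%R ltac:(lra)) as [n1 H1]. destruct (Hv (eps/2)%R ltac:(lra)) as [n2 H2].
  exists (max n1 n2). intros n Hn. specialize (H1 n ltac:(lia)). specialize (H2 n ltac:(lia)).
  replace (u n + v n - (l + m)) with ((u n - l) + (v n - m)) by ring.
  eapply Rle_lt_trans; [apply Cmod_triangle|lra].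
Qed.

Lemma Ccv_scal (c : C) (u : nat -> C) (l : C) : Ccv u l -> Ccv (fun n => c * u n) (c * l).
Proof.
  intros Hu eps He.
  assert (P : (0 < Cmod c + 1)%R) by (pose proof (Cmod_ge_0 c); lra).
  destruct (Hu (eps / (Cmod c + 1))%R ltac:(apply Rdiv_lt_0_compat; lra)) as [n1 H1].
  exists n1. intros n Hn. specialize (H1 n Hn).
  replace (c * u n - c * l) with (c * (u n - l)) by ring. rewrite Cmod_mult.
  apply Rle_lt_trans with ((Cmod c + 1) * Cmod (u n - l))%R.
  { pose proof (Cmod_ge_0 (u n - l)). nra. }
  apply Rlt_le_trans with ((Cmod c + 1) * (eps / (Cmod c + 1)))%R; [nra|right; field; lra].
Qed.

Lemma Ccv_bounded (u : nat -> C) (l : C) : Ccv u l -> exists B, (0 < B)%R /\ forall n, (Cmod (u n) <= B)%R.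
Proof.
  intros H. destruct (H 1%R ltac:(lra)) as [n0 Hn].
  assert (F : forall m, exists B, (0 <= B)%R /\ forall n, (n < m)%nat -> (Cmod (u n) <= B)%R).
  { induction m as [|m [B [HB IH]]]; [exists 0%R; split; [lra|intros; lia]|].
    exists (B + Cmod (u m))%R. pose proof (Cmod_ge_0 (u m)). split; [lra|].
    intros n Hlt. destruct (Nat.eq_dec n m) as [->|]; [lra|]. specialize (IH n ltac:(lia)). lra. }
  destruct (F n0) as [B [HB FB]]. exists (B + Cmod l + 1)%R. pose proof (Cmod_ge_0 l). split; [lra|].
  intros n. destruct (le_lt_dec n0 n) as [L|L].
  - specialize (Hn n L). pose proof (Cmod_triangle (u n - l) l).
    replace (u n - l + l) with (u n) in H1 by ring. lra.
  - specialize (FB n L). lra.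
Qed.

Lemma Ccv_mult (u v : nat -> C) (l m : C) : Ccv u l -> Ccv v m -> Ccv (fun n => u n * v n) (l * m).
Proof.
  intros Hu Hv. destruct (Ccv_bounded u l Hu) as [B [HB Hb]].
  intros eps He. assert (P : (0 < B + Cmod m + 1)%R) by (pose proof (Cmod_ge_0 m); lra).
  assert (Pe : (0 < eps / (B + Cmod m + 1))%R) by (apply Rdiv_lt_0_compat; lra).
  destruct (Hu _ Pe) as [n1 H1]. destruct (Hv _ Pe) as [n2 H2].
  exists (max n1 n2). intros n Hn. specialize (H1 n ltac:(lia)). specialize (H2 n ltac:(lia)).
  replace (u n * v n - l * m) with (u n * (v n - m) + (u n - l) * m) by ring.
  eapply Rle_lt_trans; [apply Cmod_triangle|]. rewrite !Cmod_mult.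
  apply Rlt_le_trans with ((B + Cmod m + 1) * (eps / (B + Cmod m + 1)))%R; [|right; field; lra].
  set (e := (eps / (B + Cmod m + 1))%R) in *.
  pose proof (Cmod_ge_0 (v n - m)). pose proof (Cmod_ge_0 (u n - l)). pose proof (Cmod_ge_0 m).
  pose proof (Hb n). pose proof (Cmod_ge_0 (u n)). nra.
Qed.

Lemma Ccv_subseq (u : nat -> C) (l : C) (phi : nat -> nat) :
  (forall n, (n <= phi n)%nat) -> Ccv u l -> Ccv (fun n => u (phi n)) l.
Proof.
  intros Hp Hu eps He. destruct (Hu eps He) as [n0 H]. exists n0. intros n Hn.
  apply H. specialize (Hp n). lia.
Qed.

Lemma Ccv_S (u : nat -> C) (l : C) : Ccv (fun n => u (S n)) l -> Ccv u l.
Proof.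
  intros H eps He. destruct (H eps He) as [n0 Hn]. exists (S n0). intros [|n] Hle; [lia|]. apply Hn; lia.
Qed.

Lemma Ccv_le (u : nat -> C) (l : C) (B : R) : (forall n, (Cmod (u n) <= B)%R) -> Ccv u l -> (Cmod l <= B)%R.
Proof.
  intros Hb H. apply Rnot_lt_le. intros L. destruct (H (Cmod l - B)%R ltac:(lra)) as [n0 Hn].
  specialize (Hn n0 (Nat.le_refl _)). specialize (Hb n0).
  pose proof (Cmod_triangle_minus (u n0) (u n0 - l)). replace (u n0 - (u n0 - l)) with l in H0 by ring. lra.
Qed.

Lemma csum_ext (a b : nat -> C) (n : nat) : (forall k, (k < n)%nat -> a k = b k) -> csum a n = csum b n.
Proof. induction n; intros H; simpl; [reflexivity|]. rewrite IHn, H; auto. Qed.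

Lemma csum_plus (a b : nat -> C) (n : nat) : csum (fun k => a k + b k) n = csum a n + csum b n.
Proof. induction n; simpl; [ring|]. rewrite IHn. ring. Qed.

Lemma csum_scal (c : C) (a : nat -> C) (n : nat) : csum (fun k => c * a k) n = c * csum a n.
Proof. induction n; simpl; [ring|]. rewrite IHn. ring. Qed.

Lemma csum_swap (a : nat -> nat -> C) (n m : nat) :
  csum (fun i => csum (fun j => a i j) m) n = csum (fun j => csum (fun i => a i j) n) m.
Proof.
  induction n; simpl.
  - induction m; simpl; [reflexivity|]. rewrite <- IHm. ring.
  - rewrite IHn. rewrite <- csum_plus. reflexivity.
Qed.

Lemma csum_shift (a : nat -> C) (n : nat) : csum (fun k => a (S k)) n + a O = csum a n + a n.
Proof. induction n; simpl; [reflexivity|]. rewrite <- IHn. ring. Qed.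

Lemma csum_telescope (a : nat -> C) (n : nat) : csum (fun j => a (S j) - a j) n = a n - a O.
Proof. induction n; simpl; [ring|]. rewrite IHn. ring. Qed.

Lemma rsum_plus (a b : nat -> R) (n : nat) : rsum (fun k => (a k + b k)%R) n = (rsum a n + rsum b n)%R.
Proof. induction n; simpl; [ring|]. rewrite IHn. ring. Qed.

Lemma rsum_scal (c : R) (a : nat -> R) (n : nat) : rsum (fun k => (c * a k)%R) n = (c * rsum a n)%R.
Proof. induction n; simpl; [ring|]. rewrite IHn. ring. Qed.

Lemma rsum_const (c : R) (n : nat) : rsum (fun _ => c) n = (INR n * c)%R.
Proof. induction n; [simpl; ring|]. rewrite S_INR. simpl rsum. rewrite IHn. ring. Qed.

Lemma rsum_mono (b : nat -> R) : (forall n, (0 <= b n)%R) ->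
  forall m n, (m <= n)%nat -> (rsum b m <= rsum b n)%R.
Proof. intros Hb m n H. induction H; simpl; [lra|]. specialize (Hb m0). lra. Qed.

Lemma csum_diff_bound (a : nat -> C) (b : nat -> R) : (forall k, (Cmod (a k) <= b k)%R) ->
  forall m n, (m <= n)%nat -> (Cmod (csum a n - csum a m) <= rsum b n - rsum b m)%R.
Proof.
  intros H m n L. induction L; simpl.
  - replace (csum a m - csum a m) with (RtoC 0) by ring. rewrite Cmod_0. lra.
  - replace (csum a m0 + a m0 - csum a m) with ((csum a m0 - csum a m) + a m0) by ring.
    eapply Rle_trans; [apply Cmod_triangle|]. specialize (H m0). lra.
Qed.

Lemma csum_bound (a : nat -> C) (b : nat -> R) (n : nat) : (forall k, (k < n)%nat -> (Cmod (a k) <= b k)%R) ->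
  (Cmod (csum a n) <= rsum b n)%R.
Proof.
  induction n; intros H; simpl; [rewrite Cmod_0; lra|].
  eapply Rle_trans; [apply Cmod_triangle|]. specialize (IHn (fun k h => H k (Nat.lt_lt_succ_r _ _ h))).
  specialize (H n ltac:(lia)). lra.
Qed.

Lemma summable_tail (b : nat -> R) : summable b -> forall eps, (0 < eps)%R ->
  exists m0, forall n, (m0 <= n)%nat -> (rsum b n - rsum b m0 <= eps)%R.
Proof.
  intros [Hb [B HB]] eps He.
  destruct (ex_finite_lim_seq_incr (rsum b) B) as [l Hl].
  { intros n; simpl. specialize (Hb n). lra. }
  { exact HB. }
  apply is_lim_seq_spec in Hl. destruct (Hl (mkposreal (eps/2) ltac:(lra))) as [m0 Hm]. simpl in Hm.
  exists m0. intros n Hn. pose proof (Hm n Hn). pose proof (Hm m0 (Nat.le_refl _)).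
  apply Rabs_def2 in H. apply Rabs_def2 in H0. lra.
Qed.

Lemma summable_ex_series (b : nat -> R) : summable b -> ex_series b.
Proof.
  intros [Hb [B HB]].
  destruct (ex_finite_lim_seq_incr (rsum b) B) as [l Hl].
  { intros n; simpl. specialize (Hb n). lra. }
  { exact HB. }
  exists l. apply is_lim_seq_incr_1 in Hl.
  change (is_lim_seq (sum_n b) l).
  apply (is_lim_seq_ext (fun n => rsum b (S n))); [|exact Hl].
  induction n. { simpl. rewrite sum_O. ring. } rewrite sum_Sn, <- IHn. reflexivity.
Qed.

Lemma sum_n_csum (a : nat -> C) (n : nat) : @sum_n C_AbelianMonoid a n = csum a (S n).
Proof.
  induction n. { rewrite sum_O. simpl. ring. }
  rewrite sum_Sn, IHn. reflexivity.
Qed.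

Lemma Ccv_filterlim (u : nat -> C) (l : C) :
  Ccv u l <-> filterlim u eventually (@locally C_NormedModule l).
Proof.
  rewrite (@filterlim_locally_ball_norm C_AbsRing nat C_NormedModule eventually _ u l).
  unfold ball_norm. split.
  - intros H eps. destruct (H eps (cond_pos eps)) as [n0 Hn]. exists n0. intros n Hle.
    change (Cmod (u n - l) < eps)%R. apply Hn; exact Hle.
  - intros H eps He. destruct (H (mkposreal eps He)) as [n0 Hn]. exists n0. intros n Hle.
    exact (Hn n Hle).
Qed.

Lemma Cser_is_series (a : nat -> C) (s : C) : Cser a s <-> @is_series C_AbsRing C_NormedModule a s.
Proof.
  unfold is_series. rewrite <- Ccv_filterlim. split; intros H.
  - apply Ccv_ext with (fun n => csum a (S n)). { intros n. symmetry; apply sum_n_csum. }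
    apply (Ccv_subseq (csum a) s S); auto.
  - apply Ccv_S. apply Ccv_ext with (2 := H). intros n. apply sum_n_csum.
Qed.

Lemma dom_ser (a : nat -> C) (b : nat -> R) : summable b -> (forall k, (Cmod (a k) <= b k)%R) -> exists s, Cser a s.
Proof.
  intros Hb H.
  destruct (@ex_series_le C_AbsRing C_CompleteNormedModule a b) as [s Hs].
  { exact H. }
  { apply summable_ex_series; exact Hb. }
  exists s. apply Cser_is_series. exact Hs.
Qed.

Lemma Cser_ext (a b : nat -> C) (s : C) : (forall k, a k = b k) -> Cser a s -> Cser b s.
Proof. intros H. apply Ccv_ext. intros n. apply csum_ext. auto. Qed.

Lemma Cser_plus (a b : nat -> C) (s t : C) : Cser a s -> Cser b t -> Cser (fun k => a k + b k) (s + t).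
Proof.
  intros Ha Hb. apply Ccv_ext with (fun n => csum a n + csum b n).
  { intros; symmetry; apply csum_plus. } apply Ccv_plus; assumption.
Qed.

Lemma Cser_scal (c : C) (a : nat -> C) (s : C) : Cser a s -> Cser (fun k => c * a k) (c * s).
Proof.
  intros Ha. apply Ccv_ext with (fun n => c * csum a n).
  { intros; symmetry; apply csum_scal. } apply Ccv_scal; assumption.
Qed.

Lemma Cser_unique (a : nat -> C) (s t : C) : Cser a s -> Cser a t -> s = t.
Proof. apply Ccv_unique. Qed.

Lemma Cser_bound (a : nat -> C) (b : nat -> R) (s : C) (B : R) :
  (forall k, (Cmod (a k) <= b k)%R) -> (forall n, (rsum b n <= B)%R) -> Cser a s -> (Cmod s <= B)%R.
Proof.
  intros H HB Hs. apply Ccv_le with (2 := Hs). intros n.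
  eapply Rle_trans; [apply csum_bound with (b := b); auto|auto].
Qed.

Lemma Cser_finite (a : nat -> C) (m : nat) : (forall k, (m <= k)%nat -> a k = 0) -> Cser a (csum a m).
Proof.
  intros H eps He. exists m. intros n Hn.
  replace (csum a n) with (csum a m).
  { replace (csum a m - csum a m) with (RtoC 0) by ring. rewrite Cmod_0. exact He. }
  induction Hn; [reflexivity|]. simpl. rewrite <- IHHn, H by lia. ring.
Qed.

Lemma Ccv_csum (a : nat -> nat -> C) (l : nat -> C) (m : nat) :
  (forall k, Ccv (fun n => a n k) (l k)) -> Ccv (fun n => csum (a n) m) (csum l m).
Proof. intros H. induction m; simpl; [apply Ccv_const|apply Ccv_plus; auto]. Qed.

(** Dominated convergence for series. It is the tool for every exchange of a limit with an infinite
    sum below: Fourier inversion, the triple product, Cauchy products and the regrouping of theta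
    series into power series. *)
Lemma tannery (a : nat -> nat -> C) (l : nat -> C) (b : nat -> R) (s : nat -> C) (L : C) :
  summable b -> (forall n k, (Cmod (a n k) <= b k)%R) -> (forall k, Ccv (fun n => a n k) (l k)) ->
  (forall n, Cser (a n) (s n)) -> Cser l L -> Ccv s L.
Proof.
  intros Hb Hd Hc Hs HL eps He.
  assert (Hdl : forall k, (Cmod (l k) <= b k)%R) by (intros k; apply Ccv_le with (2 := Hc k); auto).
  (* Three errors of at most eps/4 each: the tail of [a n] past m, the tail of l past m, and the
     difference of the two finite sums of length m. *)
  destruct (summable_tail b Hb (eps/4)%R ltac:(lra)) as [m Hm].
  assert (T : forall c t, (forall k, (Cmod (c k) <= b k)%R) -> Cser c t -> (Cmod (t - csum c m) <= eps/4)%R).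
  { intros c t Hcb Hct. apply Ccv_le with (u := fun n => csum c (n + m)%nat - csum c m).
    - intros n. eapply Rle_trans; [apply csum_diff_bound with (b := b); [exact Hcb|lia]|apply Hm; lia].
    - unfold Cminus. apply Ccv_plus; [|apply Ccv_const].
      apply (Ccv_subseq (csum c) t (fun n => (n + m)%nat)); [intros; lia|exact Hct]. }
  destruct (Ccv_csum a l m Hc (eps/4)%R ltac:(lra)) as [n0 Hn0].
  exists n0. intros n Hn. specialize (Hn0 n Hn).
  pose proof (T _ _ (Hd n) (Hs n)). pose proof (T _ _ Hdl HL).
  pose proof (Cmod_triangle_via (s n) (csum (a n) m) L).
  pose proof (Cmod_triangle_via (csum (a n) m) (csum l m) L).
  rewrite (Cmod_sub_sym (csum l m) L) in H2. lra.
Qed.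

Lemma summable_geom (r M : R) : (0 <= r < 1)%R -> (0 <= M)%R -> summable (fun k => (M * r ^ k)%R).
Proof.
  intros Hr HM. split. { intros n. apply Rmult_le_pos; [exact HM|apply pow_le; lra]. }
  exists (M / (1 - r))%R. intros n. rewrite rsum_scal.
  assert (E : (rsum (fun k => r ^ k) n * (1 - r) = 1 - r ^ n)%R).
  { induction n; [simpl; ring|]. simpl rsum. rewrite Rmult_plus_distr_r, IHn. simpl. ring. }
  assert (P : (0 <= r ^ n)%R) by (apply pow_le; lra).
  apply Rmult_le_compat_l; [exact HM|].
  apply Rmult_le_reg_r with (1 - r)%R; [lra|]. eapply Rle_trans; [right; exact E|]. rewrite Rinv_l; lra.
Qed.

Lemma summable_scal (c : R) (b : nat -> R) : (0 <= c)%R -> summable b -> summable (fun k => (c * b k)%R).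
Proof.
  intros Hc [Hb [B HB]]. split. { intros n. apply Rmult_le_pos; auto. }
  exists (c * B)%R. intros n. rewrite rsum_scal. apply Rmult_le_compat_l; auto.
Qed.

Lemma summable_plus (a b : nat -> R) : summable a -> summable b -> summable (fun k => (a k + b k)%R).
Proof.
  intros [Ha [A HA]] [Hb [B HB]]. split. { intros n. specialize (Ha n). specialize (Hb n). lra. }
  exists (A + B)%R. intros n. rewrite rsum_plus. specialize (HA n). specialize (HB n). lra.
Qed.

Lemma summable_inv_sq : summable (fun k => (/ (INR k + 1) ^ 2)%R).
Proof.
  split. { intros n. left. apply Rinv_0_lt_compat, pow_lt. pose proof (pos_INR n). lra. }
  exists 2%R. intros [|n]; [simpl; lra|].
  (* The induction needs the sharper bound 2 - 1/(n+1), which gains 1/(n+1) - 1/(n+2) > 1/(n+2)^2 at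
     each step. *)
  assert (E : (rsum (fun k => / (INR k + 1) ^ 2) (S n) <= 2 - / (INR n + 1))%R).
  { induction n. { simpl. lra. }
    change (rsum (fun k => / (INR k + 1) ^ 2) (S (S n)))%R with (rsum (fun k => / (INR k + 1) ^ 2) (S n) + / (INR (S n) + 1) ^ 2)%R.
    rewrite S_INR. pose proof (pos_INR n).
    assert (Q : (/ (INR n + 1) - / (INR n + 1 + 1) - / (INR n + 1 + 1) ^ 2 = / ((INR n + 1) * (INR n + 1 + 1) ^ 2))%R).
    { field. split; lra. }
    assert ((0 < / ((INR n + 1) * (INR n + 1 + 1) ^ 2))%R).
    { apply Rinv_0_lt_compat. apply Rmult_lt_0_compat; [|apply pow_lt]; lra. }
    lra. }
  pose proof (pos_INR n). assert (0 < / (INR n + 1))%R by (apply Rinv_0_lt_compat; lra). lra.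
Qed.

(** * Two-sided series, summed symmetrically *)

Definition sym (f : Z -> C) (k : nat) : C :=
  match k with O => f 0%Z | S _ => f (Z.of_nat k) + f (- Z.of_nat k)%Z end.

Lemma sym_S (f : Z -> C) (k : nat) : sym f (S k) = f (Z.of_nat (S k)) + f (- Z.of_nat (S k))%Z.
Proof. reflexivity. Qed.

Definition zdom (f : Z -> C) (b : nat -> R) : Prop := forall k, (Cmod (f k) <= b (Z.abs_nat k))%R.

(** Pairing k with -k reduces everything to series over the naturals. The price is that shifting the
    index changes the partial sums, so shifts and parity splittings need a dominating sequence. *)
Definition zser (f : Z -> C) (s : C) : Prop := Cser (sym f) s.

Lemma sym_bound (f : Z -> C) (b : nat -> R) : (forall n, (0 <= b n)%R) -> zdom f b -> forall k, (Cmod (sym f k) <= 2 * b k)%R.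
Proof.
  intros Hb H [|k]; unfold sym.
  - specialize (H 0%Z). simpl in H. specialize (Hb O). lra.
  - eapply Rle_trans; [apply Cmod_triangle|].
    pose proof (H (Z.of_nat (S k))) as H1. pose proof (H (- Z.of_nat (S k))%Z) as H2.
    rewrite Zabs2Nat.id in H1. replace (Z.abs_nat (- Z.of_nat (S k))) with (S k) in H2 by lia.
    lra.
Qed.

Lemma zser_ext (f g : Z -> C) (s : C) : (forall k, f k = g k) -> zser f s -> zser g s.
Proof. intros H. apply Cser_ext. intros [|k]; unfold sym; rewrite !H; reflexivity. Qed.

Lemma zser_unique (f : Z -> C) (s t : C) : zser f s -> zser f t -> s = t.
Proof. apply Cser_unique. Qed.

Lemma zser_plus (f g : Z -> C) (s t : C) : zser f s -> zser g t -> zser (fun k => f k + g k) (s + t).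
Proof.
  intros Hf Hg. eapply Cser_ext; [|apply Cser_plus; [exact Hf|exact Hg]].
  intros [|k]; unfold sym; ring.
Qed.

Lemma zser_scal (c : C) (f : Z -> C) (s : C) : zser f s -> zser (fun k => c * f k) (c * s).
Proof.
  intros Hf. eapply Cser_ext; [|apply Cser_scal; exact Hf].
  intros [|k]; unfold sym; ring.
Qed.

Lemma zser_opp (f : Z -> C) (s : C) : zser f s -> zser (fun k => f (- k)%Z) s.
Proof.
  apply Cser_ext. intros [|k]; [reflexivity|]. unfold sym. rewrite Z.opp_involutive. ring.
Qed.

Lemma zser_ex (f : Z -> C) (b : nat -> R) : summable b -> zdom f b -> exists s, zser f s.
Proof.
  intros Hb H. apply dom_ser with (b := fun k => (2 * b k)%R).
  - apply summable_scal; [lra|exact Hb].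
  - apply sym_bound; [apply Hb|exact H].
Qed.

Lemma summable_to_0 (b : nat -> R) : summable b -> forall eps, (0 < eps)%R -> exists n0, forall n, (n0 <= n)%nat -> (b n < eps)%R.
Proof.
  intros Hb eps He. destruct (summable_tail b Hb (eps/2)%R ltac:(lra)) as [m Hm]. exists m. intros n Hn.
  pose proof (Hm (S n) ltac:(lia)). simpl in H. pose proof (rsum_mono b (proj1 Hb) m n Hn). lra.
Qed.

(** The partial sum of the shifted series over |k| <= n differs from the original one by f(n+1) -
    f(-n), which tends to 0 by domination. *)
Lemma zser_S (f : Z -> C) (b : nat -> R) (s : C) : summable b -> zdom f b ->
  zser f s -> zser (fun k => f (k + 1)%Z) s.
Proof.
  intros Hb Hd Hf. apply Ccv_S.
  apply Ccv_ext with (fun n => csum (sym f) (S n) + (f (Z.of_nat (S n)) - f (- Z.of_nat n)%Z)).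
  { induction n. { simpl. ring. }
    change (csum (sym (fun k => f (k + 1)%Z)) (S (S n))) with
      (csum (sym (fun k => f (k + 1)%Z)) (S n) + sym (fun k => f (k + 1)%Z) (S n)).
    rewrite <- IHn. change (csum (sym f) (S (S n))) with (csum (sym f) (S n) + sym f (S n)). unfold sym at 2 4.
    replace (Z.of_nat (S n) + 1)%Z with (Z.of_nat (S (S n))) by lia.
    replace (- Z.of_nat (S n) + 1)%Z with (- Z.of_nat n)%Z by lia. ring. }
  replace s with (s + 0) by ring. apply Ccv_plus.
  { apply (Ccv_subseq _ s S); auto. }
  intros eps He. destruct (summable_to_0 b Hb (eps/2)%R ltac:(lra)) as [n0 Hn].
  exists n0. intros n Hle. pose proof (Hd (Z.of_nat (S n))). pose proof (Hd (- Z.of_nat n)%Z).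
  replace (Z.abs_nat (Z.of_nat (S n))) with (S n) in H by lia.
  replace (Z.abs_nat (- Z.of_nat n)) with n in H0 by lia.
  pose proof (Hn n Hle). pose proof (Hn (S n) ltac:(lia)).
  replace (f (Z.of_nat (S n)) - f (- Z.of_nat n)%Z - 0) with (f (Z.of_nat (S n)) - f (- Z.of_nat n)%Z) by ring.
  eapply Rle_lt_trans; [apply Cmod_triangle_minus|]. lra.
Qed.

(** Convergence of f is known from domination, so its sum may be read off along the partial sums
    over |k| <= 2n+1. The even and odd parts with index up to n in absolute value cover all of these
    except k = -(2n+1), and that term vanishes in the limit. *)
Lemma zser_even_odd (f : Z -> C) (b : nat -> R) (s t : C) : summable b -> zdom f b ->
  zser (fun k => f (2 * k)%Z) s -> zser (fun k => f (2 * k + 1)%Z) t -> zser f (s + t).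
Proof.
  intros Hb Hd Hs Ht. destruct (zser_ex f b Hb Hd) as [u Hu].
  replace (s + t) with u; [exact Hu|].
  apply Ccv_unique with (fun n => csum (sym f) (2 * n)).
  { apply (Ccv_subseq (csum (sym f)) u (fun n => (2 * n)%nat)); [intros; lia|exact Hu]. }
  apply Ccv_S.
  apply Ccv_ext with (fun n => (csum (sym (fun k => f (2 * k)%Z)) (S n) + csum (sym (fun k => f (2 * k + 1)%Z)) (S n))
                               + f (- Z.of_nat (2 * n + 1))%Z).
  { induction n.
    { simpl. ring. }
    replace (2 * S (S n))%nat with (S (S (2 * S n))) by lia.
    change (csum (sym f) (S (S (2 * S n)))) with (csum (sym f) (2 * S n) + sym f (2 * S n)%nat + sym f (S (2 * S n))%nat).
    rewrite <- IHn.
    change (csum (sym (fun k => f (2 * k)%Z)) (S (S n))) with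
      (csum (sym (fun k => f (2 * k)%Z)) (S n) + sym (fun k => f (2 * k)%Z) (S n)).
    change (csum (sym (fun k => f (2 * k + 1)%Z)) (S (S n))) with
      (csum (sym (fun k => f (2 * k + 1)%Z)) (S n) + sym (fun k => f (2 * k + 1)%Z) (S n)).
    replace (2 * S n + 1)%nat with (S (S (2 * n + 1))) by lia.
    replace (2 * S n)%nat with (S (2 * n + 1)) by lia.
    rewrite !sym_S.
    replace (2 * Z.of_nat (S n))%Z with (Z.of_nat (S (2 * n + 1))) by lia.
    replace (2 * - Z.of_nat (S n))%Z with (- Z.of_nat (S (2 * n + 1)))%Z by lia.
    replace (- Z.of_nat (S (2 * n + 1)) + 1)%Z with (- Z.of_nat (2 * n + 1))%Z by lia.
    replace (Z.of_nat (S (2 * n + 1)) + 1)%Z with (Z.of_nat (S (S (2 * n + 1)))) by lia.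
    ring. }
  replace (s + t) with (s + t + 0) by ring. apply Ccv_plus.
  { apply Ccv_plus; [apply (Ccv_subseq _ s S)|apply (Ccv_subseq _ t S)]; auto. }
  intros eps He. destruct (summable_to_0 b Hb eps He) as [n0 Hn].
  exists n0. intros n Hle. pose proof (Hd (- Z.of_nat (2 * n + 1))%Z) as H.
  replace (Z.abs_nat (- Z.of_nat (2 * n + 1))) with (2 * n + 1)%nat in H by lia.
  specialize (Hn (2 * n + 1)%nat ltac:(lia)).
  replace (f (- Z.of_nat (2 * n + 1))%Z - 0) with (f (- Z.of_nat (2 * n + 1))%Z) by ring. lra.
Qed.

Lemma tannery_Z (a : nat -> Z -> C) (l : Z -> C) (b : nat -> R) (s : nat -> C) (L : C) :
  summable b -> (forall n, zdom (a n) b) -> (forall k, Ccv (fun n => a n k) (l k)) ->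
  (forall n, zser (a n) (s n)) -> zser l L -> Ccv s L.
Proof.
  intros Hb Hd Hc Hs HL. apply tannery with (a := fun n => sym (a n)) (l := sym l) (b := fun k => (2 * b k)%R).
  - apply summable_scal; [lra|exact Hb].
  - intros n. apply sym_bound; [apply Hb|apply Hd].
  - intros [|k]; unfold sym; [apply Hc|apply Ccv_plus; apply Hc].
  - exact Hs.
  - exact HL.
Qed.

(** * The exponential and uniform second-order Taylor estimates *)

Lemma Cexp_plus (a b : C) : Cexp (a + b) = Cexp a * Cexp b.
Proof.
  unfold Cexp, Cmult. destruct a as [a1 a2], b as [b1 b2]. simpl.
  rewrite exp_plus, cos_plus, sin_plus. f_equal; ring.
Qed.

Lemma Cexp_0 : Cexp 0 = 1.
Proof. unfold Cexp. simpl. rewrite exp_0, cos_0, sin_0. unfold RtoC. f_equal; ring. Qed.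

Lemma Cmod_Cexp (a : C) : Cmod (Cexp a) = exp (Re a).
Proof.
  unfold Cexp, Cmod. cbn [fst snd].
  replace ((exp (Re a) * cos (Im a)) ^ 2 + (exp (Re a) * sin (Im a)) ^ 2)%R with (Rsqr (exp (Re a))).
  { apply sqrt_Rsqr. left. apply exp_pos. }
  pose proof (sin2_cos2 (Im a)) as H. unfold Rsqr in *.
  replace (exp (Re a) * exp (Re a))%R with (exp (Re a) * exp (Re a) * (sin (Im a) * sin (Im a) + cos (Im a) * cos (Im a)))%R
    by (rewrite H; ring). ring.
Qed.

Lemma Cexp_nz (a : C) : Cexp a <> 0.
Proof. apply Cmod_gt_0. rewrite Cmod_Cexp. apply exp_pos. Qed.

Lemma qe_plus (a b : C) : qe (a + b) = qe a * qe b.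
Proof. unfold qe. rewrite <- Cexp_plus. f_equal. ring. Qed.

Lemma qe_0 : qe 0 = 1.
Proof. unfold qe. rewrite Cmult_0_r. apply Cexp_0. Qed.

Lemma qe_nz (a : C) : qe a <> 0.
Proof. apply Cexp_nz. Qed.

Lemma Cmod_qe (a : C) : Cmod (qe a) = exp (- (2 * PI * Im a)).
Proof. unfold qe. rewrite Cmod_Cexp. f_equal. destruct a. simpl. ring. Qed.

Lemma Cmult_reg_l (a b c : C) : a <> 0 -> a * b = a * c -> b = c.
Proof. intros H E. replace b with (/ a * (a * b)) by (field; exact H). rewrite E. field. exact H. Qed.

Lemma qe_opp (a : C) : qe (- a) = / qe a.
Proof.
  apply (Cmult_reg_l (qe a)); [apply qe_nz|]. rewrite <- qe_plus.
  replace (a + - a) with (RtoC 0) by ring. rewrite qe_0. field. apply qe_nz.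
Qed.

Lemma qe_minus (a b : C) : qe (a - b) = qe a / qe b.
Proof. unfold Cminus. rewrite qe_plus, qe_opp. reflexivity. Qed.

Lemma qe_1 : qe 1 = 1.
Proof.
  unfold qe, Cexp. simpl.
  replace (((2 * PI - 0 * 0) * 0 - (2 * 0 + 0 * PI) * 1) * 1 - ((2 * PI - 0 * 0) * 1 + (2 * 0 + 0 * PI) * 0) * 0)%R with 0%R by ring.
  replace (((2 * PI - 0 * 0) * 0 - (2 * 0 + 0 * PI) * 1) * 0 + ((2 * PI - 0 * 0) * 1 + (2 * 0 + 0 * PI) * 0) * 1)%R with (2 * PI)%R by ring.
  rewrite exp_0, cos_2PI, sin_2PI. unfold RtoC. f_equal; ring.
Qed.

Lemma qe_half : qe (1 / 2) = - (1).
Proof.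
  replace (1 / 2) with (RtoC (1/2)) by (rewrite RtoC_div by lra; reflexivity).
  unfold qe, Cexp. simpl.
  replace (((2 * PI - 0 * 0) * 0 - (2 * 0 + 0 * PI) * 1) * (1/2) - ((2 * PI - 0 * 0) * 1 + (2 * 0 + 0 * PI) * 0) * 0)%R with 0%R by ring.
  replace (((2 * PI - 0 * 0) * 0 - (2 * 0 + 0 * PI) * 1) * 0 + ((2 * PI - 0 * 0) * 1 + (2 * 0 + 0 * PI) * 0) * (1/2))%R with (PI)%R by field.
  rewrite exp_0, cos_PI, sin_PI. unfold RtoC, Copp. simpl. f_equal; ring.
Qed.

Lemma qe_pow (a : C) (n : nat) : Cpow (qe a) n = qe (RtoC (INR n) * a).
Proof.
  induction n. { simpl. rewrite Cmult_0_l, qe_0. reflexivity. }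
  rewrite S_INR. simpl Cpow. rewrite IHn, <- qe_plus. f_equal. rewrite RtoC_plus. ring.
Qed.

Lemma qe_int (k : Z) : qe (RtoC (IZR k)) = 1.
Proof.
  assert (N : forall n, qe (RtoC (INR n)) = 1).
  { intros n. replace (RtoC (INR n)) with (RtoC (INR n) * 1) by ring.
    rewrite <- qe_pow, qe_1. apply Cpow_1_l. }
  destruct (Z_le_gt_dec 0 k) as [H|H].
  - rewrite <- (Z2Nat.id k H), <- INR_IZR_INZ. apply N.
  - replace k with (- Z.of_nat (Z.to_nat (- k)))%Z by lia.
    rewrite opp_IZR, <- INR_IZR_INZ, RtoC_opp, qe_opp, N. field.
Qed.

Lemma qe_period (a : C) (k : Z) : qe (a + RtoC (IZR k)) = qe a.
Proof. rewrite qe_plus, qe_int. ring. Qed.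

(** Both bounds follow from exp u >= 1 + u at u = x and u = -x together with exp x * exp (-x) =
    1. *)
Lemma exp_1_le (x : R) : (x <= 0)%R -> (0 <= exp x - 1 - x <= x ^ 2)%R /\ (0 <= 1 - exp x <= - x)%R.
Proof.
  intros Hx. pose proof (exp_ineq1_le x). pose proof (exp_ineq1_le (- x)).
  pose proof (exp_pos x). assert (E : (exp x * exp (- x) = 1)%R) by (rewrite <- exp_plus, Rplus_opp_r; apply exp_0).
  assert (exp x <= 1)%R by nra.
  assert ((exp x * (1 - x) <= 1)%R) by nra.
  split; split; nra.
Qed.

Lemma sin_abs_le (y : R) : (Rabs (sin y) <= Rabs y)%R.
Proof.
  assert (P : forall y, (0 <= y)%R -> (Rabs (sin y) <= y)%R).
  { intros u Hu. destruct (Req_dec u 0) as [->|N]; [rewrite sin_0, Rabs_R0; lra|].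
    pose proof (SIN_bound u) as B.
    destruct (Rle_lt_dec 1 u) as [L|L]; [apply Rabs_le; lra|].
    pose proof (sin_lt_x u ltac:(lra)). pose proof (sin_ge_0 u ltac:(lra) ltac:(pose proof PI2_1; lra)).
    rewrite Rabs_pos_eq; lra. }
  destruct (Rle_lt_dec 0 y) as [L|L]; [rewrite (Rabs_pos_eq y) by lra; auto|].
  rewrite (Rabs_left y) by lra. rewrite <- Rabs_Ropp, <- sin_neg. apply P. lra.
Qed.

Lemma cos_1_le (y : R) : (0 <= 1 - cos y <= y ^ 2 / 2)%R.
Proof.
  split; [pose proof (COS_bound y); lra|].
  replace y with (2 * (y / 2))%R at 1 by field. rewrite cos_2a_sin.
  pose proof (sin_abs_le (y / 2)). pose proof (Rsqr_le_abs_1 _ _ H). unfold Rsqr in *. nra.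
Qed.

Lemma sin_x_le (y : R) : (Rabs (sin y - y) <= y ^ 2)%R.
Proof.
  assert (P : forall y, (0 <= y)%R -> (Rabs (sin y - y) <= y ^ 2)%R).
  { intros u Hu. pose proof (sin_abs_le u) as A. rewrite (Rabs_pos_eq u) in A by lra. apply Rabs_le_between in A.
    destruct (Rle_lt_dec 2 u) as [L|L]; [apply Rabs_le; nra|].
    destruct (Req_dec u 0) as [->|N]; [rewrite sin_0, Rminus_0_r, Rabs_R0; lra|].
    destruct (MVT_cor2 (fun x => x - sin x)%R (fun x => 1 - cos x)%R 0 u ltac:(lra)) as [c [E Hc]].
    { intros c _. apply (derivable_pt_lim_minus id sin). apply derivable_pt_lim_id. apply derivable_pt_lim_sin. }
    rewrite sin_0 in E. pose proof (cos_1_le c). rewrite Rabs_minus_sym, Rabs_pos_eq by lra.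
    assert (c ^ 2 <= u ^ 2)%R by nra. nra. }
  destruct (Rle_lt_dec 0 y) as [L|L]; [auto|].
  rewrite <- Rabs_Ropp. replace (- (sin y - y))%R with (sin (- y) - (- y))%R by (rewrite sin_neg; ring).
  replace (y ^ 2)%R with ((- y) ^ 2)%R by ring. apply P. lra.
Qed.

Lemma Cmod_le_sum (x y : R) : (Cmod (x, y) <= Rabs x + Rabs y)%R.
Proof.
  replace (x, y) with (RtoC x + Ci * RtoC y) by (unfold RtoC, Ci, Cplus, Cmult; simpl; f_equal; ring).
  eapply Rle_trans; [apply Cmod_triangle|]. rewrite Cmod_mult, Cmod_Ci, !Cmod_R. lra.
Qed.

Lemma Cexp_rem1 (h : C) : (Re h <= 0)%R -> (Cmod (Cexp h - 1) <= 4 * Cmod h)%R.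
Proof.
  destruct h as [x y]. simpl. intros Hx. destruct (exp_1_le x Hx) as [_ H2].
  pose proof (Rmax_Cmod (x, y)) as M. simpl in M. pose proof (Rmax_l (Rabs x) (Rabs y)). pose proof (Rmax_r (Rabs x) (Rabs y)).
  unfold Cexp. simpl.
  replace (((exp x * cos y)%R, (exp x * sin y)%R) - 1)%C with (((exp x * cos y - 1)%R, (exp x * sin y)%R) : C)
    by (unfold Cminus, Cplus, Copp, RtoC; simpl; f_equal; ring).
  eapply Rle_trans; [apply Cmod_le_sum|].
  pose proof (exp_pos x). pose proof (sin_abs_le y). pose proof (cos_1_le y) as [c1 c2]. pose proof (COS_bound y).
  rewrite Rabs_mult, (Rabs_pos_eq (exp x)) by lra.
  rewrite (Rabs_left1 x) in * by lra.
  assert (H6 : (Rabs (1 - cos y) <= Rabs y)%R).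
  { rewrite Rabs_pos_eq by lra. unfold Rabs. destruct (Rcase_abs y); nra. }
  replace (exp x * cos y - 1)%R with (- (1 - exp x) - exp x * (1 - cos y))%R by ring.
  assert (Rabs (- (1 - exp x) - exp x * (1 - cos y)) <= (- x) + Rabs y)%R.
  { rewrite (Rabs_pos_eq (1 - cos y)) in H6 by lra. rewrite Rabs_left1; nra. }
  pose proof (Rabs_pos (sin y)). nra.
Qed.

Lemma Cexp_rem2 (h : C) : (Re h <= 0)%R -> (Cmod (Cexp h - 1 - h) <= 6 * Cmod h ^ 2)%R.
Proof.
  destruct h as [x y]. simpl Re. intros Hx. destruct (exp_1_le x Hx) as [H1 H2].
  pose proof (Rmax_Cmod (x, y)) as M. simpl in M. pose proof (Rmax_l (Rabs x) (Rabs y)). pose proof (Rmax_r (Rabs x) (Rabs y)).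
  set (m := Cmod (x, y)) in *.
  unfold Cexp. simpl Re. simpl Im.
  replace (((exp x * cos y)%R, (exp x * sin y)%R) - 1 - (x, y))%C with (((exp x * cos y - 1 - x)%R, (exp x * sin y - y)%R) : C)
    by (unfold Cminus, Cplus, Copp, RtoC; simpl; f_equal; ring).
  eapply Rle_trans; [apply Cmod_le_sum|].
  pose proof (exp_pos x). pose proof (sin_abs_le y). pose proof (sin_x_le y). pose proof (cos_1_le y) as [c1 c2]. pose proof (COS_bound y).
  assert (X : (x ^ 2 <= m ^ 2)%R). { rewrite <- (pow2_abs x). pose proof (Rabs_pos x). apply pow_incr. lra. }
  assert (Y : (y ^ 2 <= m ^ 2)%R). { rewrite <- (pow2_abs y). pose proof (Rabs_pos y). apply pow_incr. lra. }
  assert (XY : (- x * Rabs y <= m ^ 2)%R). { rewrite (Rabs_left1 x) in * by lra. pose proof (Rabs_pos y). simpl. rewrite Rmult_1_r. apply Rmult_le_compat; lra. }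
  assert (A : (Rabs (exp x * cos y - 1 - x) <= 2 * m ^ 2)%R).
  { replace (exp x * cos y - 1 - x)%R with ((exp x - 1 - x) - exp x * (1 - cos y))%R by ring. apply Rabs_le. nra. }
  assert (B : (Rabs (exp x * sin y - y) <= 2 * m ^ 2)%R).
  { replace (exp x * sin y - y)%R with ((sin y - y) + - (1 - exp x) * sin y)%R by ring.
    eapply Rle_trans; [apply Rabs_triang|]. rewrite Rabs_mult, Rabs_Ropp, (Rabs_pos_eq (1 - exp x)) by lra.
    pose proof (Rabs_pos (sin y)). nra. }
  pose proof (pow2_ge_0 m). lra.
Qed.

(** The error is measured by the moduli of the exponential at the two end points alone. A summable
    bound for the terms of a series of exponentials therefore also controls their remainders. *)
Lemma Cexp_rem (a b : C) :
  (Cmod (Cexp b - Cexp a - Cexp a * (b - a)) <= 10 * Cmod (b - a) ^ 2 * (Cmod (Cexp a) + Cmod (Cexp b)))%R.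
Proof.
  pose proof (Cmod_ge_0 (Cexp a)). pose proof (Cmod_ge_0 (Cexp b)). pose proof (pow2_ge_0 (Cmod (b - a))).
  destruct (Rle_lt_dec (Re (b - a)) 0) as [L|L].
  - replace (Cexp b) with (Cexp a * Cexp (b - a)) at 1 by (rewrite <- Cexp_plus; f_equal; ring).
    replace (Cexp a * Cexp (b - a) - Cexp a - Cexp a * (b - a)) with (Cexp a * (Cexp (b - a) - 1 - (b - a))) by ring.
    rewrite Cmod_mult. pose proof (Cexp_rem2 _ L). nra.
  (* Here b has the larger real part, so one factors out Cexp b. Moving the linear term from b to a
     costs the first-order bound, and 10 = 6 + 4. *)
  - assert (L' : (Re (a - b) <= 0)%R) by (destruct a, b; simpl in *; lra).
    replace (Cexp a) with (Cexp b * Cexp (a - b)) at 1 2 by (rewrite <- Cexp_plus; f_equal; ring).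
    replace (Cexp b - Cexp b * Cexp (a - b) - Cexp b * Cexp (a - b) * (b - a))
      with (Cexp b * (- (Cexp (a - b) - 1 - (a - b)) + (Cexp (a - b) - 1) * (a - b))) by ring.
    rewrite Cmod_mult. pose proof (Cexp_rem2 _ L') as E2. pose proof (Cexp_rem1 _ L') as E1.
    rewrite (Cmod_sub_sym a b) in *.
    assert (Cmod (- (Cexp (a - b) - 1 - (a - b)) + (Cexp (a - b) - 1) * (a - b)) <= 10 * Cmod (b - a) ^ 2)%R.
    { eapply Rle_trans; [apply Cmod_triangle|]. rewrite Cmod_opp, Cmod_mult, (Cmod_sub_sym a b).
      pose proof (Cmod_ge_0 (b - a)). nra. }
    nra.
Qed.

(** A quantitative form of holomorphy, with D the derivative. The remainder estimate holds for any
    two points of U, near or far, with one constant K that also bounds G and D. Such estimates can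
    be added up over a series, which replaces the theorem that locally uniform limits of holomorphic
    functions are holomorphic. *)
Definition taylor2_with (U : C -> Prop) (G D : C -> C) (K : R) : Prop :=
  forall w, U w -> (Cmod (G w) <= K)%R /\ (Cmod (D w) <= K)%R /\
    forall w', U w' -> (Cmod (G w' - G w - D w * (w' - w)) <= K * Cmod (w' - w) ^ 2)%R.

Definition taylor2 (U : C -> Prop) (G : C -> C) : Prop := exists D K, (0 <= K)%R /\ taylor2_with U G D K.

Lemma taylor2_with_mono (U : C -> Prop) (G D : C -> C) (K K' : R) : (K <= K')%R -> taylor2_with U G D K -> taylor2_with U G D K'.
Proof.
  intros HK H w Hw. destruct (H w Hw) as [A [B E]]. repeat split; [lra|lra|].
  intros w' Hw'. specialize (E w' Hw'). pose proof (pow2_ge_0 (Cmod (w' - w))). nra.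
Qed.

(** U is not assumed convex, so no mean value argument is available. Points at distance at least 1
    are handled by the bound on G, closer ones by the Taylor estimate, where d^2 <= d. *)
Lemma taylor2_with_lip (U : C -> Prop) (G D : C -> C) (K : R) : (0 <= K)%R -> taylor2_with U G D K ->
  forall w w', U w -> U w' -> (Cmod (G w' - G w) <= 2 * K * Cmod (w' - w))%R.
Proof.
  intros HK H w w' Hw Hw'. destruct (H w Hw) as [A [B E]]. specialize (E w' Hw').
  destruct (H w' Hw') as [A' _]. pose proof (Cmod_ge_0 (w' - w)).
  destruct (Rle_lt_dec 1 (Cmod (w' - w))) as [L|L].
  - eapply Rle_trans; [apply Cmod_triangle_minus|]. nra.
  - replace (G w' - G w) with ((G w' - G w - D w * (w' - w)) + D w * (w' - w)) by ring.
    eapply Rle_trans; [apply Cmod_triangle|]. rewrite Cmod_mult.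
    set (d := Cmod (w' - w)) in *.
    assert (Cmod (D w) * d <= K * d)%R by (apply Rmult_le_compat_r; assumption).
    assert (d ^ 2 <= d)%R by nra. assert (K * d ^ 2 <= K * d)%R by (apply Rmult_le_compat_l; assumption). lra.
Qed.

Lemma taylor2_sub (U V : C -> Prop) (G : C -> C) : (forall w, V w -> U w) -> taylor2 U G -> taylor2 V G.
Proof.
  intros HV [D [K [HK H]]]. exists D, K. split; [exact HK|]. intros w Hw. destruct (H w (HV w Hw)) as [A [B E]].
  repeat split; auto.
Qed.

Lemma taylor2_ext (U : C -> Prop) (G F : C -> C) : (forall w, U w -> G w = F w) -> taylor2 U G -> taylor2 U F.
Proof.
  intros HE [D [K [HK H]]]. exists D, K. split; [exact HK|]. intros w Hw. destruct (H w Hw) as [A [B E]].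
  rewrite <- HE by assumption. repeat split; auto. intros w' Hw'. rewrite <- HE by assumption. auto.
Qed.

Lemma taylor2_const (U : C -> Prop) (c : C) : taylor2 U (fun _ => c).
Proof.
  exists (fun _ => 0), (Cmod c). pose proof (Cmod_ge_0 c). split; [assumption|]. intros w _. repeat split; [lra|rewrite Cmod_0; lra|].
  intros w' _. replace (c - c - 0 * (w' - w)) with (RtoC 0) by ring. rewrite Cmod_0.
  apply Rmult_le_pos; [assumption|apply pow2_ge_0].
Qed.

Lemma taylor2_id (U : C -> Prop) (R0 : R) : (forall w, U w -> (Cmod w <= R0)%R) -> (0 <= R0)%R -> taylor2 U (fun w => w).
Proof.
  intros HU HR. exists (fun _ => 1), (R0 + 1)%R. split; [lra|]. intros w Hw. specialize (HU w Hw). repeat split; [lra|rewrite Cmod_1; lra|].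
  intros w' _. replace (w' - w - 1 * (w' - w)) with (RtoC 0) by ring. rewrite Cmod_0.
  apply Rmult_le_pos; [lra|apply pow2_ge_0].
Qed.

Lemma taylor2_plus (U : C -> Prop) (F G : C -> C) : taylor2 U F -> taylor2 U G -> taylor2 U (fun w => F w + G w).
Proof.
  intros [D [K [HK H]]] [D' [K' [HK' H']]]. exists (fun w => D w + D' w), (K + K')%R. split; [lra|].
  intros w Hw. destruct (H w Hw) as [A [B E]]. destruct (H' w Hw) as [A' [B' E']].
  split; [|split].
  - eapply Rle_trans; [apply Cmod_triangle|lra].
  - eapply Rle_trans; [apply Cmod_triangle|lra].
  - intros w' Hw'. specialize (E w' Hw'). specialize (E' w' Hw').
    replace (F w' + G w' - (F w + G w) - (D w + D' w) * (w' - w)) with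
      ((F w' - F w - D w * (w' - w)) + (G w' - G w - D' w * (w' - w))) by ring.
    eapply Rle_trans; [apply Cmod_triangle|]. lra.
Qed.

Lemma taylor2_mult (U : C -> Prop) (F G : C -> C) : taylor2 U F -> taylor2 U G -> taylor2 U (fun w => F w * G w).
Proof.
  intros [D [K [HK H]]] [D' [K' [HK' H']]].
  exists (fun w => D w * G w + F w * D' w), (6 * (K * K'))%R.
  assert (P : (0 <= K * K')%R) by (apply Rmult_le_pos; assumption). split; [lra|].
  intros w Hw. destruct (H w Hw) as [A [B E]]. destruct (H' w Hw) as [A' [B' E']].
  pose proof (Cmod_ge_0 (F w)). pose proof (Cmod_ge_0 (G w)). pose proof (Cmod_ge_0 (D w)). pose proof (Cmod_ge_0 (D' w)).
  assert (M : forall x y, (0 <= x <= K)%R -> (0 <= y <= K')%R -> (x * y <= K * K')%R) by (intros; apply Rmult_le_compat; lra).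
  split; [|split].
  - rewrite Cmod_mult. pose proof (M (Cmod (F w)) (Cmod (G w))). lra.
  - eapply Rle_trans; [apply Cmod_triangle|]. rewrite !Cmod_mult.
    pose proof (M (Cmod (D w)) (Cmod (G w))). pose proof (M (Cmod (F w)) (Cmod (D' w))). lra.
  - intros w' Hw'. specialize (E w' Hw'). specialize (E' w' Hw').
    pose proof (taylor2_with_lip U F D K HK H w w' Hw Hw') as L. pose proof (taylor2_with_lip U G D' K' HK' H' w w' Hw Hw') as L'.
    replace (F w' * G w' - F w * G w - (D w * G w + F w * D' w) * (w' - w)) with
      (F w * (G w' - G w - D' w * (w' - w)) + (F w' - F w - D w * (w' - w)) * G w + (F w' - F w) * (G w' - G w)) by ring.
    eapply Rle_trans; [apply Cmod_triangle|]. eapply Rle_trans; [apply Rplus_le_compat_r, Cmod_triangle|].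
    rewrite !Cmod_mult. set (d := Cmod (w' - w)) in *. assert (Hd : (0 <= d)%R) by apply Cmod_ge_0.
    assert (Cmod (F w) * Cmod (G w' - G w - D' w * (w' - w)) <= K * (K' * d ^ 2))%R
      by (apply Rmult_le_compat; try lra; apply Cmod_ge_0).
    assert (Cmod (F w' - F w - D w * (w' - w)) * Cmod (G w) <= K * d ^ 2 * K')%R
      by (apply Rmult_le_compat; try lra; apply Cmod_ge_0).
    assert (Cmod (F w' - F w) * Cmod (G w' - G w) <= 2 * K * d * (2 * K' * d))%R
      by (apply Rmult_le_compat; try lra; apply Cmod_ge_0).
    lra.
Qed.

Lemma taylor2_comp (U V : C -> Prop) (G h : C -> C) : (forall w, U w -> V (h w)) -> taylor2 V G -> taylor2 U h -> taylor2 U (fun w => G (h w)).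
Proof.
  intros HV [D [K [HK H]]] [D' [K' [HK' H']]].
  exists (fun w => D (h w) * D' w), (K + K * K' + K * (2 * K') ^ 2)%R.
  assert (P : (0 <= K * K')%R) by (apply Rmult_le_pos; assumption).
  assert (P2 : (0 <= K * (2 * K') ^ 2)%R) by (apply Rmult_le_pos; [assumption|apply pow2_ge_0]). split; [lra|].
  intros w Hw. destruct (H (h w) (HV w Hw)) as [A [B E]]. destruct (H' w Hw) as [A' [B' E']].
  split; [lra|split].
  - rewrite Cmod_mult. pose proof (Rmult_le_compat _ _ _ _ (Cmod_ge_0 (D (h w))) (Cmod_ge_0 (D' w)) B B'). lra.
  - intros w' Hw'. specialize (E (h w') (HV w' Hw')). specialize (E' w' Hw').
    pose proof (taylor2_with_lip U h D' K' HK' H' w w' Hw Hw') as L.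
    replace (G (h w') - G (h w) - D (h w) * D' w * (w' - w)) with
      ((G (h w') - G (h w) - D (h w) * (h w' - h w)) + D (h w) * (h w' - h w - D' w * (w' - w))) by ring.
    eapply Rle_trans; [apply Cmod_triangle|]. rewrite Cmod_mult.
    set (d := Cmod (w' - w)) in *. assert (Hd : (0 <= d)%R) by apply Cmod_ge_0.
    assert (Cmod (D (h w)) * Cmod (h w' - h w - D' w * (w' - w)) <= K * (K' * d ^ 2))%R
      by (apply Rmult_le_compat; try lra; apply Cmod_ge_0).
    assert (Cmod (h w' - h w) ^ 2 <= (2 * K' * d) ^ 2)%R by (apply pow_incr; split; [apply Cmod_ge_0|exact L]).
    assert (K * Cmod (h w' - h w) ^ 2 <= K * (2 * K' * d) ^ 2)%R by (apply Rmult_le_compat_l; assumption).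
    assert (0 <= K * d ^ 2)%R by (apply Rmult_le_pos; [assumption|apply pow2_ge_0]). lra.
Qed.

Lemma taylor2_Cexp (A : R) : taylor2 (fun w => (Re w <= A)%R) Cexp.
Proof.
  exists Cexp, (20 * exp A)%R. pose proof (exp_pos A). split; [lra|].
  assert (B : forall w, (Re w <= A)%R -> (Cmod (Cexp w) <= exp A)%R).
  { intros w Hw. rewrite Cmod_Cexp. destruct Hw as [Hw|Hw]; [left; apply exp_increasing; exact Hw|rewrite Hw; lra]. }
  intros w Hw. pose proof (B w Hw). repeat split; [lra|lra|].
  intros w' Hw'. pose proof (B w' Hw'). eapply Rle_trans; [apply Cexp_rem|].
  pose proof (pow2_ge_0 (Cmod (w' - w))). nra.
Qed.

Lemma taylor2_inv (c : R) : (0 < c)%R -> taylor2 (fun w => (c <= Cmod w)%R) Cinv.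
Proof.
  intros Hc. exists (fun w => - (/ w * / w)), (/ c + / c ^ 2 + / c ^ 3)%R.
  assert (I : (0 < / c)%R) by (apply Rinv_0_lt_compat; lra).
  assert (I2 : (/ c ^ 2 = / c * / c)%R) by (field; lra). assert (I3 : (/ c ^ 3 = / c * / c * / c)%R) by (field; lra).
  rewrite I2, I3.
  assert (J : (0 < / c * / c)%R) by (apply Rmult_lt_0_compat; assumption).
  assert (J3 : (0 < / c * / c * / c)%R) by (apply Rmult_lt_0_compat; assumption). split; [lra|].
  assert (B : forall w, (c <= Cmod w)%R -> w <> 0 /\ (Cmod (/ w) <= / c)%R).
  { intros w Hw. assert (N : w <> 0) by (apply Cmod_gt_0; lra). split; [exact N|]. rewrite Cmod_inv by exact N.
    apply Rinv_le_contravar; lra. }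
  intros w Hw. destruct (B w Hw) as [N L]. pose proof (Cmod_ge_0 (/ w)).
  assert (L2 : (Cmod (/ w * / w) <= / c * / c)%R) by (rewrite Cmod_mult; apply Rmult_le_compat; lra).
  split; [lra|split].
  - rewrite Cmod_opp. lra.
  - intros w' Hw'. destruct (B w' Hw') as [N' L'].
    replace (/ w' - / w - - (/ w * / w) * (w' - w)) with ((/ w * / w) * / w' * ((w' - w) * (w' - w))) by (field; auto).
    rewrite (Cmod_mult _ ((w' - w) * (w' - w))), (Cmod_mult (/ w * / w)), (Cmod_mult (w' - w)).
    pose proof (Cmod_ge_0 (w' - w)). pose proof (Cmod_ge_0 (/ w')). pose proof (Cmod_ge_0 (/ w * / w)).
    assert (Cmod (/ w * / w) * Cmod (/ w') <= / c * / c * / c)%R by (apply Rmult_le_compat; lra).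
    replace (Cmod (w' - w) * Cmod (w' - w))%R with (Cmod (w' - w) ^ 2)%R by ring.
    apply Rmult_le_compat_r; [apply pow2_ge_0|lra].
Qed.

Lemma taylor2_div (U : C -> Prop) (F G : C -> C) (c : R) : (0 < c)%R -> (forall w, U w -> (c <= Cmod (G w))%R) ->
  taylor2 U F -> taylor2 U G -> taylor2 U (fun w => F w / G w).
Proof.
  intros Hc HG HF Hg. apply taylor2_mult; [exact HF|].
  apply taylor2_comp with (V := fun w => (c <= Cmod w)%R); [exact HG|apply taylor2_inv; exact Hc|exact Hg].
Qed.

(** The derivative of the sum is the termwise sum of the D k, chosen pointwise. All three estimates
    are then sums of the termwise ones, with total constant bounding the partial sums of b. *)
Lemma taylor2_series (U : C -> Prop) (f D : nat -> C -> C) (b : nat -> R) (G : C -> C) :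
  summable b -> (forall k, taylor2_with U (f k) (D k) (b k)) -> (forall w, U w -> Cser (fun k => f k w) (G w)) -> taylor2 U G.
Proof.
  intros Hb H HG. destruct Hb as [Hb0 [B HB]].
  assert (HD : forall w, exists d, U w -> Cser (fun k => D k w) d).
  { intros w. destruct (classic (U w)) as [Hw|Hw]; [|exists 0; tauto].
    destruct (dom_ser (fun k => D k w) b) as [d Hd]; [split; eauto|intros k; apply (H k w Hw)|].
    exists d. intros _. exact Hd. }
  pose (DG := fun w => proj1_sig (constructive_indefinite_description _ (HD w))).
  assert (HDG : forall w, U w -> Cser (fun k => D k w) (DG w)) by (intros w; unfold DG; apply (proj2_sig (constructive_indefinite_description _ (HD w)))).
  exists DG, B.
  split. { apply Rle_trans with (rsum b 0); [simpl; lra|apply HB]. }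
  intros w Hw. specialize (HDG w Hw). pose proof (HG w Hw) as Gw.
  split; [|split].
  - apply Cser_bound with (2 := HB) (3 := Gw). intros k. apply (H k w Hw).
  - apply Cser_bound with (2 := HB) (3 := HDG). intros k. apply (H k w Hw).
  - intros w' Hw'. pose proof (HG w' Hw') as Gw'.
    apply Cser_bound with (a := fun k => f k w' + (- (1)) * f k w + (- (w' - w)) * D k w) (b := fun k => (Cmod (w' - w) ^ 2 * b k)%R).
    + intros k. destruct (H k w Hw) as [_ [_ E]]. specialize (E w' Hw').
      replace (f k w' + (- (1)) * f k w + (- (w' - w)) * D k w) with (f k w' - f k w - D k w * (w' - w)) by ring. lra.
    + intros n. rewrite rsum_scal. rewrite Rmult_comm. apply Rmult_le_compat_r; [apply pow2_ge_0|apply HB].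
    + replace (G w' - G w - DG w * (w' - w)) with (G w' + (- (1)) * G w + (- (w' - w)) * DG w) by ring.
      apply Cser_plus; [apply Cser_plus; [exact Gw'|apply Cser_scal; exact Gw]|apply Cser_scal; exact HDG].
Qed.

Lemma taylor2_holo (U : C -> Prop) (G : C -> C) (z : C) (r : R) : (0 < r)%R ->
  (forall w, (Cmod (w - z) < r)%R -> U w) -> taylor2 U G -> holo_at G z.
Proof.
  intros Hr HU [D [K [HK H]]].
  assert (Uz : U z) by (apply HU; replace (z - z) with (RtoC 0) by ring; rewrite Cmod_0; exact Hr).
  destruct (H z Uz) as [_ [_ E]]. exists (D z). split.
  { apply (@is_linear_scal_l C_AbsRing C_NormedModule). }
  intros x Hx. assert (z = x) as <-.
  { apply (@is_filter_lim_locally_unique C_AbsRing (AbsRing_NormedModule C_AbsRing)). exact Hx. }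
  intros eps. pose (d := Rmin r (eps / (K + 1))).
  assert (Pe : (0 < eps / (K + 1))%R) by (apply Rdiv_lt_0_compat; [apply cond_pos|lra]).
  assert (Hd : (0 < d)%R) by (apply Rmin_glb_lt; assumption).
  apply (@locally_le_locally_norm C_AbsRing (AbsRing_NormedModule C_AbsRing)).
  exists (mkposreal d Hd). intros y Hy.
  assert (Hy' : (Cmod (y - z) < d)%R) by exact Hy.
  assert (L1 : (d <= r)%R) by apply Rmin_l. assert (L2 : (d <= eps / (K + 1))%R) by apply Rmin_r.
  specialize (E y (HU y ltac:(lra))).
  change (Cmod ((G y - G z) - (y - z) * D z) <= eps * Cmod (y - z))%R.
  replace (G y - G z - (y - z) * D z) with (G y - G z - D z * (y - z)) by ring.
  eapply Rle_trans; [exact E|]. pose proof (Cmod_ge_0 (y - z)).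
  assert (Q : (Cmod (y - z) * (K + 1) <= eps)%R).
  { apply Rle_trans with (eps / (K + 1) * (K + 1))%R; [apply Rmult_le_compat_r; lra|right; field; lra]. }
  nra.
Qed.

(** * Theta series *)

Ltac push_RtoC := repeat first [rewrite plus_IZR | rewrite minus_IZR | rewrite mult_IZR | rewrite opp_IZR];
  repeat first [rewrite RtoC_plus | rewrite RtoC_minus | rewrite RtoC_mult | rewrite RtoC_opp | rewrite RtoC_div by lra].

Local Notation zc k := (RtoC (IZR k)).

(** Choice makes the sum a total function. Its value is unspecified for a divergent series, and
    [zsum_spec] identifies it whenever the series converges. *)
Definition zsum (f : Z -> C) : C := epsilon (inhabits (RtoC 0)) (zser f).

Lemma zsum_spec (f : Z -> C) (s : C) : zser f s -> zsum f = s.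
Proof.
  intros H. apply (zser_unique f); [|exact H]. apply (epsilon_spec (inhabits (RtoC 0)) (zser f)). exists s. exact H.
Qed.

Lemma zsum_zser (f : Z -> C) (b : nat -> R) : summable b -> zdom f b -> zser f (zsum f).
Proof. intros Hb H. destruct (zser_ex f b Hb H) as [s Hs]. rewrite (zsum_spec f s Hs). exact Hs. Qed.

(** The single weight (1 + |e|)^2 dominates 1, |e| and |e|^2, which are the factors needed for the
    value, the derivative and the second-order remainder. *)
Lemma taylor2_with_Cexp_lin (U : C -> Prop) (e p : C) (B : R) :
  (forall w, U w -> ((1 + Cmod e) ^ 2 * Cmod (Cexp (p + e * w)) <= B)%R) ->
  taylor2_with U (fun w => Cexp (p + e * w)) (fun w => e * Cexp (p + e * w)) (20 * B).
Proof.
  intros H w Hw. pose proof (H w Hw) as Bw. pose proof (Cmod_ge_0 e). pose proof (Cmod_ge_0 (Cexp (p + e * w))).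
  assert (B0 : (0 <= B)%R). { eapply Rle_trans; [|exact Bw]. apply Rmult_le_pos; [apply pow2_ge_0|assumption]. }
  split; [|split].
  - nra.
  - rewrite Cmod_mult. nra.
  - intros w' Hw'. pose proof (H w' Hw') as Bw'. pose proof (Cmod_ge_0 (Cexp (p + e * w'))).
    replace (e * Cexp (p + e * w) * (w' - w)) with (Cexp (p + e * w) * ((p + e * w') - (p + e * w))) by ring.
    eapply Rle_trans; [apply Cexp_rem|].
    replace (p + e * w' - (p + e * w)) with (e * (w' - w)) by ring. rewrite Cmod_mult.
    set (d := Cmod (w' - w)). set (x := Cmod (Cexp (p + e * w))) in *. set (y := Cmod (Cexp (p + e * w'))) in *.
    assert (Cmod e ^ 2 * x <= B)%R by nra. assert (Cmod e ^ 2 * y <= B)%R by nra.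
    replace (10 * (Cmod e * d) ^ 2 * (x + y))%R with (10 * (Cmod e ^ 2 * x + Cmod e ^ 2 * y) * d ^ 2)%R by ring.
    apply Rmult_le_compat_r; [apply pow2_ge_0|lra].
Qed.

(** Serves two purposes: theta series as functions of z, and Klein forms as functions of t. In both
    the exponents are affine in the variable. *)
Lemma taylor2_zser_Cexp (U : C -> Prop) (e p : Z -> C) (b : nat -> R) (G : C -> C) : summable b ->
  (forall w, U w -> forall k, ((1 + Cmod (e k)) ^ 2 * Cmod (Cexp (p k + e k * w)) <= b (Z.abs_nat k))%R) ->
  (forall w, U w -> zser (fun k => Cexp (p k + e k * w)) (G w)) -> taylor2 U G.
Proof.
  intros Hb H HG.
  apply taylor2_series with (f := fun k w => sym (fun j => Cexp (p j + e j * w)) k)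
    (D := fun k w => sym (fun j => e j * Cexp (p j + e j * w)) k) (b := fun k => (40 * b k)%R).
  - apply summable_scal; [lra|exact Hb].
  - assert (S1 : forall j, taylor2_with U (fun w => Cexp (p j + e j * w)) (fun w => e j * Cexp (p j + e j * w)) (20 * b (Z.abs_nat j))).
    { intros j. apply taylor2_with_Cexp_lin. intros w Hw. apply H; exact Hw. }
    intros [|k].
    + apply taylor2_with_mono with (2 := S1 0%Z). simpl. pose proof (proj1 Hb O). lra.
    + intros w Hw. destruct (S1 (Z.of_nat (S k)) w Hw) as [A1 [A2 A3]]. destruct (S1 (- Z.of_nat (S k))%Z w Hw) as [B1 [B2 B3]].
      rewrite Zabs2Nat.id in A1, A2, A3. replace (Z.abs_nat (- Z.of_nat (S k))) with (S k) in B1, B2, B3 by lia.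
      rewrite !sym_S. split; [|split].
      * eapply Rle_trans; [apply Cmod_triangle|]. lra.
      * eapply Rle_trans; [apply Cmod_triangle|]. lra.
      * intros w' Hw'. specialize (A3 w' Hw'). specialize (B3 w' Hw'). rewrite !sym_S.
        match goal with |- (Cmod ?x <= _)%R => match type of A3 with (Cmod ?y <= _)%R => match type of B3 with (Cmod ?z <= _)%R =>
          replace x with (y + z) by ring end end end.
        eapply Rle_trans; [apply Cmod_triangle|]. lra.
  - exact HG.
Qed.

(** Completing the square gives A x - c x^2 <= (A+1)^2/(4c) - x, so Gaussian decay is bounded by a
    geometric sequence in |k|. *)
Lemma summable_gauss (A c : R) : (0 < c)%R -> exists b, summable b /\
  forall k : Z, (exp (A * Rabs (IZR k) - c * IZR k ^ 2) <= b (Z.abs_nat k))%R.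
Proof.
  intros Hc. exists (fun n => (exp ((A + 1) ^ 2 / (4 * c)) * exp (-1) ^ n)%R). split.
  - apply summable_geom; [|left; apply exp_pos]. split; [left; apply exp_pos|]. rewrite <- exp_0. apply exp_increasing. lra.
  - intros k.
    assert (E : forall n, (exp (-1) ^ n = exp (- INR n))%R).
    { induction n; [simpl; rewrite Ropp_0, exp_0; reflexivity|]. simpl pow. rewrite IHn, <- exp_plus, S_INR. f_equal. ring. }
    rewrite E, <- exp_plus.
    replace (INR (Z.abs_nat k)) with (Rabs (IZR k)) by (rewrite INR_IZR_INZ, Zabs2Nat.id_abs, abs_IZR; reflexivity).
    rewrite <- (pow2_abs (IZR k)). set (x := Rabs (IZR k)).
    assert (Q : (A * x - c * x ^ 2 <= (A + 1) ^ 2 / (4 * c) + - x)%R).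
    { apply Rminus_le. replace (A * x - c * x ^ 2 - ((A + 1) ^ 2 / (4 * c) + - x))%R with (- (c * (x - (A + 1) / (2 * c)) ^ 2))%R by (field; lra).
      pose proof (pow2_ge_0 (x - (A + 1) / (2 * c))). nra. }
    destruct Q as [Q|Q]; [left; apply exp_increasing; exact Q|rewrite Q; lra].
Qed.

Lemma exp_le (x y : R) : (x <= y)%R -> (exp x <= exp y)%R.
Proof. intros [H|H]; [left; apply exp_increasing; exact H|rewrite H; lra]. Qed.

Definition Th_term (z t : C) (k : Z) : C := qe (zc k * z + RtoC (IZR k * (IZR k - 1) / 2) * t).

Definition Th (z t : C) : C := zsum (Th_term z t).

Lemma Cmod_Th_term (z t : C) (k : Z) :
  Cmod (Th_term z t k) = exp (- (2 * PI * (IZR k * Im z + IZR k * (IZR k - 1) / 2 * Im t))).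
Proof. unfold Th_term. rewrite Cmod_qe. f_equal. destruct z, t. simpl. ring. Qed.

Lemma Th_term_dom (t : C) (R0 : R) : in_H t -> exists b, summable b /\ forall z, (Cmod z <= R0)%R ->
  forall k, ((1 + 2 * PI * Rabs (IZR k)) ^ 2 * Cmod (Th_term z t k) <= b (Z.abs_nat k))%R.
Proof.
  intros Ht. unfold in_H in Ht. pose proof PI_RGT_0 as P.
  (* The summand 4 pi absorbs the weight, since (1 + y)^2 <= exp(2y) with y = 2 pi |k|. The term 2
     pi R0 bounds the contribution of z, and pi Im t that of the linear part of k(k-1)/2. *)
  destruct (summable_gauss (4 * PI + 2 * PI * R0 + PI * Im t) (PI * Im t)) as [b [Hb H]]; [nra|].
  exists b. split; [exact Hb|]. intros z Hz k. eapply Rle_trans; [|apply H].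
  rewrite Cmod_Th_term. set (x := Rabs (IZR k)). assert (Hx : (0 <= x)%R) by apply Rabs_pos.
  apply Rle_trans with (exp (2 * (2 * PI * x)) * exp (- (2 * PI * (IZR k * Im z + IZR k * (IZR k - 1) / 2 * Im t))))%R.
  - apply Rmult_le_compat_r; [left; apply exp_pos|].
    replace (2 * (2 * PI * x))%R with (2 * PI * x + 2 * PI * x)%R by ring. rewrite exp_plus.
    replace ((1 + 2 * PI * x) ^ 2)%R with ((1 + 2 * PI * x) * (1 + 2 * PI * x))%R by ring.
    pose proof (exp_ineq1_le (2 * PI * x)). assert (0 <= 2 * PI * x)%R by (apply Rmult_le_pos; lra). apply Rmult_le_compat; lra.
  - rewrite <- exp_plus. apply exp_le.
    assert (I1 : (Rabs (Im z) <= R0)%R).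
    { eapply Rle_trans; [|exact Hz]. pose proof (Rmax_Cmod z). pose proof (Rmax_r (Rabs (fst z)) (Rabs (snd z))). unfold Im. lra. }
    assert (I2 : (- (IZR k * Im z) <= x * R0)%R).
    { eapply Rle_trans; [apply Rle_abs|]. rewrite Rabs_Ropp, Rabs_mult. apply Rmult_le_compat_l; assumption. }
    assert (I3 : (IZR k * Im t <= x * Im t)%R) by (apply Rmult_le_compat_r; [lra|apply Rle_abs]).
    nra.
Qed.

Lemma Th_term_zdom (z t : C) : in_H t -> exists b, summable b /\ zdom (Th_term z t) b.
Proof.
  intros Ht. destruct (Th_term_dom t (Cmod z) Ht) as [b [Hb H]]. exists b. split; [exact Hb|].
  intros k. eapply Rle_trans; [|apply (H z (Rle_refl _) k)].
  pose proof (Cmod_ge_0 (Th_term z t k)). pose proof (Rabs_pos (IZR k)). pose proof PI_RGT_0.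
  assert (0 <= 2 * PI * Rabs (IZR k))%R by (apply Rmult_le_pos; lra).
  rewrite <- (Rmult_1_l (Cmod (Th_term z t k))) at 1. apply Rmult_le_compat_r; [assumption|]. nra.
Qed.

Lemma Th_zser (z t : C) : in_H t -> zser (Th_term z t) (Th z t).
Proof. intros Ht. destruct (Th_term_zdom z t Ht) as [b [Hb H]]. apply zsum_zser with b; assumption. Qed.

Lemma taylor2_Th (t : C) (R0 : R) : in_H t -> taylor2 (fun z => (Cmod z <= R0)%R) (fun z => Th z t).
Proof.
  intros Ht. destruct (Th_term_dom t R0 Ht) as [b [Hb H]].
  assert (E : forall k w, Cexp (2 * RtoC PI * Ci * (RtoC (IZR k * (IZR k - 1) / 2) * t) + 2 * RtoC PI * Ci * zc k * w) = Th_term w t k).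
  { intros k w. unfold Th_term, qe. f_equal. ring. }
  apply taylor2_zser_Cexp with (e := fun k => 2 * RtoC PI * Ci * zc k) (p := fun k => 2 * RtoC PI * Ci * (RtoC (IZR k * (IZR k - 1) / 2) * t)) (b := b).
  - exact Hb.
  - intros w Hw k. rewrite E.
    replace (Cmod (2 * RtoC PI * Ci * zc k)) with (2 * PI * Rabs (IZR k))%R; [apply H; exact Hw|].
    rewrite !Cmod_mult, Cmod_Ci, !Cmod_R. rewrite (Rabs_pos_eq 2) by lra. rewrite (Rabs_pos_eq PI); [ring|].
    pose proof PI_RGT_0; lra.
  - intros w Hw. apply zser_ext with (Th_term w t); [|apply Th_zser; exact Ht]. intros k. symmetry. apply E.
Qed.

Lemma Th_1 (z t : C) : Th (z + 1) t = Th z t.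
Proof.
  unfold Th. replace (Th_term (z + 1) t) with (Th_term z t); [reflexivity|].
  apply functional_extensionality. intros k. unfold Th_term.
  rewrite <- (qe_period _ k). f_equal. ring.
Qed.

Lemma Th_t (z t : C) : in_H t -> Th (z + t) t = qe (- z) * Th z t.
Proof.
  intros Ht. apply zsum_spec. apply zser_ext with (fun k => qe (- z) * Th_term z t (k + 1)%Z).
  - intros k. unfold Th_term. rewrite <- qe_plus. f_equal. push_RtoC. field.
  - apply zser_scal. destruct (Th_term_zdom z t Ht) as [b [Hb H]]. apply zser_S with b; [assumption..|]. apply Th_zser, Ht.
Qed.

Lemma quasi_1 (G : C -> C) : (forall z, G (z + 1) = G z) -> forall (m : Z) z, G (z + zc m) = G z.
Proof.
  intros H m.
  assert (P : forall n z, G (z + RtoC (INR n)) = G z).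
  { induction n; intros z. { simpl. f_equal. ring. } rewrite S_INR, RtoC_plus, Cplus_assoc, H. apply IHn. }
  intros z. destruct (Z_le_gt_dec 0 m) as [L|L].
  - rewrite <- (Z2Nat.id m L), <- INR_IZR_INZ. apply P.
  - replace m with (- Z.of_nat (Z.to_nat (- m)))%Z by lia.
    rewrite opp_IZR, <- INR_IZR_INZ, RtoC_opp. rewrite <- (P (Z.to_nat (- m))). f_equal. ring.
Qed.

Lemma quasi_t (G : C -> C) (t : C) : (forall z, G (z + t) = qe (- z) * G z) ->
  forall (m : Z) z, G (z + zc m * t) = qe (- (zc m * z) - RtoC (IZR m * (IZR m - 1) / 2) * t) * G z.
Proof.
  intros H.
  assert (P : forall n z, G (z + zc (Z.of_nat n) * t) = qe (- (zc (Z.of_nat n) * z) - RtoC (IZR (Z.of_nat n) * (IZR (Z.of_nat n) - 1) / 2) * t) * G z).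
  { induction n; intros z.
    { simpl Z.of_nat. replace (z + 0 * t) with z by ring.
      replace (- (0 * z) - RtoC (0 * (0 - 1) / 2) * t) with (RtoC 0) by (push_RtoC; field). rewrite qe_0. ring. }
    rewrite Nat2Z.inj_succ. unfold Z.succ.
    replace (z + zc (Z.of_nat n + 1) * t) with (z + zc (Z.of_nat n) * t + t) by (push_RtoC; ring).
    rewrite H, IHn, Cmult_assoc, <- qe_plus. f_equal. f_equal. push_RtoC. field. }
  intros m z. destruct (Z_le_gt_dec 0 m) as [L|L].
  - rewrite <- (Z2Nat.id m L). apply P.
  - replace m with (- Z.of_nat (Z.to_nat (- m)))%Z by lia. set (n := Z.to_nat (- m)).
    (* For negative m the law is the positive case read backwards from the translated point w. *)
    set (w := z + zc (- Z.of_nat n) * t).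
    replace (G z) with (G (w + zc (Z.of_nat n) * t)) by (unfold w; f_equal; push_RtoC; ring).
    rewrite P, Cmult_assoc, <- qe_plus.
    replace (- (zc (- Z.of_nat n) * z) - RtoC (IZR (- Z.of_nat n) * (IZR (- Z.of_nat n) - 1) / 2) * t + (- (zc (Z.of_nat n) * w) - RtoC (IZR (Z.of_nat n) * (IZR (Z.of_nat n) - 1) / 2) * t)) with (RtoC 0).
    { rewrite qe_0. ring. }
    unfold w. push_RtoC. field.
Qed.

(** * Riemann means and finite Fourier analysis of quasi-periodic functions *)

Definition fr (N j : nat) : C := RtoC (INR j / INR N).

(** Discrete stand-in for the integral of G over a unit segment starting at w, that is, for the
    zeroth Fourier coefficient. *)
Definition Rmean (G : C -> C) (N : nat) (w : C) : C := RtoC (/ INR N) * csum (fun j => G (w + fr N j)) N.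

Lemma fr_S (N j : nat) : (0 < N)%nat -> fr N (S j) = fr N j + RtoC (/ INR N).
Proof. intros H. apply lt_0_INR in H. unfold fr. rewrite S_INR, <- RtoC_plus. f_equal. field. lra. Qed.

Lemma fr_N (N j : nat) : (0 < N)%nat -> fr N (j + N) = fr N j + 1.
Proof. intros H. apply lt_0_INR in H. unfold fr. rewrite plus_INR, <- RtoC_plus. f_equal. field. lra. Qed.

Lemma fr_0 (N : nat) : fr N 0 = 0.
Proof. unfold fr. simpl. f_equal. unfold Rdiv. ring. Qed.

Lemma Cmod_fr (N j m : nat) : (0 < N)%nat -> (j <= m * N)%nat -> (Cmod (fr N j) <= INR m)%R.
Proof.
  intros H Hj. apply lt_0_INR in H. unfold fr. rewrite Cmod_R. apply le_INR in Hj. rewrite mult_INR in Hj.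
  pose proof (pos_INR j). rewrite Rabs_pos_eq by (apply Rmult_le_pos; [lra|left; apply Rinv_0_lt_compat; lra]).
  apply Rmult_le_reg_r with (INR N); [lra|]. unfold Rdiv. rewrite Rmult_assoc, Rinv_l by lra. lra.
Qed.

Lemma Rmean_bound (G : C -> C) (N : nat) (w : C) (K : R) : (0 < N)%nat ->
  (forall j, (j < N)%nat -> (Cmod (G (w + fr N j)%C) <= K)%R) -> (Cmod (Rmean G N w) <= K)%R.
Proof.
  intros HN H. pose proof (lt_0_INR N HN). unfold Rmean. rewrite Cmod_mult, Cmod_R, Rabs_pos_eq by (left; apply Rinv_0_lt_compat; lra).
  pose proof (csum_bound (fun j => G (w + fr N j)) (fun _ => K) N H) as B. rewrite rsum_const in B.
  apply Rmult_le_reg_l with (INR N); [lra|]. rewrite <- Rmult_assoc, Rinv_r by lra. lra.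
Qed.

(* The sum of [G(v+1/N) - G(v)] over one period vanishes, so replacing the derivative
   by this difference quotient shows that Riemann means are asymptotically constant. *)
Lemma Rmean_step (G D : C -> C) (R0 K : R) (N : nat) (w d : C) : (0 < N)%nat -> (0 <= K)%R ->
  (forall z, G (z + 1) = G z) -> taylor2_with (fun z => (Cmod z <= R0)%R) G D K ->
  (Cmod w + 2 <= R0)%R -> (Cmod (w + d * RtoC (/ INR N)) + 2 <= R0)%R ->
  (Cmod (Rmean G N (w + d * RtoC (/ INR N))%C - Rmean G N w) <= K * (Cmod d ^ 2 + Cmod d) / INR N ^ 2)%R.
Proof.
  intros HN HK H1 H Hw Hwd. pose proof (lt_0_INR N HN) as PN. set (e := RtoC (/ INR N)).
  assert (Ee : (Cmod e = / INR N)%R) by (unfold e; rewrite Cmod_R, Rabs_pos_eq by (left; apply Rinv_0_lt_compat; lra); reflexivity).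
  assert (E : Rmean G N (w + d * e) - Rmean G N w =
    e * csum (fun j => (G (w + fr N j + d * e) - G (w + fr N j) - D (w + fr N j) * (d * e))
                     - d * (G (w + fr N j + e) - G (w + fr N j) - D (w + fr N j) * e)) N).
  { assert (T : csum (fun j => G (w + fr N (S j)) - G (w + fr N j)) N = 0).
    { rewrite (csum_telescope (fun j => G (w + fr N j))). rewrite <- (Nat.add_0_l N) at 2. rewrite fr_N, fr_0, Cplus_assoc, H1 by exact HN. ring. }
    unfold Rmean. fold e. rewrite <- (Cplus_0_r (csum _ N)). replace (RtoC 0) with (- d * csum (fun j => G (w + fr N (S j)) - G (w + fr N j)) N) by (rewrite T; ring).
    rewrite <- csum_scal, <- csum_plus.
    replace (e * csum (fun j => G (w + d * e + fr N j) + - d * (G (w + fr N (S j)) - G (w + fr N j))) N - e * csum (fun j => G (w + fr N j)) N)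
      with (e * (csum (fun j => G (w + d * e + fr N j) + - d * (G (w + fr N (S j)) - G (w + fr N j))) N + (- (1)) * csum (fun j => G (w + fr N j)) N)) by ring.
    rewrite <- csum_scal, <- csum_plus. f_equal. apply csum_ext. intros j _. rewrite fr_S by exact HN. fold e.
    replace (w + (fr N j + e)) with (w + fr N j + e) by ring. replace (w + d * e + fr N j) with (w + fr N j + d * e) by ring. ring. }
  rewrite E, Cmod_mult, Ee.
  assert (B : (Cmod (csum (fun j => (G (w + fr N j + d * e) - G (w + fr N j) - D (w + fr N j) * (d * e))
                     - d * (G (w + fr N j + e) - G (w + fr N j) - D (w + fr N j) * e))%C N) <= rsum (fun _ => K * (Cmod d ^ 2 + Cmod d) / INR N ^ 2) N)%R).
  { apply csum_bound. intros j Hj.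
    pose proof (Cmod_fr N j 1 HN ltac:(lia)) as F1. pose proof (Cmod_fr N (S j) 1 HN ltac:(lia)) as F2. rewrite fr_S in F2 by exact HN. fold e in F2. simpl INR in F1, F2.
    assert (U0 : (Cmod (w + fr N j) <= R0)%R) by (eapply Rle_trans; [apply Cmod_triangle|lra]).
    destruct (H _ U0) as [_ [_ Q]].
    assert (U1 : (Cmod (w + fr N j + e) <= R0)%R).
    { replace (w + fr N j + e) with (w + (fr N j + e)) by ring. eapply Rle_trans; [apply Cmod_triangle|lra]. }
    assert (U2 : (Cmod (w + fr N j + d * e) <= R0)%R).
    { replace (w + fr N j + d * e) with (w + d * e + fr N j) by ring. eapply Rle_trans; [apply Cmod_triangle|]. fold e in Hwd. lra. }
    pose proof (Q _ U1) as Q1. pose proof (Q _ U2) as Q2.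
    replace (w + fr N j + e - (w + fr N j)) with e in Q1 by ring.
    replace (w + fr N j + d * e - (w + fr N j)) with (d * e) in Q2 by ring.
    rewrite Cmod_mult in Q2. rewrite Ee in Q1, Q2.
    eapply Rle_trans; [apply Cmod_triangle_minus|]. rewrite (Cmod_mult d (_ - _)).
    pose proof (Rmult_le_compat_l _ _ _ (Cmod_ge_0 d) Q1).
    replace (K * (Cmod d ^ 2 + Cmod d) / INR N ^ 2)%R with (K * (Cmod d * / INR N) ^ 2 + Cmod d * (K * (/ INR N) ^ 2))%R by (field; lra). lra. }
  rewrite rsum_const in B.
  apply Rmult_le_reg_l with (INR N); [lra|]. rewrite <- Rmult_assoc, Rinv_r by lra. lra.
Qed.

(** Plays the part of shifting a contour. One walks from w' to w in N equal steps; each changes the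
    mean by O(1/N^2), so the total change is O(1/N). *)
Lemma Rmean_indep (G : C -> C) (w w' : C) : (forall R0, taylor2 (fun z => (Cmod z <= R0)%R) G) ->
  (forall z, G (z + 1) = G z) -> Ccv (fun N => Rmean G (S N) w - Rmean G (S N) w') 0.
Proof.
  intros Hsm H1. destruct (Hsm (Cmod w + Cmod w' + 2)%R) as [D [K [HK H]]].
  set (d := w - w'). set (Q := (K * (Cmod d ^ 2 + Cmod d))%R).
  assert (HQ : (0 <= Q)%R). { apply Rmult_le_pos; [exact HK|]. pose proof (pow2_ge_0 (Cmod d)). pose proof (Cmod_ge_0 d). lra. }
  assert (B : forall N, (0 < N)%nat -> (Cmod (Rmean G N w - Rmean G N w') <= Q / INR N)%R).
  { intros N HN. pose proof (lt_0_INR N HN) as PN.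
    assert (W : forall i, (i <= N)%nat -> (Cmod (w' + d * fr N i) <= Cmod w + Cmod w')%R).
    { intros i Hi. unfold d, fr. apply le_INR in Hi. pose proof (pos_INR i). set (s := (INR i / INR N)%R).
      assert (Hs : (0 <= s <= 1)%R). { unfold s. split; [apply Rmult_le_pos; [lra|left; apply Rinv_0_lt_compat; lra]|].
        apply Rmult_le_reg_r with (INR N); [lra|]. unfold Rdiv. rewrite Rmult_assoc, Rinv_l by lra. lra. }
      replace (w' + (w - w') * RtoC s) with (w * RtoC s + w' * RtoC (1 - s)) by (rewrite RtoC_minus; ring).
      eapply Rle_trans; [apply Cmod_triangle|]. rewrite !Cmod_mult, !Cmod_R, !Rabs_pos_eq by lra.
      pose proof (Cmod_ge_0 w). pose proof (Cmod_ge_0 w'). nra. }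
    assert (I : forall i, (i <= N)%nat -> (Cmod (Rmean G N (w' + d * fr N i)%C - Rmean G N w') <= INR i * (Q / INR N ^ 2))%R).
    { induction i; intros Hi.
      - rewrite fr_0. replace (w' + d * 0) with w' by ring. replace (Rmean G N w' - Rmean G N w') with (RtoC 0) by ring. rewrite Cmod_0. simpl. lra.
      - specialize (IHi ltac:(lia)). pose proof (W i ltac:(lia)) as W1. pose proof (W (S i) Hi) as W2.
        rewrite fr_S in * by exact HN. replace (w' + d * (fr N i + RtoC (/ INR N))) with (w' + d * fr N i + d * RtoC (/ INR N)) in * by ring.
        pose proof (Rmean_step G D _ K N (w' + d * fr N i) d HN HK H1 H ltac:(lra) ltac:(lra)) as St. fold Q in St.
        pose proof (Cmod_triangle_via (Rmean G N (w' + d * fr N i + d * RtoC (/ INR N))) (Rmean G N (w' + d * fr N i)) (Rmean G N w')).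
        rewrite S_INR. lra. }
    specialize (I N (Nat.le_refl _)). replace (w' + d * fr N N) with w in I.
    - replace (Q / INR N)%R with (INR N * (Q / INR N ^ 2))%R by (field; lra). exact I.
    - rewrite <- (Nat.add_0_l N) at 2. rewrite fr_N, fr_0 by exact HN. unfold d. ring. }
  intros eps He. destruct (INR_unbounded (Q / eps)) as [n0 Hn0]. exists n0. intros n Hn.
  replace (Rmean G (S n) w - Rmean G (S n) w' - 0) with (Rmean G (S n) w - Rmean G (S n) w') by ring.
  eapply Rle_lt_trans; [apply B; lia|].
  assert (L : (Q / eps < INR (S n))%R). { apply Rlt_le_trans with (INR n0); [exact Hn0|]. apply le_INR. lia. }
  pose proof (lt_0_INR (S n) ltac:(lia)).
  apply Rmult_lt_reg_r with (INR (S n)); [lra|]. unfold Rdiv. rewrite Rmult_assoc, Rinv_l by lra.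
  apply Rmult_lt_compat_r with (r := eps) in L; [|exact He]. unfold Rdiv in L. rewrite Rmult_assoc, Rinv_l in L by lra. lra.
Qed.

Lemma Cmod_qe_sub1 (x : R) : (Cmod (qe (RtoC x) - 1)%C ^ 2 = 4 * sin (PI * x) ^ 2)%R.
Proof.
  assert (E : qe (RtoC x) = (cos (2 * (PI * x)), sin (2 * (PI * x)))).
  { unfold qe, Cexp. simpl.
    replace (((2 * PI - 0 * 0) * 0 - (2 * 0 + 0 * PI) * 1) * x - ((2 * PI - 0 * 0) * 1 + (2 * 0 + 0 * PI) * 0) * 0)%R with 0%R by ring.
    replace (((2 * PI - 0 * 0) * 0 - (2 * 0 + 0 * PI) * 1) * 0 + ((2 * PI - 0 * 0) * 1 + (2 * 0 + 0 * PI) * 0) * x)%R with (2 * (PI * x))%R by ring.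
    rewrite exp_0. f_equal; ring. }
  rewrite E, Cmod2_alt. simpl. rewrite sin_2a, cos_2a_sin.
  pose proof (sin2_cos2 (PI * x)) as H. unfold Rsqr in H.
  set (s := sin (PI * x)) in *. set (c := cos (PI * x)) in *.
  transitivity (4 * (s * s) * (s * s + c * c))%R; [ring|rewrite H; ring].
Qed.

(** A crude Jordan inequality. From |sin v - v| <= v^2 one gets sin v >= v/4 up to 3/4, and
    monotonicity covers the rest because pi/2 <= 2. *)
Lemma sin_lower (u : R) : (0 <= u <= PI / 2)%R -> (u / 12 <= sin u)%R.
Proof.
  intros Hu. assert (S : forall v, (0 <= v <= 3 / 4)%R -> (v / 4 <= sin v)%R).
  { intros v Hv. pose proof (sin_x_le v) as B. apply Rabs_le_between in B. nra. }
  destruct (Rle_lt_dec u (3/4)) as [L|L]; [specialize (S u ltac:(lra)); lra|].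
  pose proof (S (3/4)%R ltac:(lra)). pose proof PI_4.
  assert (sin (3/4) <= sin u)%R by (left; apply sin_increasing_1; lra). lra.
Qed.

Lemma Cmod_qe_sub1_lower (x : R) : (Rabs x <= 1 / 2)%R -> (x ^ 2 / 9 <= Cmod (qe (RtoC x) - 1)%C ^ 2)%R.
Proof.
  intros Hx. rewrite Cmod_qe_sub1. pose proof PI2_1. apply Rabs_le_between in Hx.
  assert (P : forall y, (0 <= y <= 1 / 2)%R -> (y ^ 2 / 9 <= 4 * sin (PI * y) ^ 2)%R).
  { intros y Hy. pose proof (sin_lower (PI * y) ltac:(nra)). assert (y / 6 <= sin (PI * y))%R by nra. nra. }
  destruct (Rle_lt_dec 0 x) as [L|L]; [apply P; lra|].
  specialize (P (- x)%R ltac:(lra)). replace (PI * - x)%R with (- (PI * x))%R in P by ring. rewrite sin_neg in P.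
  nra.
Qed.

Lemma qe_neq_1 (x : R) : (0 < x < 1)%R -> qe (RtoC x) <> 1.
Proof.
  intros Hx E. pose proof (Cmod_qe_sub1 x) as H. rewrite E in H.
  replace (1 - 1) with (RtoC 0) in H by ring. rewrite Cmod_0 in H.
  pose proof PI_RGT_0. pose proof (sin_gt_0 (PI * x) ltac:(nra) ltac:(nra)). nra.
Qed.

Lemma sym_csum (a : Z -> nat -> C) (N m : nat) :
  csum (sym (fun k => csum (a k) N)) m = csum (fun j => csum (sym (fun k => a k j)) m) N.
Proof.
  rewrite <- csum_swap. apply csum_ext. intros [|i] _; [reflexivity|].
  rewrite sym_S, <- csum_plus. reflexivity.
Qed.

Lemma sym_scal (c : C) (f : Z -> C) (m : nat) : csum (sym (fun k => c * f k)) m = c * csum (sym f) m.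
Proof. rewrite <- csum_scal. apply csum_ext. intros [|i] _; [reflexivity|]. rewrite !sym_S. ring. Qed.

Lemma dirichlet (x : C) (m : nat) :
  (qe x - 1) * csum (sym (fun k => qe (zc k * x))) (S m) = qe (zc (Z.of_nat m + 1) * x) - qe (zc (- Z.of_nat m) * x).
Proof.
  induction m.
  - simpl. replace (0 * x) with (RtoC 0) by ring. replace (1 * x) with x by ring. rewrite qe_0. ring.
  - change (csum (sym (fun k => qe (zc k * x))) (S (S m))) with (csum (sym (fun k => qe (zc k * x))) (S m) + sym (fun k => qe (zc k * x)) (S m)).
    rewrite Cmult_plus_distr_l, IHm, sym_S.
    replace (zc (Z.of_nat (S m) + 1) * x) with (zc (Z.of_nat (S m)) * x + x) by (rewrite Nat2Z.inj_succ; unfold Z.succ; push_RtoC; ring).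
    replace (zc (- Z.of_nat m) * x) with (zc (- Z.of_nat (S m)) * x + x) by (rewrite Nat2Z.inj_succ; unfold Z.succ; push_RtoC; ring).
    replace (Z.of_nat m + 1)%Z with (Z.of_nat (S m)) by lia.
    rewrite !qe_plus. ring.
Qed.

(** By quasi-periodicity this is the k-th discrete Fourier coefficient of G at the 2M+1 points z +
    j/(2M+1). Written as a theta term times a mean, it shows that the coefficients tend to those of
    a multiple of the theta series, because the means become independent of k. An odd number of
    points makes -M, ..., M a full residue system, matching symmetric summation. *)
Definition dft_coef (G : C -> C) (t : C) (M : nat) (z : C) (k : Z) : C := Th_term z t k * Rmean G (2 * M + 1) (z + zc k * t).

Lemma dft_coef_eq (G : C -> C) (t : C) (M : nat) (z : C) (k : Z) : (forall z, G (z + t) = qe (- z) * G z) ->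
  dft_coef G t M z k = RtoC (/ INR (2 * M + 1)) * csum (fun j => qe (zc k * (- fr (2 * M + 1) j)) * G (z + fr (2 * M + 1) j)) (2 * M + 1).
Proof.
  intros Ht. unfold dft_coef, Rmean. rewrite Cmult_assoc, (Cmult_comm (Th_term z t k)), <- Cmult_assoc, <- csum_scal. f_equal.
  apply csum_ext. intros j _. replace (z + zc k * t + fr (2 * M + 1) j) with (z + fr (2 * M + 1) j + zc k * t) by ring.
  rewrite (quasi_t G t Ht), Cmult_assoc. unfold Th_term. rewrite <- qe_plus. f_equal. f_equal. ring.
Qed.

Lemma dft_coef_inversion (G : C -> C) (t : C) (M : nat) (z : C) : (forall z, G (z + t) = qe (- z) * G z) ->
  csum (sym (dft_coef G t M z)) (S M) = G z.
Proof.
  intros Ht. set (N := (2 * M + 1)%nat). assert (HN : (0 < N)%nat) by (unfold N; lia). pose proof (lt_0_INR N HN) as PN.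
  transitivity (csum (sym (fun k => RtoC (/ INR N) * csum (fun j => qe (zc k * (- fr N j)) * G (z + fr N j)) N)) (S M)).
  { apply csum_ext. intros [|i] _; unfold sym; rewrite !(dft_coef_eq G t M z _ Ht); reflexivity. }
  rewrite sym_scal, sym_csum.
  replace N with (S (2 * M)) at 2 by (unfold N; lia). rewrite <- (Nat.add_1_r (2 * M)). fold N.
  replace (csum (fun j => csum (sym (fun k => qe (zc k * - fr N j) * G (z + fr N j))) (S M)) N) with (RtoC (INR N) * G z).
  { rewrite Cmult_assoc, <- RtoC_mult, Rinv_l by lra. ring. }
  (* Only j = 0 contributes, with the value N G(z); every further j adds a full sum of nontrivial
     roots of unity, which is 0. *)
  assert (T : forall n, (n < N)%nat -> csum (fun j => csum (sym (fun k => qe (zc k * - fr N j) * G (z + fr N j))) (S M)) (S n) = RtoC (INR N) * G z).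
  { induction n; intros Hn.
    - replace (csum (fun j => csum (sym (fun k => qe (zc k * - fr N j) * G (z + fr N j))) (S M)) 1) with
        (csum (sym (fun k => qe (zc k * - fr N 0) * G (z + fr N 0))) (S M)) by (symmetry; apply Cplus_0_l).
      rewrite fr_0. replace (z + 0) with z by ring.
      clear Hn. unfold N. clear. induction M as [|m IHm].
      + simpl. replace (0 * - 0) with (RtoC 0) by ring. rewrite qe_0. ring.
      + change (csum (sym (fun k => qe (zc k * - 0) * G z)) (S (S m))) with (csum (sym (fun k => qe (zc k * - 0) * G z)) (S m) + sym (fun k => qe (zc k * - 0) * G z) (S m)).
        rewrite IHm, sym_S. replace (zc (Z.of_nat (S m)) * - 0) with (RtoC 0) by ring. replace (zc (- Z.of_nat (S m)) * - 0) with (RtoC 0) by ring.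
        rewrite qe_0. replace (2 * S m + 1)%nat with (S (S (2 * m + 1))) by lia. rewrite !S_INR, !RtoC_plus. ring.
    - change (csum (fun j => csum (sym (fun k => qe (zc k * - fr N j) * G (z + fr N j))) (S M)) (S (S n))) with
        (csum (fun j => csum (sym (fun k => qe (zc k * - fr N j) * G (z + fr N j))) (S M)) (S n) + csum (sym (fun k => qe (zc k * - fr N (S n)) * G (z + fr N (S n)))) (S M)).
      rewrite IHn by lia.
      replace (csum (sym (fun k => qe (zc k * - fr N (S n)) * G (z + fr N (S n)))) (S M)) with (G (z + fr N (S n)) * csum (sym (fun k => qe (zc k * - fr N (S n)))) (S M)).
      2:{ rewrite <- sym_scal. apply csum_ext. intros [|i] _; unfold sym; ring. }
      replace (csum (sym (fun k => qe (zc k * - fr N (S n)))) (S M)) with (RtoC 0); [ring|].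
      apply (Cmult_reg_l (qe (- fr N (S n)) - 1)).
      { intros E. apply Ceq_minus in E. rewrite qe_opp in E.
        apply (qe_neq_1 (INR (S n) / INR N)).
        - pose proof (lt_0_INR (S n) ltac:(lia)). pose proof (lt_INR _ _ Hn). split.
          + apply Rdiv_lt_0_compat; lra.
          + apply Rmult_lt_reg_r with (INR N); [lra|]. unfold Rdiv. rewrite Rmult_assoc, Rinv_l by lra. lra.
        - fold (fr N (S n)). replace (qe (fr N (S n))) with (/ / qe (fr N (S n))) by (field; apply qe_nz). rewrite E. field. }
      rewrite dirichlet.
      (* The end points M+1 and -M of the telescoped sum differ by N, so their arguments differ by
         an integer and the two terms cancel. *)
      replace (zc (Z.of_nat M + 1) * - fr N (S n)) with (zc (- Z.of_nat M) * - fr N (S n) + zc (- Z.of_nat (S n))).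
      { rewrite qe_period. ring. }
      unfold fr. rewrite !opp_IZR, plus_IZR, <- !INR_IZR_INZ. rewrite <- !RtoC_opp, <- !RtoC_mult, <- !RtoC_plus. f_equal.
      assert (EN : INR N = (2 * INR M + 1)%R) by (unfold N; rewrite plus_INR, mult_INR; simpl; ring).
      rewrite EN in *. field. lra. }
  specialize (T (2 * M)%nat ltac:(unfold N; lia)). replace (S (2 * M)) with N in T by (unfold N; lia). symmetry. exact T.
Qed.

(** Summation by parts twice: multiplying the Fourier sum by (om - 1)^2 turns it into a sum of
    second differences of G, each at most 2K/N^2. Since |om - 1| >= |k|/(3N), this gives 9 * 2
    K/k^2. *)
Lemma dft_coef_bound (G D : C -> C) (t : C) (M : nat) (z : C) (k : Z) (K : R) : (0 <= K)%R ->
  (forall z, G (z + 1) = G z) -> (forall z, G (z + t) = qe (- z) * G z) ->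
  taylor2_with (fun w => (Cmod w <= Cmod z + 2)%R) G D K -> k <> 0%Z -> (Z.abs_nat k <= M)%nat ->
  (Cmod (dft_coef G t M z k) * IZR k ^ 2 <= 18 * K)%R.
Proof.
  intros HK H1 Ht H Hk HM. rewrite (dft_coef_eq G t M z k Ht). set (N := (2 * M + 1)%nat).
  assert (HN : (0 < N)%nat) by (unfold N; lia). pose proof (lt_0_INR N HN) as PN.
  set (om := qe (- (RtoC (IZR k / INR N)))).
  set (h := fun j => qe (zc k * - fr N j) * G (z + fr N j)). set (X := csum h N).
  assert (Hom : forall j, qe (zc k * - fr N (S j)) = om * qe (zc k * - fr N j)).
  { intros j. unfold om. rewrite <- qe_plus. f_equal. rewrite fr_S by exact HN. unfold Rdiv. rewrite RtoC_mult. ring. }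
  assert (Hper : forall j, h (j + N)%nat = h j).
  { intros j. unfold h. rewrite fr_N, Cplus_assoc, H1 by exact HN. f_equal.
    rewrite <- (qe_period (zc k * - fr N j) (- k)). f_equal. push_RtoC. ring. }
  assert (X1 : csum (fun j => h (S j)) N = X).
  { pose proof (csum_shift h N) as E. pose proof (Hper O) as P0. change (h N = h O) in P0. rewrite P0 in E. fold X in E.
    replace (csum (fun j => h (S j)) N) with (csum (fun j => h (S j)) N + h O - h O) by ring. rewrite E. ring. }
  assert (X2 : csum (fun j => h (S (S j))) N = X).
  { pose proof (csum_shift (fun j => h (S j)) N) as E. cbv beta in E. pose proof (Hper 1%nat) as P1. change (h (S N) = h 1%nat) in P1. rewrite P1, X1 in E.
    replace (csum (fun j => h (S (S j))) N) with (csum (fun j => h (S (S j))) N + h 1%nat - h 1%nat) by ring. rewrite E. ring. }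
  assert (E : (om - 1) * (om - 1) * X = csum (fun j => qe (zc k * - fr N (S (S j))) * (G (z + fr N (S (S j))) - 2 * G (z + fr N (S j)) + G (z + fr N j))) N).
  { replace ((om - 1) * (om - 1) * X) with (X + ((- (2 * om)) * X + om * om * X)) by ring.
    rewrite <- X2 at 1. rewrite <- X1 at 1. unfold X. rewrite <- !csum_scal, <- !csum_plus. apply csum_ext. intros j _.
    unfold h. rewrite !Hom. ring. }
  assert (Cqe : forall j, Cmod (qe (zc k * - fr N j)) = 1%R).
  { intros j. rewrite Cmod_qe. unfold fr. simpl. replace (- (2 * PI * (IZR k * -0 + 0 * - (INR j / INR N))))%R with 0%R by ring. apply exp_0. }
  assert (B : (Cmod ((om - 1) * (om - 1) * X) <= rsum (fun _ => 2 * K / INR N ^ 2) N)%R).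
  { rewrite E. apply csum_bound. intros j Hj. rewrite Cmod_mult, Cqe, Rmult_1_l.
    set (e := RtoC (/ INR N)).
    assert (Ee : (Cmod e = / INR N)%R) by (unfold e; rewrite Cmod_R, Rabs_pos_eq by (left; apply Rinv_0_lt_compat; lra); reflexivity).
    (* The second difference reaches the index N+1, beyond one period, hence the radius |z| + 2 in
       the hypothesis. *)
    assert (U : forall i, (i <= 2 * N)%nat -> (Cmod (z + fr N i) <= Cmod z + 2)%R).
    { intros i Hi. pose proof (Cmod_fr N i 2 HN ltac:(lia)). simpl in H0. eapply Rle_trans; [apply Cmod_triangle|]. lra. }
    destruct (H (z + fr N (S j)) (U (S j) ltac:(lia))) as [_ [_ Q]].
    pose proof (Q _ (U (S (S j)) ltac:(lia))) as Q1. pose proof (Q _ (U j ltac:(lia))) as Q2.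
    rewrite !fr_S in * by exact HN. fold e in Q1, Q2 |- *.
    replace (z + (fr N j + e + e) - (z + (fr N j + e))) with e in Q1 by ring.
    replace (z + fr N j - (z + (fr N j + e))) with (- e) in Q2 by ring. rewrite Cmod_opp in Q2. rewrite Ee in Q1, Q2.
    match goal with |- (Cmod ?x <= _)%R => match type of Q1 with (Cmod ?y <= _)%R => match type of Q2 with (Cmod ?w <= _)%R =>
          replace x with (y + w) by ring end end end.
    eapply Rle_trans; [apply Cmod_triangle|].
    replace (2 * K / INR N ^ 2)%R with (K * (/ INR N) ^ 2 + K * (/ INR N) ^ 2)%R by (field; lra). lra. }
  rewrite rsum_const, !Cmod_mult in B.
  (* The condition |k| <= M with N = 2M+1 gives |k/N| <= 1/2, the range in which the chord length is
     bounded below. *)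
  assert (Lo : (IZR k ^ 2 / INR N ^ 2 / 9 <= Cmod (om - 1) * Cmod (om - 1))%R).
  { unfold om. rewrite <- RtoC_opp. pose proof (Cmod_qe_sub1_lower (- (IZR k / INR N))) as L.
    replace ((- (IZR k / INR N)) ^ 2)%R with (IZR k ^ 2 / INR N ^ 2)%R in L by (field; lra).
    eapply Rle_trans; [apply L|right; ring].
    rewrite Rabs_Ropp, Rabs_div, (Rabs_pos_eq (INR N)) by lra.
    apply Rmult_le_reg_r with (INR N); [lra|]. unfold Rdiv. rewrite Rmult_assoc, Rinv_l by lra.
    rewrite <- abs_IZR, <- Zabs2Nat.id_abs, <- INR_IZR_INZ. apply le_INR in HM.
    assert (EN : INR N = (2 * INR M + 1)%R) by (unfold N; rewrite plus_INR, mult_INR; simpl; ring). lra. }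
  fold X. rewrite Cmod_mult, Cmod_R, Rabs_pos_eq by (left; apply Rinv_0_lt_compat; lra).
  assert (B2 : (IZR k ^ 2 / INR N ^ 2 / 9 * Cmod X <= INR N * (2 * K / INR N ^ 2))%R).
  { eapply Rle_trans; [|exact B]. apply Rmult_le_compat_r; [apply Cmod_ge_0|exact Lo]. }
  apply Rmult_le_reg_l with (/ 9 * / INR N)%R. { apply Rmult_lt_0_compat; [lra|apply Rinv_0_lt_compat; lra]. }
  replace (/ 9 * / INR N * (/ INR N * Cmod X * IZR k ^ 2))%R with (IZR k ^ 2 / INR N ^ 2 / 9 * Cmod X)%R by (field; lra).
  eapply Rle_trans; [exact B2|]. right. field. lra.
Qed.

(** * Uniqueness of the theta function *)

(** Discrete inversion writes G z as the sum of its coefficients with |k| <= M. Each coefficient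
    minus the mean at 0 times the theta term tends to 0, and the 1/k^2 bound justifies passing to
    the limit under the sum. *)
Lemma theta_mean (t : C) (G : C -> C) (z : C) : in_H t -> (forall R0, taylor2 (fun w => (Cmod w <= R0)%R) G) ->
  (forall w, G (w + 1) = G w) -> (forall w, G (w + t) = qe (- w) * G w) ->
  Ccv (fun M => G z + - Rmean G (2 * M + 1) 0 * Th z t) 0.
Proof.
  intros Ht Hsm H1 Hq.
  destruct (Th_term_zdom z t Ht) as [b [Hb Hd]].
  destruct (Hsm (Cmod z + 2)%R) as [D [K [HK H]]].
  assert (BG : forall M, (Cmod (Rmean G (2 * M + 1) 0) <= K)%R).
  { intros M. apply Rmean_bound; [lia|]. intros j Hj. apply H.
    replace (0 + fr (2 * M + 1) j) with (fr (2 * M + 1) j) by ring.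
    pose proof (Cmod_fr (2 * M + 1) j 1 ltac:(lia) ltac:(lia)) as F. change (INR 1) with 1%R in F. pose proof (Cmod_ge_0 z). lra. }
  set (tr := fun (M : nat) (k : Z) => if Z_le_dec (Z.abs k) (Z.of_nat M) then dft_coef G t M z k else 0).
  apply tannery_Z with (a := fun M k => tr M k + - Rmean G (2 * M + 1) 0 * Th_term z t k) (l := fun _ => 0)
    (* Here 72 = 4 * 18, because (n+1)^2 <= 4 n^2 for n >= 1. The shift by 1 keeps the bound
       meaningful at n = 0, where the coefficient is at most K. *)
    (b := fun n => (72 * K * / (INR n + 1) ^ 2 + K * b n)%R).
  - apply summable_plus; [apply summable_scal; [lra|apply summable_inv_sq]|apply summable_scal; assumption].
  - intros M k. eapply Rle_trans; [apply Cmod_triangle|]. apply Rplus_le_compat.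
    + assert (P : (0 < / (INR (Z.abs_nat k) + 1) ^ 2)%R). { apply Rinv_0_lt_compat, pow_lt. pose proof (pos_INR (Z.abs_nat k)). lra. }
      unfold tr. destruct (Z_le_dec (Z.abs k) (Z.of_nat M)) as [L|L].
      * destruct (Z.eq_dec k 0) as [->|Hk].
        -- simpl Z.abs_nat. simpl INR. replace (72 * K * / (0 + 1) ^ 2)%R with (72 * K)%R by field.
           unfold dft_coef. rewrite Cmod_mult. replace (Th_term z t 0) with (RtoC 1).
           2:{ unfold Th_term. rewrite <- qe_0. f_equal. push_RtoC. field. }
           rewrite Cmod_1, Rmult_1_l. apply Rle_trans with K; [|lra].
           apply Rmean_bound; [lia|]. intros j Hj. apply H. replace (z + 0 * t) with z by ring.
           pose proof (Cmod_fr (2 * M + 1) j 1 ltac:(lia) ltac:(lia)) as F. change (INR 1) with 1%R in F. eapply Rle_trans; [apply Cmod_triangle|]. lra.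
        -- pose proof (dft_coef_bound G D t M z k K HK H1 Hq H Hk ltac:(lia)) as B.
           assert (E : (IZR k ^ 2 = INR (Z.abs_nat k) ^ 2)%R) by (rewrite INR_IZR_INZ, Zabs2Nat.id_abs, abs_IZR, pow2_abs; reflexivity).
           rewrite E in B. set (x := INR (Z.abs_nat k)) in *.
           assert (Hx : (1 <= x)%R). { unfold x. apply (le_INR 1). lia. }
           pose proof (Cmod_ge_0 (dft_coef G t M z k)).
           apply Rmult_le_reg_r with ((x + 1) ^ 2)%R; [apply pow_lt; lra|]. rewrite Rmult_assoc, Rinv_l by (apply pow_nonzero; lra).
           apply Rle_trans with (Cmod (dft_coef G t M z k) * (4 * x ^ 2))%R; [apply Rmult_le_compat_l; [assumption|nra]|lra].
      * rewrite Cmod_0. apply Rmult_le_pos; lra.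
    + rewrite Cmod_mult, Cmod_opp. apply Rmult_le_compat; [apply Cmod_ge_0|apply Cmod_ge_0|apply BG|apply Hd].
  - intros k.
    assert (L : Ccv (fun M => Th_term z t k * (Rmean G (2 * M + 1) (z + zc k * t) - Rmean G (2 * M + 1) 0)) (Th_term z t k * 0)).
    { apply Ccv_scal. pose proof (Rmean_indep G (z + zc k * t) 0 Hsm H1) as I.
      apply (Ccv_subseq _ 0 (fun M => (2 * M)%nat)) in I; [|intros; lia].
      eapply Ccv_ext; [|exact I]. intros M. cbv beta. replace (S (2 * M)) with (2 * M + 1)%nat by lia. reflexivity. }
    replace (Th_term z t k * 0) with (RtoC 0) in L by ring.
    intros eps He. destruct (L eps He) as [n0 Hn]. exists (max n0 (Z.abs_nat k)). intros M HM. specialize (Hn M ltac:(lia)).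
    unfold tr. destruct (Z_le_dec (Z.abs k) (Z.of_nat M)) as [Q|Q]; [|lia]. unfold dft_coef.
    replace (Th_term z t k * Rmean G (2 * M + 1) (z + zc k * t) + - Rmean G (2 * M + 1) 0 * Th_term z t k - 0)
      with (Th_term z t k * (Rmean G (2 * M + 1) (z + zc k * t) - Rmean G (2 * M + 1) 0) - 0) by ring. exact Hn.
  - intros M. apply zser_plus; [|apply zser_scal, Th_zser, Ht].
    unfold zser. rewrite <- (dft_coef_inversion G t M z Hq).
    replace (csum (sym (dft_coef G t M z)) (S M)) with (csum (sym (tr M)) (S M)).
    + apply Cser_finite. intros [|k] Hk; [lia|]. rewrite sym_S. unfold tr.
      destruct (Z_le_dec (Z.abs (Z.of_nat (S k))) (Z.of_nat M)); [lia|].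
      destruct (Z_le_dec (Z.abs (- Z.of_nat (S k))) (Z.of_nat M)); [lia|]. ring.
    + apply csum_ext. intros [|k] Hk; [unfold sym, tr; destruct (Z_le_dec (Z.abs 0) (Z.of_nat M)); [reflexivity|lia]|].
      rewrite !sym_S. unfold tr.
      destruct (Z_le_dec (Z.abs (Z.of_nat (S k))) (Z.of_nat M)); [|lia].
      destruct (Z_le_dec (Z.abs (- Z.of_nat (S k))) (Z.of_nat M)); [|lia]. reflexivity.
  - replace (RtoC 0) with (csum (sym (fun _ => 0)) 0) at 3 by reflexivity.
    apply (Cser_finite (sym (fun _ => RtoC 0)) 0). intros [|k] _; unfold sym; ring.
Qed.

(** The cross-multiplied form eliminates the means from the two limits at z and z', so their
    convergence never has to be established. *)
Lemma theta_unique (t : C) (G : C -> C) : in_H t -> (forall R0, taylor2 (fun w => (Cmod w <= R0)%R) G) ->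
  (forall w, G (w + 1) = G w) -> (forall w, G (w + t) = qe (- w) * G w) ->
  forall z z', G z * Th z' t = G z' * Th z t.
Proof.
  intros Ht Hsm H1 Hq z z'. apply Ceq_minus.
  pose proof (theta_mean t G z Ht Hsm H1 Hq) as A. pose proof (theta_mean t G z' Ht Hsm H1 Hq) as B.
  apply (Ccv_scal (Th z' t)) in A. apply (Ccv_scal (- Th z t)) in B.
  pose proof (Ccv_plus _ _ _ _ A B) as L.
  replace (Th z' t * 0 + - Th z t * 0) with (RtoC 0) in L by ring.
  apply Ccv_unique with (2 := L).
  eapply Ccv_ext; [|apply Ccv_const]. intros M. cbv beta. ring.
Qed.

(** * The Jacobi triple product *)

Lemma qpoch_step (a b : C) (n : nat) : qpoch_part a b (S n) = qpoch_part a b n * (1 - a * Cpow b n).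
Proof. reflexivity. Qed.

Lemma summable_qpoch (a b : C) : (Cmod b < 1)%R -> summable (fun k => (Cmod a * Cmod b ^ k)%R).
Proof. intros Hb. apply summable_geom; [split; [apply Cmod_ge_0|exact Hb]|apply Cmod_ge_0]. Qed.

Lemma qpoch_upper (a b : C) (n : nat) : (Cmod (qpoch_part a b n) <= exp (rsum (fun k => (Cmod a * Cmod b ^ k)%R) n))%R.
Proof.
  induction n; [simpl; rewrite Cmod_1, exp_0; lra|]. rewrite qpoch_step, Cmod_mult. simpl rsum. rewrite exp_plus.
  apply Rmult_le_compat; [apply Cmod_ge_0|apply Cmod_ge_0|exact IHn|].
  eapply Rle_trans; [apply Cmod_triangle_minus|]. rewrite Cmod_1, Cmod_mult, Cmod_pow. apply exp_ineq1_le.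
Qed.

(** This is the inequality that a product of factors 1 - x_i is at least 1 minus the sum of the x_i,
    applied to a stretch of the product whose sum is at most 1/2. *)
Lemma qpoch_lower (a b : C) (m n : nat) : (m <= n)%nat ->
  (rsum (fun k => (Cmod a * Cmod b ^ k)%R) n - rsum (fun k => (Cmod a * Cmod b ^ k)%R) m <= 1 / 2)%R ->
  (Cmod (qpoch_part a b m) * (1 - (rsum (fun k => (Cmod a * Cmod b ^ k)%R) n - rsum (fun k => (Cmod a * Cmod b ^ k)%R) m)) <= Cmod (qpoch_part a b n))%R.
Proof.
  intros Hmn. pose proof (Cmod_ge_0 (qpoch_part a b m)) as C0. set (s := rsum (fun k => (Cmod a * Cmod b ^ k)%R)) in *.
  induction Hmn as [|n Hmn IH]; intros Hs; [lra|].
  change (s (S n)) with (s n + Cmod a * Cmod b ^ n)%R in *. set (x := (Cmod a * Cmod b ^ n)%R) in *.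
  assert (Hx : (0 <= x)%R) by (apply Rmult_le_pos; [apply Cmod_ge_0|apply pow_le, Cmod_ge_0]).
  specialize (IH ltac:(lra)). rewrite qpoch_step, Cmod_mult.
  assert (L : (1 - x <= Cmod (1 - a * Cpow b n))%R).
  { pose proof (Cmod_triangle (1 - a * Cpow b n) (a * Cpow b n)) as T.
    replace (1 - a * Cpow b n + a * Cpow b n) with (RtoC 1) in T by ring. rewrite Cmod_1, Cmod_mult, Cmod_pow in T. fold x in T. lra. }
  assert (S0 : (0 <= s n - s m)%R).
  { assert (s m <= s n)%R; [|lra]. apply rsum_mono; [|exact Hmn]. intros k. apply Rmult_le_pos; [apply Cmod_ge_0|apply pow_le, Cmod_ge_0]. }
  assert (M : (0 <= Cmod (qpoch_part a b m) * (1 - (s n - s m)))%R) by (apply Rmult_le_pos; lra).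
  apply Rle_trans with (Cmod (qpoch_part a b m) * (1 - (s n - s m)) * (1 - x))%R.
  - rewrite Rmult_assoc. apply Rmult_le_compat_l; [exact C0|]. nra.
  - apply Rmult_le_compat; try lra.
Qed.

(** The consecutive differences are a bounded partial product times a b^k, so the telescoping series
    of differences is dominated by a geometric one. *)
Lemma qpoch_cv_ex (a b : C) : (Cmod b < 1)%R -> exists l, Ccv (qpoch_part a b) l.
Proof.
  intros Hb. destruct (summable_qpoch a b Hb) as [S0 [B HB]].
  destruct (dom_ser (fun k => qpoch_part a b (S k) - qpoch_part a b k) (fun k => (exp B * (Cmod a * Cmod b ^ k))%R)) as [l Hl].
  - apply summable_scal; [left; apply exp_pos|apply summable_qpoch, Hb].
  - intros k. rewrite qpoch_step. replace (qpoch_part a b k * (1 - a * Cpow b k) - qpoch_part a b k) with (- (qpoch_part a b k * (a * Cpow b k))) by ring.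
    rewrite Cmod_opp, !Cmod_mult, Cmod_pow. apply Rmult_le_compat_r; [apply S0|].
    eapply Rle_trans; [apply qpoch_upper|apply exp_le, HB].
  - exists (l + 1). eapply Ccv_ext; [|apply Ccv_plus; [exact Hl|apply Ccv_const]].
    intros n. cbv beta. rewrite (csum_telescope (qpoch_part a b)). simpl. ring.
Qed.

Lemma qpoch_cv (a b : C) : (Cmod b < 1)%R -> Ccv (qpoch_part a b) (qpoch_inf a b).
Proof.
  intros Hb. destruct (qpoch_cv_ex a b Hb) as [l Hl].
  replace (qpoch_inf a b) with l; [exact Hl|].
  apply Ccv_filterlim in Hl. symmetry. unfold qpoch_inf.
  assert (PF : ProperFilter (filtermap (qpoch_part a b) eventually)) by (apply filtermap_proper_filter; apply eventually_filter).
  assert (CF : cauchy (T := C_CompleteNormedModule) (filtermap (qpoch_part a b) eventually)).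
  { intros eps. exists l. apply (Hl (fun y => ball (M := C_NormedModule) l eps y)). exists eps. auto. }
  pose proof (complete_cauchy (T := C_CompleteNormedModule) (filtermap (qpoch_part a b) eventually) PF CF) as CC.
  apply (@is_filter_lim_unique C_AbsRing C_NormedModule (filtermap (qpoch_part a b) eventually)).
  - apply Proper_StrongProper. exact PF.
  - intros P [eps HP]. specialize (CC eps). eapply filter_imp; [|exact CC]. exact HP.
  - exact Hl.
Qed.

Lemma qpoch_bounded (a b : C) : (Cmod b < 1)%R -> exists B, forall n, (Cmod (qpoch_part a b n) <= B)%R.
Proof.
  intros Hb. destruct (summable_qpoch a b Hb) as [S0 [B HB]]. exists (exp B). intros n.
  eapply Rle_trans; [apply qpoch_upper|apply exp_le, HB].
Qed.

(** Past some m the factors can at most halve the product, and the finitely many partial products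
    before m are nonzero. A uniform lower bound is what survives in the limit. *)
Lemma qpoch_bounded_below (a b : C) : (Cmod b < 1)%R -> (forall n, 1 - a * Cpow b n <> 0) ->
  exists c, (0 < c)%R /\ forall n, (c <= Cmod (qpoch_part a b n))%R.
Proof.
  intros Hb Hn.
  assert (NZ : forall n, (0 < Cmod (qpoch_part a b n))%R).
  { intros n. apply Cmod_gt_0. induction n; [apply C1_nz|apply Cmult_neq_0; auto]. }
  destruct (summable_tail _ (summable_qpoch a b Hb) (1/2)%R ltac:(lra)) as [m Hm].
  assert (F : exists c, (0 < c)%R /\ forall n, (n < m)%nat -> (c <= Cmod (qpoch_part a b n))%R).
  { clear Hm. induction m as [|m [c [Hc IH]]]; [exists 1%R; split; [lra|intros; lia]|].
    exists (Rmin c (Cmod (qpoch_part a b m))). split; [apply Rmin_glb_lt; auto|].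
    intros n L. destruct (Nat.eq_dec n m) as [->|]; [apply Rmin_r|]. eapply Rle_trans; [apply Rmin_l|apply IH; lia]. }
  destruct F as [c [Hc F]]. exists (Rmin c (Cmod (qpoch_part a b m) / 2)).
  split; [apply Rmin_glb_lt; [exact Hc|specialize (NZ m); lra]|].
  intros n. destruct (le_lt_dec m n) as [L|L].
  - eapply Rle_trans; [apply Rmin_r|]. pose proof (Hm n L). pose proof (qpoch_lower a b m n L H). specialize (NZ m). nra.
  - eapply Rle_trans; [apply Rmin_l|apply F, L].
Qed.

Lemma Ccv_ge (u : nat -> C) (l : C) (c : R) : (forall n, (c <= Cmod (u n))%R) -> Ccv u l -> (c <= Cmod l)%R.
Proof.
  intros Hb H. apply Rnot_lt_le. intros L. destruct (H (c - Cmod l)%R ltac:(lra)) as [n0 Hn].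
  specialize (Hn n0 (Nat.le_refl _)). specialize (Hb n0).
  pose proof (Cmod_triangle (u n0 - l) l). replace (u n0 - l + l) with (u n0) in H0 by ring. lra.
Qed.

Lemma qpoch_inf_nz (a b : C) : (Cmod b < 1)%R -> (forall n, 1 - a * Cpow b n <> 0) -> qpoch_inf a b <> 0.
Proof.
  intros Hb Hn. destruct (qpoch_bounded_below a b Hb Hn) as [c [Hc H]]. apply Cmod_gt_0.
  pose proof (Ccv_ge _ _ c H (qpoch_cv a b Hb)). lra.
Qed.

Lemma Ccv_inv (u : nat -> C) (l : C) (c : R) : (0 < c)%R -> (forall n, (c <= Cmod (u n))%R) -> Ccv u l -> Ccv (fun n => / u n) (/ l).
Proof.
  intros Hc Hb H. pose proof (Ccv_ge u l c Hb H) as Hl.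
  assert (Nl : l <> 0) by (apply Cmod_gt_0; lra).
  intros eps He. destruct (H (eps * (c * c))%R) as [n0 Hn]. { apply Rmult_lt_0_compat; [lra|apply Rmult_lt_0_compat; lra]. }
  exists n0. intros n Hle. specialize (Hn n Hle). specialize (Hb n).
  assert (Nu : u n <> 0) by (apply Cmod_gt_0; lra).
  replace (/ u n - / l) with (- ((u n - l) / (u n * l))) by (field; auto).
  rewrite Cmod_opp, Cmod_div, Cmod_mult by (apply Cmult_neq_0; assumption).
  assert (P : (c * c <= Cmod (u n) * Cmod l)%R) by (apply Rmult_le_compat; lra).
  assert (P0 : (0 < c * c)%R) by (apply Rmult_lt_0_compat; lra).
  apply Rmult_lt_reg_r with (Cmod (u n) * Cmod l)%R; [lra|]. unfold Rdiv. rewrite Rmult_assoc, Rinv_l by lra. nra.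
Qed.

Lemma zser_pred (f : Z -> C) (b : nat -> R) (s : C) : summable b -> zdom f b ->
  zser f s -> zser (fun k => f (k - 1)%Z) s.
Proof.
  intros Hb Hd H. apply zser_opp in H. apply (zser_S _ b) in H; [|exact Hb|].
  - apply zser_opp in H. eapply zser_ext; [|exact H]. intros k. cbv beta. f_equal. lia.
  - intros k. specialize (Hd (- k)%Z). replace (Z.abs_nat (- k)) with (Z.abs_nat k) in Hd by lia. exact Hd.
Qed.

Lemma Cmod_qe_lt_1 (t : C) : in_H t -> (Cmod (qe t) < 1)%R.
Proof.
  intros Ht. rewrite Cmod_qe. rewrite <- exp_0. apply exp_increasing. unfold in_H in Ht. pose proof PI_RGT_0. nra.
Qed.

Lemma qe_neq (w c : C) : Im w <> 0%R -> Cmod c = 1%R -> qe w <> c.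
Proof.
  intros Hw Hc E. assert (M : Cmod (qe w) = 1%R) by (rewrite E; exact Hc). rewrite Cmod_qe, <- exp_0 in M.
  apply exp_inv in M. pose proof PI_RGT_0. nra.
Qed.

(** * The finite form of the triple product *)

Definition Qp (t : C) (n : nat) : C := qpoch_part (qe t) (qe t) n.

(* Extending 1/(Q;Q)_m by zero to m < 0 makes [rQ_pred] hold for every integer m. *)
Definition rQ (t : C) (m : Z) : C := if Z_lt_dec m 0 then 0 else / Qp t (Z.to_nat m).

Lemma Qp_factor_nz (t : C) (n : nat) : in_H t -> 1 - qe t * Cpow (qe t) n <> 0.
Proof.
  intros Ht E. apply Ceq_minus in E. rewrite qe_pow, <- qe_plus in E. symmetry in E. revert E. apply qe_neq; [|apply Cmod_1].
  unfold in_H in Ht. pose proof (pos_INR n). destruct t as [x y]. simpl in *. nra.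
Qed.

Lemma Qp_nz (t : C) (n : nat) : in_H t -> Qp t n <> 0.
Proof. intros Ht. induction n; [apply C1_nz|]. apply Cmult_neq_0; [exact IHn|apply Qp_factor_nz, Ht]. Qed.

Lemma rQ_pred (t : C) (m : Z) : in_H t -> rQ t (m - 1) = (1 - qe (zc m * t)) * rQ t m.
Proof.
  intros Ht. unfold rQ. destruct (Z_lt_dec m 0) as [L|L]; destruct (Z_lt_dec (m - 1) 0) as [L'|L']; try lia.
  - ring.
  - replace m with 0%Z by lia. replace (0 * t) with (RtoC 0) by ring. rewrite qe_0. ring.
  - replace (Z.to_nat m) with (S (Z.to_nat (m - 1))) by lia. unfold Qp. rewrite qpoch_step. fold (Qp t (Z.to_nat (m - 1))).
    pose proof (Qp_nz t (Z.to_nat (m - 1)) Ht). pose proof (Qp_factor_nz t (Z.to_nat (m - 1)) Ht) as F.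
    replace (qe (zc m * t)) with (qe t * Cpow (qe t) (Z.to_nat (m - 1))); [field; auto|].
    rewrite qe_pow, <- qe_plus. f_equal. rewrite INR_IZR_INZ, Z2Nat.id by lia. push_RtoC. ring.
Qed.

Lemma rQ_bounded (t : C) : in_H t -> exists B, (0 <= B)%R /\ forall m, (Cmod (rQ t m) <= B)%R.
Proof.
  intros Ht. destruct (qpoch_bounded_below (qe t) (qe t) (Cmod_qe_lt_1 t Ht) (fun n => Qp_factor_nz t n Ht)) as [c [Hc H]].
  assert (Pc : (0 < / c)%R) by (apply Rinv_0_lt_compat; exact Hc).
  exists (/ c)%R. split; [lra|]. intros m. unfold rQ. destruct (Z_lt_dec m 0); [rewrite Cmod_0; lra|].
  rewrite Cmod_inv by (apply Qp_nz, Ht). apply Rinv_le_contravar; [exact Hc|apply H].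
Qed.

(** The Q-binomial coefficient with entries 2N and N+k, times the k-th theta term. It vanishes for
    |k| > N thanks to the convention in [rQ], so the two-sided series below is a finite sum. *)
Definition triple_term (z t : C) (N : nat) (k : Z) : C := Qp t (2 * N) * rQ t (Z.of_nat N - k) * rQ t (Z.of_nat N + k) * Th_term z t k.

Definition triple_prod (z t : C) (N : nat) : C := qpoch_part (- qe z) (qe t) N * qpoch_part (- qe (t - z)) (qe t) N.

Lemma triple_term_dom (z t : C) : in_H t -> exists b, summable b /\ forall N, zdom (triple_term z t N) b.
Proof.
  intros Ht. destruct (Th_term_zdom z t Ht) as [b [Hb Hd]]. destruct (rQ_bounded t Ht) as [B [HB H]].
  destruct (qpoch_bounded (qe t) (qe t) (Cmod_qe_lt_1 t Ht)) as [B' H'].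
  assert (HB' : (0 <= B')%R) by (eapply Rle_trans; [apply Cmod_ge_0|apply (H' O)]).
  exists (fun n => (B' * B * B * b n)%R). split.
  - apply summable_scal; [repeat apply Rmult_le_pos; assumption|exact Hb].
  - intros N k. unfold triple_term. rewrite !Cmod_mult.
    repeat (apply Rmult_le_compat; try (repeat apply Rmult_le_pos; apply Cmod_ge_0)); auto. apply H'.
Qed.

(** Passing from N to N+1 multiplies the product by (1 + y Q^N)(1 + Q^(N+1)/y), which expands to 1 +
    Q^(2N+1) + y Q^N + Q^(N+1)/y. This is the corresponding Pascal-type recurrence for the
    coefficients. *)
Lemma triple_term_step (z t : C) (N : nat) (k : Z) : in_H t ->
  triple_term z t (S N) k = (1 + qe (zc (2 * Z.of_nat N + 1) * t)) * triple_term z t N k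
    + qe (z + zc (Z.of_nat N) * t) * triple_term z t N (k - 1)%Z + qe (zc (Z.of_nat N + 1) * t - z) * triple_term z t N (k + 1)%Z.
Proof.
  intros Ht. unfold triple_term.
  replace (Z.of_nat (S N) - k)%Z with (Z.of_nat N + 1 - k)%Z by lia.
  replace (Z.of_nat (S N) + k)%Z with (Z.of_nat N + 1 + k)%Z by lia.
  replace (Z.of_nat N - (k - 1))%Z with (Z.of_nat N + 1 - k)%Z by lia.
  replace (Z.of_nat N + (k - 1))%Z with (Z.of_nat N + k - 1)%Z by lia.
  replace (Z.of_nat N - (k + 1))%Z with (Z.of_nat N - k - 1)%Z by lia.
  replace (Z.of_nat N + (k + 1))%Z with (Z.of_nat N + 1 + k)%Z by lia.
  rewrite (rQ_pred t (Z.of_nat N + k) Ht), (rQ_pred t (Z.of_nat N - k) Ht).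
  replace (rQ t (Z.of_nat N + k)) with (rQ t (Z.of_nat N + 1 + k - 1)) by (f_equal; lia).
  replace (rQ t (Z.of_nat N - k)) with (rQ t (Z.of_nat N + 1 - k - 1)) by (f_equal; lia).
  rewrite (rQ_pred t (Z.of_nat N + 1 + k) Ht), (rQ_pred t (Z.of_nat N + 1 - k) Ht).
  (* Everything is expressed through the reciprocals with the largest index, and through u = Q^N, v
     = Q^k and q = Q; what is left is a rational identity. *)
  set (A := rQ t (Z.of_nat N + 1 + k)). set (B := rQ t (Z.of_nat N + 1 - k)).
  replace (2 * S N)%nat with (S (S (2 * N))) by lia. unfold Qp. rewrite !qpoch_step. fold (Qp t (2 * N)). set (P := Qp t (2 * N)).
  set (u := qe (zc (Z.of_nat N) * t)). set (v := qe (zc k * t)). set (q := qe t).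
  assert (Nv : v <> 0) by apply qe_nz.
  assert (Eu : Cpow q (2 * N) = u * u).
  { unfold q, u. rewrite qe_pow, <- qe_plus. f_equal. rewrite mult_INR, INR_IZR_INZ. push_RtoC. simpl. rewrite <- INR_IZR_INZ. replace (1 + 1)%R with 2%R by ring. ring. }
  replace (Cpow q (S (2 * N))) with (q * (u * u)) by (rewrite <- Eu; reflexivity). rewrite Eu.
  assert (E1 : qe (zc (Z.of_nat N + k) * t) = u * v) by (unfold u, v; rewrite <- qe_plus; f_equal; push_RtoC; ring).
  assert (E2 : qe (zc (Z.of_nat N - k) * t) = u / v) by (unfold u, v; rewrite <- qe_minus; f_equal; push_RtoC; ring).
  assert (E3 : qe (zc (Z.of_nat N + 1 + k) * t) = u * v * q) by (unfold u, v, q; rewrite <- !qe_plus; f_equal; push_RtoC; ring).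
  assert (E4 : qe (zc (Z.of_nat N + 1 - k) * t) = u / v * q) by (unfold u, v, q; rewrite <- qe_minus, <- qe_plus; f_equal; push_RtoC; ring).
  assert (E5 : qe (zc (2 * Z.of_nat N + 1) * t) = u * u * q) by (unfold u, q; rewrite <- !qe_plus; f_equal; push_RtoC; ring).
  assert (E6 : qe (z + zc (Z.of_nat N) * t) * Th_term z t (k - 1) = Th_term z t k * (u / v * q)).
  { unfold u, v, q, Th_term. rewrite <- qe_minus, <- !qe_plus. f_equal. push_RtoC. field. }
  assert (E7 : qe (zc (Z.of_nat N + 1) * t - z) * Th_term z t (k + 1) = Th_term z t k * (u * v * q)).
  { unfold u, v, q, Th_term. rewrite <- !qe_plus. f_equal. push_RtoC. field. }
  rewrite E1, E2, E3, E4, E5.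
  match goal with |- _ = _ + ?x * (?y1 * ?y2 * ?y3 * ?w) + ?x' * (?z1 * ?z2 * ?z3 * ?w') =>
    replace (x * (y1 * y2 * y3 * w)) with (y1 * y2 * y3 * (x * w)) by ring;
    replace (x' * (z1 * z2 * z3 * w')) with (z1 * z2 * z3 * (x' * w')) by ring end.
  rewrite E6, E7. field. exact Nv.
Qed.

Lemma triple_term_zser (z t : C) (N : nat) : in_H t -> zser (triple_term z t N) (triple_prod z t N).
Proof.
  intros Ht. destruct (triple_term_dom z t Ht) as [b [Hb Hd]]. induction N.
  - replace (triple_prod z t 0) with (csum (sym (triple_term z t 0)) 1).
    + apply Cser_finite. intros [|k] Hk; [lia|]. rewrite sym_S. unfold triple_term, rQ.
      destruct (Z_lt_dec (Z.of_nat 0 - Z.of_nat (S k)) 0); [|lia].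
      destruct (Z_lt_dec (Z.of_nat 0 + - Z.of_nat (S k)) 0); [|lia]. ring.
    + unfold triple_prod, triple_term, Th_term, rQ, Qp. simpl. replace (0 * z + RtoC (0 * (0 - 1) / 2) * t) with (RtoC 0) by (push_RtoC; field).
      rewrite qe_0. field.
  - assert (E : triple_prod z t (S N) = (1 + qe (zc (2 * Z.of_nat N + 1) * t)) * triple_prod z t N
       + qe (z + zc (Z.of_nat N) * t) * triple_prod z t N + qe (zc (Z.of_nat N + 1) * t - z) * triple_prod z t N).
    { unfold triple_prod. rewrite !qpoch_step, qe_pow.
      replace (1 - - qe z * qe (RtoC (INR N) * t)) with (1 + qe (z + zc (Z.of_nat N) * t)) by (rewrite qe_plus, INR_IZR_INZ; ring).
      replace (1 - - qe (t - z) * qe (RtoC (INR N) * t)) with (1 + qe (zc (Z.of_nat N + 1) * t - z)).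
      2:{ replace (zc (Z.of_nat N + 1) * t - z) with (t - z + RtoC (INR N) * t) by (rewrite INR_IZR_INZ; push_RtoC; ring). rewrite qe_plus. ring. }
      replace (qe (zc (2 * Z.of_nat N + 1) * t)) with (qe (z + zc (Z.of_nat N) * t) * qe (zc (Z.of_nat N + 1) * t - z)).
      2:{ rewrite <- qe_plus. f_equal. push_RtoC. ring. }
      ring. }
    rewrite E. eapply zser_ext. { intros k. symmetry. apply triple_term_step, Ht. }
    apply zser_plus; [apply zser_plus|].
    + apply zser_scal, IHN.
    + apply zser_scal. apply zser_pred with b; [exact Hb|apply Hd|exact IHN].
    + apply zser_scal. apply zser_S with b; [exact Hb|apply Hd|exact IHN].
Qed.

Lemma rQ_cv (t : C) (k : Z) : in_H t -> Ccv (fun N => rQ t (Z.of_nat N + k)) (/ qpoch_inf (qe t) (qe t)).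
Proof.
  intros Ht. destruct (qpoch_bounded_below (qe t) (qe t) (Cmod_qe_lt_1 t Ht) (fun n => Qp_factor_nz t n Ht)) as [c [Hc H]].
  pose proof (Ccv_inv _ _ c Hc H (qpoch_cv _ _ (Cmod_qe_lt_1 t Ht))) as L.
  intros eps He. destruct (L eps He) as [n0 Hn]. exists (n0 + Z.abs_nat k)%nat. intros n Hle.
  unfold rQ. destruct (Z_lt_dec (Z.of_nat n + k) 0); [lia|]. apply Hn. lia.
Qed.

Lemma jacobi_triple (z t : C) : in_H t ->
  Th z t = qpoch_inf (qe t) (qe t) * (qpoch_inf (- qe z) (qe t) * qpoch_inf (- qe (t - z)) (qe t)).
Proof.
  intros Ht. pose proof (Cmod_qe_lt_1 t Ht) as Hq. set (P := qpoch_inf (qe t) (qe t)).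
  assert (NP : P <> 0) by (apply qpoch_inf_nz; [exact Hq|intros n; apply Qp_factor_nz, Ht]).
  destruct (triple_term_dom z t Ht) as [b [Hb Hd]].
  assert (L1 : Ccv (triple_prod z t) (/ P * Th z t)).
  { apply tannery_Z with (a := triple_term z t) (l := fun k => / P * Th_term z t k) (b := b).
    - exact Hb.
    - exact Hd.
    (* As N grows, the Q-binomial coefficient tends to P * (1/P) * (1/P) = 1/P. *)
    - intros k. replace (/ P * Th_term z t k) with (P * / P * / P * Th_term z t k) by (field; exact NP).
      apply Ccv_mult; [|apply Ccv_const]. apply Ccv_mult; [|apply rQ_cv, Ht]. apply Ccv_mult.
      + apply (Ccv_subseq (Qp t) P (fun N => (2 * N)%nat)); [intros; lia|]. apply qpoch_cv, Hq.
      + apply (rQ_cv t (- k) Ht).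
    - intros N. apply triple_term_zser, Ht.
    - apply zser_scal, Th_zser, Ht. }
  assert (L2 : Ccv (triple_prod z t) (qpoch_inf (- qe z) (qe t) * qpoch_inf (- qe (t - z)) (qe t))).
  { apply Ccv_mult; apply qpoch_cv, Hq. }
  rewrite <- (Ccv_unique _ _ _ L1 L2). field. exact NP.
Qed.

(** The hypothesis makes |y Q^n| differ from 1 for every integer n, so no factor of the product can
    vanish. It excludes more than the actual zeros, but comparing moduli is all that it asks for. *)
Lemma Th_nz (z t : C) : in_H t -> (forall n : Z, (Im z + IZR n * Im t <> 0)%R) -> Th z t <> 0.
Proof.
  intros Ht Hz. rewrite jacobi_triple by exact Ht. pose proof (Cmod_qe_lt_1 t Ht) as Hq.
  assert (M1 : Cmod (- (1)) = 1%R) by apply Cmod_m1.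
  apply Cmult_neq_0; [|apply Cmult_neq_0]; apply qpoch_inf_nz; try exact Hq; intros n.
  - apply Qp_factor_nz, Ht.
  - intros E. assert (E' : qe (z + RtoC (INR n) * t) = - (1)).
    { rewrite qe_plus, <- qe_pow. replace (qe z * Cpow (qe t) n) with (1 - - qe z * Cpow (qe t) n - 1) by ring. rewrite E. ring. }
    revert E'. apply qe_neq; [|exact M1]. specialize (Hz (Z.of_nat n)). rewrite <- INR_IZR_INZ in Hz. destruct z, t. simpl in *.
    intros F. apply Hz. rewrite <- F. ring.
  - intros E. assert (E' : qe (t - z + RtoC (INR n) * t) = - (1)).
    { rewrite qe_plus, <- qe_pow. replace (qe (t - z) * Cpow (qe t) n) with (1 - - qe (t - z) * Cpow (qe t) n - 1) by ring. rewrite E. ring. }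
    revert E'. apply qe_neq; [|exact M1]. specialize (Hz (- (Z.of_nat n + 1))%Z). rewrite opp_IZR, plus_IZR, <- INR_IZR_INZ in Hz. destruct z, t. simpl in *.
    intros F. apply Hz. lra.
Qed.

(** * Klein forms and their covariance under SL2(Z) *)

Lemma taylor2_qe (U : C -> Prop) (p : C -> C) : taylor2 U p -> taylor2 U (fun w => qe (p w)).
Proof.
  intros Hp. pose proof (taylor2_mult U _ _ (taylor2_const U (2 * RtoC PI * Ci)) Hp) as H.
  pose proof H as [D [K [HK HD]]].
  apply (taylor2_comp U (fun w => (Re w <= K)%R) Cexp (fun w => 2 * RtoC PI * Ci * p w)).
  - intros w Hw. destruct (HD w Hw) as [B _]. eapply Rle_trans; [|exact B].
    eapply Rle_trans; [apply Rle_abs|apply re_le_Cmod].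
  - apply taylor2_Cexp.
  - exact H.
Qed.

Lemma taylor2_Th_comp (U : C -> Prop) (p : C -> C) (t : C) : in_H t -> taylor2 U p -> taylor2 U (fun w => Th (p w) t).
Proof.
  intros Ht H. pose proof H as [D [K [HK HD]]].
  apply (taylor2_comp U (fun w => (Cmod w <= K)%R) (fun z => Th z t) p).
  - intros w Hw. apply (HD w Hw).
  - apply taylor2_Th, Ht.
  - exact H.
Qed.

Lemma in_H_nz (t : C) : in_H t -> t <> 0.
Proof. intros H E. rewrite E in H. unfold in_H in H. simpl in H. lra. Qed.

Lemma in_H_neg_inv (t : C) : in_H t -> in_H (- (1) / t).
Proof.
  unfold in_H. intros H. destruct t as [x y]. simpl in *.
  replace (- (1) * (- y / (x * (x * 1) + y * (y * 1))) + - 0 * (x / (x * (x * 1) + y * (y * 1))))%R with (y / (x * x + y * y))%R by (field; nra).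
  apply Rdiv_lt_0_compat; nra.
Qed.

(** The inverted theta function, with its argument moved by 1/2 and multiplied by a Gaussian factor,
    satisfies both functional equations of Th(.|t): the two periods change roles, and the Gaussian
    is chosen to repair the automorphy factors. Uniqueness then gives proportionality. *)
Lemma theta_S (t : C) : in_H t -> exists C0 : C, C0 <> 0 /\
  forall u, Th (u / t + 1 / 2) (- (1) / t) = C0 * qe (u * u / (2 * t) + u / (2 * t) - u / 2) * Th (u + 1 / 2) t.
Proof.
  intros Ht. pose proof (in_H_nz t Ht) as Nt. pose proof (in_H_neg_inv t Ht) as Ht'.
  set (t' := - (1) / t) in *.
  assert (Et' : t' = - (1) / t) by reflexivity.
  set (G := fun w => qe ((w - 1 / 2) / 2 - (w - 1 / 2) * (w - 1 / 2) / (2 * t) - (w - 1 / 2) / (2 * t)) * Th ((w - 1 / 2) / t + 1 / 2) t').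
  assert (Hsm : forall R0, taylor2 (fun w => (Cmod w <= R0)%R) G).
  { intros R0. assert (I : taylor2 (fun w => (Cmod w <= Rabs R0)%R) (fun w => w)) by (apply taylor2_id with (Rabs R0); [auto|apply Rabs_pos]).
    apply taylor2_sub with (U := fun w => (Cmod w <= Rabs R0)%R). { intros w Hw. eapply Rle_trans; [exact Hw|apply Rle_abs]. }
    assert (J : taylor2 (fun w => (Cmod w <= Rabs R0)%R) (fun w => w - 1 / 2)) by (apply taylor2_plus; [exact I|apply taylor2_const]).
    apply taylor2_mult.
    - apply taylor2_qe.
      apply taylor2_ext with (fun w => (w - 1 / 2) * (/ 2) + ((w - 1 / 2) * (w - 1 / 2)) * (- (/ (2 * t))) + (w - 1 / 2) * (- (/ (2 * t)))).
      { intros w _. field. exact Nt. }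
      repeat apply taylor2_plus.
      + apply taylor2_mult; [exact J|apply taylor2_const].
      + apply taylor2_mult; [apply taylor2_mult; exact J|apply taylor2_const].
      + apply taylor2_mult; [exact J|apply taylor2_const].
    - apply taylor2_Th_comp; [exact Ht'|]. apply taylor2_plus; [apply taylor2_mult; [exact J|apply taylor2_const]|apply taylor2_const]. }
  assert (H1 : forall w, G (w + 1) = G w).
  { intros w. unfold G. set (v := (w - 1 / 2) / t + 1 / 2).
    replace (Th ((w + 1 - 1 / 2) / t + 1 / 2) t') with (qe (v - t') * Th v t').
    2:{ replace (Th v t') with (Th ((v - t') + t') t') by (f_equal; ring). rewrite Th_t by exact Ht'.
        rewrite Cmult_assoc, <- qe_plus. replace (v - t' + - (v - t')) with (RtoC 0) by ring. rewrite qe_0, Cmult_1_l.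
        f_equal. unfold v. rewrite Et'. field. exact Nt. }
    rewrite Cmult_assoc, <- qe_plus. f_equal. rewrite <- (qe_period _ (-1)). f_equal. unfold v. rewrite Et'. field. exact Nt. }
  assert (Hq : forall w, G (w + t) = qe (- w) * G w).
  { intros w. unfold G. replace ((w + t - 1 / 2) / t + 1 / 2) with ((w - 1 / 2) / t + 1 / 2 + 1) by (field; exact Nt).
    rewrite Th_1, Cmult_assoc, <- qe_plus. f_equal. f_equal. field. exact Nt. }
  pose proof (theta_unique t G Ht Hsm H1 Hq) as Un.
  (* A base point at which both theta functions are visibly nonzero: z0 lies at half the height of
     t, and its image is 1 - t'/2, at half the height of t' with opposite sign. *)
  set (z0 := t / 2 + 1).
  assert (T0 : Th z0 t <> 0).
  { apply Th_nz; [exact Ht|]. intros n. replace z0 with (RtoC (1 / 2) * t + 1) by (unfold z0; push_RtoC; field). unfold in_H in Ht. destruct t as [x y]. simpl in *.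
    intros E. assert (E2 : (y * (1 + 2 * IZR n) = 0)%R) by lra.
    apply Rmult_integral in E2. destruct E2 as [E2|E2]; [lra|]. rewrite <- mult_IZR, <- plus_IZR in E2. apply eq_IZR in E2. lia. }
  assert (T1 : Th ((z0 - 1 / 2) / t + 1 / 2) t' <> 0).
  { replace ((z0 - 1 / 2) / t + 1 / 2) with (1 - RtoC (1 / 2) * t') by (unfold z0; rewrite Et'; push_RtoC; field; exact Nt).
    apply Th_nz; [exact Ht'|]. intros n. clear - Ht'. unfold in_H in Ht'. destruct t' as [x y]. simpl in *.
    intros E. assert (E2 : (y * (-1 + 2 * IZR n) = 0)%R) by lra.
    apply Rmult_integral in E2. destruct E2 as [E2|E2]; [lra|]. rewrite <- mult_IZR, <- plus_IZR in E2. apply eq_IZR in E2. lia. }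
  assert (G0 : G z0 <> 0) by (apply Cmult_neq_0; [apply qe_nz|exact T1]).
  exists (G z0 / Th z0 t). split.
  { intros E. apply G0. replace (G z0) with (G z0 / Th z0 t * Th z0 t) by (field; exact T0). rewrite E. ring. }
  intros u. specialize (Un (u + 1 / 2) z0).
  replace (G z0 / Th z0 t * qe (u * u / (2 * t) + u / (2 * t) - u / 2) * Th (u + 1 / 2) t)
    with (qe (u * u / (2 * t) + u / (2 * t) - u / 2) * (G z0 * Th (u + 1 / 2) t) / Th z0 t) by (field; exact T0).
  rewrite <- Un. unfold G. replace (u + 1 / 2 - 1 / 2) with u by ring.
  replace (u / 2 - u * u / (2 * t) - u / (2 * t)) with (- (u * u / (2 * t) + u / (2 * t) - u / 2)) by (field; exact Nt).
  rewrite qe_opp. field. split; [apply qe_nz|exact T0].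
Qed.

(* Up to a factor independent of (x1, x2), this is the Klein form of the lattice Z t + Z at x1 t + x2. *)
Definition klein_term (x1 x2 : R) (t : C) (k : Z) : C :=
  qe (RtoC ((IZR k - 1 / 2 + x1) ^ 2 / 2) * t + RtoC (x1 * x2 / 2 + (IZR k - 1 / 2) * x2 + IZR k / 2)).

Definition klein (x1 x2 : R) (t : C) : C := zsum (klein_term x1 x2 t).

Lemma klein_term_Th_term (x1 x2 : R) (t z : C) (k : Z) : z = RtoC x1 * t + RtoC x2 ->
  klein_term x1 x2 t k = qe (t / 8 + RtoC ((x1 - 1) / 2) * z) * Th_term (z + 1 / 2) t k.
Proof.
  intros ->. unfold klein_term, Th_term. rewrite <- qe_plus. f_equal.
  replace ((IZR k - 1 / 2 + x1) ^ 2 / 2)%R with ((IZR k - 1 / 2 + x1) * (IZR k - 1 / 2 + x1) / 2)%R by field. push_RtoC. field.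
Qed.

Lemma klein_zser (x1 x2 : R) (t z : C) : in_H t -> z = RtoC x1 * t + RtoC x2 ->
  zser (klein_term x1 x2 t) (qe (t / 8 + RtoC ((x1 - 1) / 2) * z) * Th (z + 1 / 2) t).
Proof.
  intros Ht Hz. eapply zser_ext; [intros k; symmetry; apply klein_term_Th_term, Hz|]. apply zser_scal, Th_zser, Ht.
Qed.

Lemma klein_Th (x1 x2 : R) (t z : C) : in_H t -> z = RtoC x1 * t + RtoC x2 ->
  klein x1 x2 t = qe (t / 8 + RtoC ((x1 - 1) / 2) * z) * Th (z + 1 / 2) t.
Proof. intros Ht Hz. apply zsum_spec, klein_zser; assumption. Qed.

Lemma klein_nz (x1 x2 : R) (t : C) : in_H t -> (forall n : Z, (x1 <> IZR n)%R) -> klein x1 x2 t <> 0.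
Proof.
  intros Ht Hx. rewrite (klein_Th x1 x2 t _ Ht eq_refl). apply Cmult_neq_0; [apply qe_nz|]. apply Th_nz; [exact Ht|].
  intros n E. apply (Hx (- n)%Z). unfold in_H in Ht. destruct t as [x y]. simpl in *. rewrite opp_IZR.
  apply Rmult_eq_reg_r with y; [|lra]. lra.
Qed.

Lemma binom_even (k : Z) : exists m, (IZR k * (IZR k - 1) / 2 = IZR m)%R.
Proof.
  exists (k * (k - 1) / 2)%Z. assert (E : (k * (k - 1) = 2 * (k * (k - 1) / 2))%Z).
  { apply Z_div_exact_full_2; [lia|]. destruct (Z.Even_or_Odd k) as [[m ->]|[m ->]].
    - replace (2 * m * (2 * m - 1))%Z with ((m * (2 * m - 1)) * 2)%Z by ring. apply Z_mod_mult.
    - replace ((2 * m + 1) * (2 * m + 1 - 1))%Z with (((2 * m + 1) * m) * 2)%Z by ring. apply Z_mod_mult. }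
  rewrite <- minus_IZR, <- mult_IZR, E at 1. rewrite mult_IZR. field.
Qed.

Lemma zsum_ext_scal (c : C) (f g : Z -> C) (s : C) : zser f s -> (forall k, g k = c * f k) -> zsum g = c * s.
Proof. intros H E. apply zsum_spec. apply zser_ext with (fun k => c * f k); [auto|]. apply zser_scal, H. Qed.

Lemma klein_spec (x1 x2 : R) (t : C) : in_H t -> zser (klein_term x1 x2 t) (klein x1 x2 t).
Proof. intros Ht. rewrite (klein_Th x1 x2 t _ Ht eq_refl). apply klein_zser; [exact Ht|reflexivity]. Qed.

(** Since (k - 1/2)^2/2 = k(k-1)/2 + 1/8, the square in k gives the eighth root of unity and an
    integer. The remaining part, linear and quadratic in x1, is exactly what changing x2 to x1 n +
    x2 produces, thanks to the normalising term x1 x2/2. *)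
Lemma klein_T (x1 x2 : R) (t : C) (n : Z) : in_H t ->
  klein x1 x2 (t + zc n) = qe (zc n / 8) * klein x1 (x1 * IZR n + x2) t.
Proof.
  intros Ht. apply zsum_ext_scal with (klein_term x1 (x1 * IZR n + x2) t); [apply klein_spec, Ht|]. intros k.
  destruct (binom_even k) as [m Hm]. unfold klein_term. rewrite <- qe_plus. rewrite <- (qe_period (zc n / 8 + _) (n * m)). f_equal.
  rewrite mult_IZR, <- Hm.
  replace ((IZR k - 1 / 2 + x1) ^ 2 / 2)%R with ((IZR k - 1 / 2 + x1) * (IZR k - 1 / 2 + x1) / 2)%R by field. push_RtoC. field.
Qed.

(** Substitute k by 1 - k, which reflects k - 1/2; the sign comes from the parity factor qe(k/2). *)
Lemma klein_opp (x1 x2 : R) (t : C) : in_H t -> klein (- x1) (- x2) t = - (1) * klein x1 x2 t.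
Proof.
  intros Ht. pose proof (klein_spec x1 x2 t Ht) as H. apply zsum_spec.
  assert (D : exists b, summable b /\ zdom (klein_term x1 x2 t) b).
  { destruct (Th_term_zdom (RtoC x1 * t + RtoC x2 + 1 / 2) t Ht) as [b [Hb Hd]].
    exists (fun n => (Cmod (qe (t / 8 + RtoC ((x1 - 1) / 2) * (RtoC x1 * t + RtoC x2))) * b n)%R). split.
    - apply summable_scal; [apply Cmod_ge_0|exact Hb].
    - intros k. rewrite (klein_term_Th_term x1 x2 t _ k eq_refl), Cmod_mult. apply Rmult_le_compat_l; [apply Cmod_ge_0|apply Hd]. }
  destruct D as [b [Hb Hd]]. apply zser_S with (b := b) in H; [|assumption..]. apply zser_opp in H.
  eapply zser_ext; [|apply zser_scal, H]. intros k. cbv beta. rewrite <- qe_half. unfold klein_term. rewrite <- qe_plus.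
  rewrite <- (qe_period _ (k - 1)).
  f_equal.
  replace ((IZR (- k + 1) - 1 / 2 + x1) ^ 2 / 2)%R with ((IZR (- k + 1) - 1 / 2 + x1) * (IZR (- k + 1) - 1 / 2 + x1) / 2)%R by field.
  replace ((IZR k - 1 / 2 + - x1) ^ 2 / 2)%R with ((IZR k - 1 / 2 + - x1) * (IZR k - 1 / 2 + - x1) / 2)%R by field.
  push_RtoC. field.
Qed.

(** The row vector (x1, x2) is multiplied by the matrix. The order of the quantifiers matters: C0
    may depend on t but not on (x1, x2), so it cancels in quotients. *)
Definition klein_covariant (a b c d : Z) : Prop := forall t, in_H t -> exists C0 : C, C0 <> 0 /\
  forall x1 x2 : R, klein x1 x2 (mob a b c d t) = C0 * klein (x1 * IZR a + x2 * IZR c) (x1 * IZR b + x2 * IZR d) t.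

Lemma mob_den_nz (a b c d : Z) (t : C) : SL2Z a b c d -> in_H t -> zc c * t + zc d <> 0.
Proof.
  unfold SL2Z, in_H. intros H Ht E. destruct t as [x y]. simpl in *. unfold Cplus, Cmult, RtoC in E. simpl in E.
  injection E as E1 E2. assert (Hc : (IZR c = 0)%R) by (apply Rmult_eq_reg_r with y; lra).
  rewrite Hc in E1. assert (Hd : (IZR d = 0)%R) by lra. apply eq_IZR in Hc. apply eq_IZR in Hd. subst. lia.
Qed.

Lemma in_H_mob (a b c d : Z) (t : C) : SL2Z a b c d -> in_H t -> in_H (mob a b c d t).
Proof.
  intros H Ht. pose proof (mob_den_nz a b c d t H Ht) as N. unfold in_H in *.
  assert (P : (0 < (IZR c * Re t + IZR d) ^ 2 + (IZR c * Im t) ^ 2)%R).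
  { apply Cmod_gt_0 in N. pose proof (pow_lt _ 2 N) as Q. rewrite Cmod2_alt in Q. destruct t as [x y]. simpl in *.
    replace (IZR c * x - 0 * y + IZR d)%R with (IZR c * x + IZR d)%R in Q by ring.
    replace (IZR c * y + 0 * x + 0)%R with (IZR c * y)%R in Q by ring. exact Q. }
  unfold SL2Z in H. assert (HR : (IZR a * IZR d - IZR b * IZR c = 1)%R) by (rewrite <- !mult_IZR, <- minus_IZR, H; reflexivity).
  destruct t as [x y]. unfold mob. simpl in *.
  match goal with |- (0 < ?e)%R => replace e with ((IZR a * IZR d - IZR b * IZR c) * y / ((IZR c * x + IZR d) ^ 2 + (IZR c * y) ^ 2))%R end.
  - rewrite HR. apply Rdiv_lt_0_compat; [lra|exact P].
  - field. intros Q. apply (Rlt_irrefl 0). rewrite <- Q at 2. eapply Rlt_le_trans; [exact P|right; ring].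
Qed.

Lemma mob_comp (a b c d a' b' c' d' : Z) (t : C) : SL2Z a b c d -> SL2Z a' b' c' d' -> in_H t ->
  mob a b c d (mob a' b' c' d' t) = mob (a * a' + b * c') (a * b' + b * d') (c * a' + d * c') (c * b' + d * d') t.
Proof.
  intros H H' Ht. pose proof (mob_den_nz _ _ _ _ t H' Ht) as N'.
  pose proof (mob_den_nz _ _ _ _ _ H (in_H_mob _ _ _ _ t H' Ht)) as N.
  unfold mob in *. push_RtoC.
  assert (N2 : (zc c * zc a' + zc d * zc c') * t + (zc c * zc b' + zc d * zc d') <> 0).
  { replace ((zc c * zc a' + zc d * zc c') * t + (zc c * zc b' + zc d * zc d')) with
      ((zc c * ((zc a' * t + zc b') / (zc c' * t + zc d')) + zc d) * (zc c' * t + zc d')) by (field; exact N').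
    apply Cmult_neq_0; assumption. }
  field. repeat split; auto.
Qed.

Lemma klein_covariant_comp (a b c d a' b' c' d' : Z) : SL2Z a b c d -> SL2Z a' b' c' d' -> klein_covariant a b c d -> klein_covariant a' b' c' d' ->
  klein_covariant (a * a' + b * c') (a * b' + b * d') (c * a' + d * c') (c * b' + d * d').
Proof.
  intros H H' L L' t Ht. destruct (L' t Ht) as [C1 [N1 E1]].
  destruct (L _ (in_H_mob _ _ _ _ t H' Ht)) as [C2 [N2 E2]].
  exists (C2 * C1). split; [apply Cmult_neq_0; assumption|]. intros x1 x2.
  rewrite <- mob_comp by assumption. rewrite E2, E1, Cmult_assoc. f_equal. f_equal; rewrite !plus_IZR, !mult_IZR; ring.
Qed.

Lemma klein_covariant_T (n : Z) : klein_covariant 1 n 0 1.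
Proof.
  intros t Ht. exists (qe (zc n / 8)). split; [apply qe_nz|]. intros x1 x2.
  replace (mob 1 n 0 1 t) with (t + zc n) by (unfold mob; field; intros E; injection E; lra).
  rewrite klein_T by exact Ht. f_equal. f_equal; ring.
Qed.

Lemma klein_covariant_opp : klein_covariant (-1) 0 0 (-1).
Proof.
  intros t Ht. exists (- (1)). split; [intros E; injection E; lra|]. intros x1 x2.
  replace (mob (-1) 0 0 (-1) t) with t by (unfold mob; field; intros E; injection E; lra).
  replace (x1 * -1 + x2 * 0)%R with (- x1)%R by ring. replace (x1 * 0 + x2 * -1)%R with (- x2)%R by ring.
  rewrite klein_opp by exact Ht. ring.
Qed.

Lemma klein_covariant_S : klein_covariant 0 (-1) 1 0.
Proof.
  intros t Ht. pose proof (in_H_nz t Ht) as Nt. destruct (theta_S t Ht) as [C0 [N0 E]].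
  assert (Em : mob 0 (-1) 1 0 t = - (1) / t) by (unfold mob; field; exact Nt). rewrite Em.
  exists (C0 * qe ((- (1) / t) / 8 - t / 8)). split; [apply Cmult_neq_0; [exact N0|apply qe_nz]|]. intros x1 x2.
  replace (x1 * 0 + x2 * 1)%R with x2 by ring. replace (x1 * -1 + x2 * 0)%R with (- x1)%R by ring.
  (* The point x1 (-1/t) + x2 equals u/t, and u is the point with coordinates (x2, -x1) for the
     lattice of t. *)
  set (u := RtoC x2 * t + RtoC (- x1)).
  rewrite (klein_Th x1 x2 _ (u / t)), (klein_Th x2 (- x1) t u Ht eq_refl), E.
  - replace (qe (- (1) / t / 8 + RtoC ((x1 - 1) / 2) * (u / t)) * (C0 * qe (u * u / (2 * t) + u / (2 * t) - u / 2) * Th (u + 1 / 2) t))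
      with (C0 * (qe (- (1) / t / 8 + RtoC ((x1 - 1) / 2) * (u / t)) * qe (u * u / (2 * t) + u / (2 * t) - u / 2)) * Th (u + 1 / 2) t) by ring.
    replace (C0 * qe (- (1) / t / 8 - t / 8) * (qe (t / 8 + RtoC ((x2 - 1) / 2) * u) * Th (u + 1 / 2) t))
      with (C0 * (qe (- (1) / t / 8 - t / 8) * qe (t / 8 + RtoC ((x2 - 1) / 2) * u)) * Th (u + 1 / 2) t) by ring.
    rewrite <- !qe_plus. f_equal. f_equal. f_equal. unfold u. push_RtoC. field. exact Nt.
  - apply in_H_neg_inv, Ht.
  - unfold u. push_RtoC. field. exact Nt.
Qed.

(** Euclidean descent on |c|. With m = d / c and r = d mod c, the given matrix is the one with rows
    (ma - b, a) and (-r, c) times S T^m, and |r| < |c|. For c = 0 the matrix is plus or minus a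
    translation. *)
Lemma klein_covariant_SL2Z (a b c d : Z) : SL2Z a b c d -> klein_covariant a b c d.
Proof.
  remember (Z.abs_nat c) as n eqn:Hn. revert a b c d Hn.
  induction n as [n IH] using (well_founded_induction lt_wf). intros a b c d Hn H.
  assert (HT : forall m, SL2Z 1 m 0 1) by (intros m; unfold SL2Z; ring).
  destruct (Z.eq_dec c 0) as [->|Hc].
  - unfold SL2Z in H. assert (Had : (a * d = 1)%Z) by lia.
    destruct (Z.mul_eq_1 a d Had) as [->| ->].
    + replace d with 1%Z by lia. apply klein_covariant_T.
    + replace d with (-1)%Z by lia.
      pose proof (klein_covariant_comp (-1) 0 0 (-1) 1 (- b) 0 1 eq_refl (HT _) klein_covariant_opp (klein_covariant_T (- b))) as L.
      replace (-1 * 1 + 0 * 0)%Z with (-1)%Z in L by ring. replace (-1 * - b + 0 * 1)%Z with b in L by ring.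
      exact L.
  - set (m := (d / c)%Z). pose proof (Z.div_mod d c Hc) as Dm. fold m in Dm. set (r := (d mod c)%Z) in *.
    assert (Hr : (Z.abs_nat (- r) < n)%nat).
    { subst n. destruct (Z_lt_le_dec c 0) as [L|L].
      - pose proof (Z.mod_neg_bound d c L). fold r in H0. lia.
      - pose proof (Z.mod_pos_bound d c ltac:(lia)). fold r in H0. lia. }
    assert (H1 : SL2Z (- (b - m * a)) a (- r) c).
    { unfold SL2Z in *. replace r with (d - m * c)%Z by lia. rewrite <- H. ring. }
    pose proof (IH _ Hr _ _ _ _ eq_refl H1) as L1.
    pose proof (klein_covariant_comp 0 (-1) 1 0 1 m 0 1 eq_refl (HT m) klein_covariant_S (klein_covariant_T m)) as L2.
    assert (H2 : SL2Z (0 * 1 + -1 * 0) (0 * m + -1 * 1) (1 * 1 + 0 * 0) (1 * m + 0 * 1)) by (unfold SL2Z; ring).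
    pose proof (klein_covariant_comp _ _ _ _ _ _ _ _ H1 H2 L1 L2) as L.
    match type of L with klein_covariant ?a' ?b' ?c' ?d' => replace a' with a in L by ring; replace b' with b in L by ring;
      replace c' with c in L by ring; replace d' with d in L by (rewrite Dm; ring) end.
    exact L.
Qed.

(** * Quotients of Klein forms *)

Definition translation_phase (x1 x2 : R) (m1 m2 : Z) : R :=
  ((x1 * IZR m2 - IZR m1 * x2) / 2 + (IZR m1 * IZR m2 - IZR m1 - IZR m2) / 2)%R.

Lemma klein_translate (x1 x2 : R) (m1 m2 : Z) (t : C) : in_H t ->
  klein (x1 + IZR m1) (x2 + IZR m2) t = qe (RtoC (translation_phase x1 x2 m1 m2)) * klein x1 x2 t.
Proof.
  intros Ht. set (z := RtoC x1 * t + RtoC x2).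
  rewrite (klein_Th x1 x2 t z Ht eq_refl), (klein_Th _ _ t (z + zc m2 + zc m1 * t) Ht).
  2:{ unfold z. push_RtoC. ring. }
  replace (z + zc m2 + zc m1 * t + 1 / 2) with (z + 1 / 2 + zc m2 + zc m1 * t) by ring.
  rewrite (quasi_t (fun w => Th w t) t (fun w => Th_t w t Ht) m1 (z + 1 / 2 + zc m2)).
  rewrite (quasi_1 (fun w => Th w t) (fun w => Th_1 w t) m2 (z + 1 / 2)).
  rewrite !Cmult_assoc, <- !qe_plus. f_equal. rewrite <- (qe_period _ (m1 * m2)). f_equal.
  unfold translation_phase, z. push_RtoC. field.
Qed.

(** The derivative in t brings down the quadratic exponent [E k], so the decay has to absorb a
    polynomial weight. Half of it is spent on that, and the other half, pi * eta * [E k], still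
    gives a summable Gaussian. *)
Lemma taylor2_klein (x1 x2 eta : R) : (0 < eta)%R -> taylor2 (fun t => (eta <= Im t)%R) (fun t => klein x1 x2 t).
Proof.
  intros He. pose proof PI_RGT_0 as P.
  (* With ep <= 1 one has 1 + y <= exp(ep y)/ep, and with ep <= eta/4 its square costs at most
     exp(eta y/2). *)
  set (s := (x1 - 1 / 2)%R). set (ep := Rmin 1 (eta / 4)).
  assert (Hep : (0 < ep)%R) by (apply Rmin_glb_lt; lra).
  assert (Hep1 : (ep <= 1)%R) by apply Rmin_l. assert (Hep2 : (ep <= eta / 4)%R) by apply Rmin_r.
  destruct (summable_gauss (PI * eta * Rabs s) (PI * eta / 2)) as [b [Hb H]]; [nra|].
  set (E := fun k : Z => ((IZR k - 1 / 2 + x1) ^ 2 / 2)%R).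
  set (p := fun k : Z => 2 * RtoC PI * Ci * RtoC (x1 * x2 / 2 + (IZR k - 1 / 2) * x2 + IZR k / 2)).
  assert (Ek : forall k w, Cexp (p k + 2 * RtoC PI * Ci * RtoC (E k) * w) = klein_term x1 x2 w k).
  { intros k w. unfold klein_term, qe, p, E. f_equal. ring. }
  apply taylor2_zser_Cexp with (e := fun k => 2 * RtoC PI * Ci * RtoC (E k)) (p := p) (b := fun n => (/ ep ^ 2 * b n)%R).
  - apply summable_scal; [left; apply Rinv_0_lt_compat, pow_lt; lra|exact Hb].
  - intros w Hw k. rewrite Ek. unfold klein_term. rewrite Cmod_qe.
    assert (HE : (0 <= E k)%R) by (unfold E; pose proof (pow2_ge_0 (IZR k - 1 / 2 + x1)); lra).
    rewrite !Cmod_mult, Cmod_Ci, !Cmod_R. rewrite (Rabs_pos_eq 2), (Rabs_pos_eq PI), (Rabs_pos_eq (E k)) by lra.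
    set (y := (2 * PI * E k)%R). assert (Hy : (0 <= y)%R) by (unfold y; apply Rmult_le_pos; lra).
    replace (2 * PI * 1 * E k)%R with y by (unfold y; ring).
    match goal with |- (_ * exp ?a <= _)%R => replace a with (- (y * Im w))%R end.
    2:{ unfold y, E. destruct w. simpl. field. }
    assert (A1 : (1 + y <= / ep * exp (ep * y))%R).
    { apply Rmult_le_reg_l with ep; [lra|]. rewrite <- Rmult_assoc, Rinv_r by lra.
      pose proof (exp_ineq1_le (ep * y)). nra. }
    assert (A2 : ((1 + y) ^ 2 <= / ep ^ 2 * exp (eta / 2 * y))%R).
    { apply Rle_trans with ((/ ep * exp (ep * y)) ^ 2)%R; [apply pow_incr; lra|].
      replace ((/ ep * exp (ep * y)) ^ 2)%R with (/ ep ^ 2 * (exp (ep * y) * exp (ep * y)))%R by (field; lra).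
      rewrite <- exp_plus. apply Rmult_le_compat_l; [left; apply Rinv_0_lt_compat, pow_lt; lra|]. apply exp_le. nra. }
    apply Rle_trans with (/ ep ^ 2 * exp (eta / 2 * y) * exp (- (y * Im w)))%R.
    { apply Rmult_le_compat_r; [left; apply exp_pos|exact A2]. }
    rewrite Rmult_assoc, <- exp_plus. apply Rmult_le_compat_l; [left; apply Rinv_0_lt_compat, pow_lt; lra|].
    eapply Rle_trans; [|apply H]. apply exp_le.
    apply Rle_trans with (- (PI * eta * E k))%R. { unfold y in *. nra. }
    assert (Q : (IZR k ^ 2 / 2 - Rabs (IZR k) * Rabs s <= E k)%R).
    { unfold E. replace (IZR k - 1 / 2 + x1)%R with (IZR k + s)%R by (unfold s; ring).
      rewrite <- Rabs_mult. pose proof (Rle_abs (- (IZR k * s))). rewrite Rabs_Ropp in H0. pose proof (pow2_ge_0 s). lra. }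
    assert (PE : (0 < PI * eta)%R) by (apply Rmult_lt_0_compat; lra).
    apply (Rmult_le_compat_l (PI * eta)) in Q; [|lra]. lra.
  - intros w Hw. assert (Ht : in_H w) by (unfold in_H; lra).
    eapply zser_ext; [intros k; symmetry; apply Ek|]. apply klein_spec, Ht.
Qed.

Lemma taylor2_pow (U : C -> Prop) (F : C -> C) (n : nat) : taylor2 U F -> taylor2 U (fun w => Cpow (F w) n).
Proof. intros H. induction n; simpl; [apply taylor2_const|apply taylor2_mult; assumption]. Qed.

Lemma taylor2_nonzero_near (z : C) (r : R) (G : C -> C) : (0 < r)%R -> taylor2 (fun w => (Cmod (w - z) < r)%R) G -> G z <> 0 ->
  exists r' c, (0 < r' <= r)%R /\ (0 < c)%R /\ forall w, (Cmod (w - z) < r')%R -> (c <= Cmod (G w))%R.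
Proof.
  intros Hr [D [K [HK H]]] Hz. set (g := Cmod (G z)). assert (Hg : (0 < g)%R) by (apply Cmod_gt_0, Hz).
  assert (P : (0 < g / (4 * (K + 1)))%R) by (apply Rdiv_lt_0_compat; lra).
  exists (Rmin r (g / (4 * (K + 1)))), (g / 2)%R. split; [split; [apply Rmin_glb_lt; assumption|apply Rmin_l]|]. split; [lra|].
  intros w Hw. pose proof (Rmin_l r (g / (4 * (K + 1)))). pose proof (Rmin_r r (g / (4 * (K + 1)))).
  assert (Uz : (Cmod (z - z) < r)%R) by (replace (z - z) with (RtoC 0) by ring; rewrite Cmod_0; exact Hr).
  pose proof (taylor2_with_lip _ G D K HK H z w Uz ltac:(lra)) as L.
  pose proof (Cmod_triangle_minus (G w) (G w - G z)) as T. replace (G w - (G w - G z)) with (G z) in T by ring. fold g in T.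
  pose proof (Cmod_ge_0 (w - z)).
  assert (Q : (2 * K * Cmod (w - z) <= g / 2)%R).
  { apply Rle_trans with (2 * (K + 1) * (g / (4 * (K + 1))))%R; [|right; field; lra].
    apply Rmult_le_compat; lra. }
  lra.
Qed.

(** For the lattice Z + N tau Z the coordinates (u/N, v/2) describe the point u tau + v/2. *)
Definition klein_quot (N u1 v1 u2 v2 : Z) (tau : C) : C :=
  klein (IZR u1 / IZR N) (IZR v1 / 2) (zc N * tau) / klein (IZR u2 / IZR N) (IZR v2 / 2) (zc N * tau).

Lemma in_H_scale (N : Z) (tau : C) : (0 < N)%Z -> in_H tau -> in_H (zc N * tau).
Proof. intros HN. apply IZR_lt in HN. unfold in_H. destruct tau as [x y]. simpl. intros H. nra. Qed.

Lemma klein_quot_den_nz (N u v : Z) (t : C) : (0 < N)%Z -> ~ (N | u)%Z -> in_H t -> klein (IZR u / IZR N) (IZR v / 2) t <> 0.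
Proof.
  intros HN Hu Ht. apply klein_nz; [exact Ht|]. intros n E. apply Hu. exists n. apply eq_IZR. rewrite mult_IZR, <- E. field.
  apply IZR_lt in HN. lra.
Qed.

Lemma near_in_H (z w : C) : (Cmod (w - z) < Im z)%R -> in_H w.
Proof.
  intros H. pose proof (Rmax_Cmod (w - z)) as M. pose proof (Rmax_r (Rabs (fst (w - z))) (Rabs (snd (w - z)))) as M2.
  unfold in_H, Im in *. destruct z as [x y], w as [a b]. simpl in *.
  pose proof (Rle_abs (- (b + - y))). rewrite Rabs_Ropp in H0. lra.
Qed.

Lemma taylor2_klein_near (N : Z) (x1 x2 : R) (z : C) : (0 < N)%Z -> in_H z ->
  taylor2 (fun w => (Cmod (w - z) < Im z / 2)%R) (fun w => klein x1 x2 (zc N * w)).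
Proof.
  intros HN Hz. unfold in_H in Hz. pose proof (IZR_lt _ _ HN) as HNR.
  apply (taylor2_comp _ (fun t => (IZR N * (Im z / 2) <= Im t)%R) (fun t => klein x1 x2 t) (fun w => zc N * w)).
  - intros w Hw. pose proof (Rmax_Cmod (w - z)) as M. pose proof (Rmax_r (Rabs (fst (w - z))) (Rabs (snd (w - z)))) as M2.
    rewrite im_scal_l. apply Rmult_le_compat_l; [lra|]. unfold Im in *. destruct z as [x y], w as [a b]. simpl in *.
    pose proof (Rle_abs (- (b + - y))). rewrite Rabs_Ropp in H. lra.
  - apply taylor2_klein. apply Rmult_lt_0_compat; lra.
  - apply taylor2_mult; [apply taylor2_const|]. apply taylor2_id with (Cmod z + Im z / 2)%R.
    + intros w Hw. pose proof (Cmod_triangle (w - z) z). replace (w - z + z) with w in H by ring. lra.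
    + pose proof (Cmod_ge_0 z). lra.
Qed.

Lemma klein_quot_meromorphic (N u1 v1 u2 v2 : Z) (kappa : C) (e : nat) (f : C -> C) : (0 < N)%Z -> ~ (N | u2)%Z ->
  (forall tau, in_H tau -> f tau = Cpow (kappa * klein_quot N u1 v1 u2 v2 tau) e) -> meromorphic_on_H f.
Proof.
  intros HN Hu Hf z0 Hz0.
  assert (Holo : forall z, in_H z -> holo_at f z).
  { intros z Hz. pose proof (taylor2_klein_near N (IZR u1 / IZR N) (IZR v1 / 2) z HN Hz) as S1.
    pose proof (taylor2_klein_near N (IZR u2 / IZR N) (IZR v2 / 2) z HN Hz) as S2.
    assert (Hz2 : (0 < Im z / 2)%R) by (unfold in_H in Hz; lra).
    destruct (taylor2_nonzero_near z _ _ Hz2 S2 (klein_quot_den_nz N u2 v2 _ HN Hu (in_H_scale N z HN Hz))) as [r [c [Hr [Hc B]]]].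
    apply taylor2_holo with (U := fun w => (Cmod (w - z) < r)%R) (r := r); [lra|auto|].
    apply taylor2_ext with (fun w => Cpow (kappa * klein_quot N u1 v1 u2 v2 w) e).
    { intros w Hw. symmetry. apply Hf. apply near_in_H with z. lra. }
    apply taylor2_pow, taylor2_mult; [apply taylor2_const|].
    apply taylor2_div with c; [exact Hc|exact B| |]; eapply taylor2_sub; [| exact S1| |exact S2]; intros w Hw; cbv beta in *; lra. }
  (* The denominator has no zeros on H, so f is holomorphic there: order 0 with f itself as the
     holomorphic factor. *)
  exists 0%Z, (Im z0), f. split; [exact Hz0|]. split.
  - intros z Hz. apply Holo, near_in_H with z0, Hz.
  - intros z _ _. simpl. ring.
Qed.

Lemma mob_scale (N a b c' d : Z) (tau : C) : SL2Z a b (N * c') d -> in_H tau -> (0 < N)%Z ->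
  zc N * mob a b (N * c') d tau = mob a (N * b) c' d (zc N * tau).
Proof.
  intros H Ht HN. pose proof (mob_den_nz _ _ _ _ tau H Ht) as Nz. unfold mob. rewrite mult_IZR, RtoC_mult in *. push_RtoC.
  field. replace (zc c' * (zc N * tau) + zc d) with (zc N * zc c' * tau + zc d) by ring. exact Nz.
Qed.

(** The first four equations, after clearing denominators, say that the matrix (a, N b; c', d)
    acting on N tau moves the coordinates of the two forms by the integer vectors (m1, m2) and (n1,
    n2). The covariance constants cancel, and l is e times the difference of the two translation
    phases. *)
Lemma klein_quot_invariant (N u1 v1 u2 v2 : Z) (kappa : C) (e : nat) (a b c' d m1 m2 n1 n2 l : Z) (tau : C) :
  (0 < N)%Z -> ~ (N | u2)%Z -> SL2Z a b (N * c') d -> in_H tau ->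
  (2 * u1 * a + N * v1 * c' = 2 * u1 + 2 * N * m1)%Z -> (2 * u1 * b + v1 * d = v1 + 2 * m2)%Z ->
  (2 * u2 * a + N * v2 * c' = 2 * u2 + 2 * N * n1)%Z -> (2 * u2 * b + v2 * d = v2 + 2 * n2)%Z ->
  (INR e * (translation_phase (IZR u1 / IZR N) (IZR v1 / 2) m1 m2 - translation_phase (IZR u2 / IZR N) (IZR v2 / 2) n1 n2) = IZR l)%R ->
  Cpow (kappa * klein_quot N u1 v1 u2 v2 (mob a b (N * c') d tau)) e = Cpow (kappa * klein_quot N u1 v1 u2 v2 tau) e.
Proof.
  intros HN Hu H Ht E1 E2 E3 E4 El. unfold klein_quot. rewrite (mob_scale N a b c' d tau H Ht HN).
  assert (H' : SL2Z a (N * b) c' d) by (unfold SL2Z in *; rewrite <- H; ring).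
  pose proof (in_H_scale N tau HN Ht) as Ht'.
  assert (HNR : IZR N <> 0%R) by (apply IZR_lt in HN; lra).
  destruct (klein_covariant_SL2Z _ _ _ _ H' _ Ht') as [C0 [N0 E]]. rewrite !E.
  assert (T : forall u v k1 k2, (2 * u * a + N * v * c' = 2 * u + 2 * N * k1)%Z -> (2 * u * b + v * d = v + 2 * k2)%Z ->
    klein (IZR u / IZR N * IZR a + IZR v / 2 * IZR c') (IZR u / IZR N * IZR (N * b) + IZR v / 2 * IZR d) (zc N * tau)
    = qe (RtoC (translation_phase (IZR u / IZR N) (IZR v / 2) k1 k2)) * klein (IZR u / IZR N) (IZR v / 2) (zc N * tau)).
  { intros u v k1 k2 F1 F2. rewrite <- klein_translate by exact Ht'.
    apply (f_equal IZR) in F1. apply (f_equal IZR) in F2. repeat rewrite ?plus_IZR, ?mult_IZR in F1; repeat rewrite ?plus_IZR, ?mult_IZR in F2.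
    f_equal.
    - apply Rmult_eq_reg_l with (2 * IZR N)%R; [|nra].
      transitivity (2 * IZR u * IZR a + IZR N * IZR v * IZR c')%R; [field; exact HNR|rewrite F1; field; exact HNR].
    - rewrite mult_IZR. apply Rmult_eq_reg_l with 2%R; [|lra].
      transitivity (2 * IZR u * IZR b + IZR v * IZR d)%R; [field; exact HNR|rewrite F2; field]. }
  rewrite (T u1 v1 m1 m2 E1 E2), (T u2 v2 n1 n2 E3 E4).
  pose proof (klein_quot_den_nz N u2 v2 (zc N * tau) HN Hu Ht') as Nd.
  set (k1 := klein (IZR u1 / IZR N) (IZR v1 / 2) (zc N * tau)). set (k2 := klein (IZR u2 / IZR N) (IZR v2 / 2) (zc N * tau)) in *.
  set (p1 := translation_phase (IZR u1 / IZR N) (IZR v1 / 2) m1 m2) in *. set (p2 := translation_phase (IZR u2 / IZR N) (IZR v2 / 2) n1 n2) in *.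
  replace (kappa * (C0 * (qe (RtoC p1) * k1) / (C0 * (qe (RtoC p2) * k2)))) with (qe (RtoC (p1 - p2)) * (kappa * (k1 / k2))).
  - rewrite Cpow_mult_l, qe_pow, <- RtoC_mult, El, qe_int. ring.
  - rewrite RtoC_minus, qe_minus. field. repeat split; auto using qe_nz.
Qed.

(** * Power series at a cusp *)

(** A positive radius of convergence, recorded as a bound on the coefficients so that products and
    reciprocals can be estimated directly. Expansions are required only for q different from 0,
    since q will be an exponential. *)
Definition geom_bounded (a : nat -> C) : Prop :=
  exists K R0, (0 <= K)%R /\ (0 < R0)%R /\ forall n, (Cmod (a n) <= K * R0 ^ n)%R.

Definition series_near_0 (F : C -> C) (a : nat -> C) : Prop :=
  exists rho, (0 < rho)%R /\ forall q, (0 < Cmod q < rho)%R -> Cser (fun n => a n * Cpow q n) (F q).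

Definition analytic_near_0 (F : C -> C) : Prop := exists a, geom_bounded a /\ series_near_0 F a.

Definition conv (a b : nat -> C) (n : nat) : C := csum (fun k => a k * b (n - k)%nat) (S n).

Lemma csum_conv (a b : nat -> C) (n : nat) : csum (conv a b) n = csum (fun k => a k * csum b (n - k)) n.
Proof.
  induction n; [reflexivity|]. simpl csum at 1. rewrite IHn. unfold conv.
  change (csum (fun k => a k * csum b (S n - k)) (S n)) with (csum (fun k => a k * csum b (S n - k)) n + a n * csum b (S n - n)).
  replace (csum (fun k => a k * csum b (S n - k)) n) with (csum (fun k => a k * csum b (n - k) + a k * b (n - k)%nat) n).
  - rewrite csum_plus. change (csum (fun k => a k * b (n - k)%nat) (S n)) with (csum (fun k => a k * b (n - k)%nat) n + a n * b (n - n)%nat).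
    replace (S n - n)%nat with 1%nat by lia. replace (n - n)%nat with O by lia. simpl. ring.
  - apply csum_ext. intros k Hk. replace (S n - k)%nat with (S (n - k)) by lia. simpl. ring.
Qed.

(** The n-th partial sum of the Cauchy product is the sum over k < n of [a k] times the partial sum
    of b of length n - k. These are bounded and converge, so dominated convergence in k applies. *)
Lemma Cser_conv (a b : nat -> C) (s t : C) (ba bb : nat -> R) : summable ba -> summable bb ->
  (forall k, (Cmod (a k) <= ba k)%R) -> (forall k, (Cmod (b k) <= bb k)%R) ->
  Cser a s -> Cser b t -> Cser (conv a b) (s * t).
Proof.
  intros Sa Sb Ha Hb As Bt. destruct (Ccv_bounded _ _ Bt) as [B [HB Bd]].
  apply Ccv_ext with (fun n => csum (fun k => a k * csum b (n - k)) n). { intros n. symmetry. apply csum_conv. }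
  apply tannery with (a := fun n k => if le_lt_dec n k then RtoC 0 else a k * csum b (n - k)) (l := fun k => a k * t) (b := fun k => (B * ba k)%R).
  - apply summable_scal; [lra|exact Sa].
  - intros n k. destruct (le_lt_dec n k).
    + rewrite Cmod_0. apply Rmult_le_pos; [lra|apply Sa].
    + rewrite Cmod_mult, Rmult_comm. apply Rmult_le_compat; auto using Cmod_ge_0.
  - intros k. pose proof (Ccv_scal (a k) _ _ Bt) as L. intros eps He. destruct (L eps He) as [n0 Hn].
    exists (n0 + k + 1)%nat. intros n Hle. destruct (le_lt_dec n k); [lia|]. apply Hn. lia.
  - intros n. replace (csum (fun k => a k * csum b (n - k)) n) with (csum (fun k => if le_lt_dec n k then RtoC 0 else a k * csum b (n - k)) n).
    + apply Cser_finite. intros k Hk. destruct (le_lt_dec n k); [reflexivity|lia].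
    + apply csum_ext. intros k Hk. destruct (le_lt_dec n k); [lia|reflexivity].
  - rewrite (Cmult_comm s t). eapply Cser_ext; [|apply (Cser_scal t), As]. intros k. cbv beta. ring.
Qed.

Lemma pow_succ_le (n : nat) : (INR (S n) <= 2 ^ n)%R.
Proof. induction n; [simpl; lra|]. rewrite S_INR. simpl pow. pose proof (pow_R1_Rle 2 n ltac:(lra)). lra. Qed.

Lemma geom_bounded_conv (a b : nat -> C) : geom_bounded a -> geom_bounded b -> geom_bounded (conv a b).
Proof.
  intros [K [R1 [HK [HR Ha]]]] [K' [R2 [HK' [HR' Hb]]]].
  set (M := Rmax R1 R2). assert (M1 : (R1 <= M)%R) by apply Rmax_l. assert (M2 : (R2 <= M)%R) by apply Rmax_r.
  exists (K * K')%R, (2 * M)%R. split; [apply Rmult_le_pos; assumption|]. split; [lra|]. intros n. unfold conv.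
  eapply Rle_trans; [apply csum_bound with (b := fun _ => (K * K' * M ^ n)%R)|].
  - intros k Hk. rewrite Cmod_mult. replace (M ^ n)%R with (M ^ k * M ^ (n - k))%R by (rewrite <- pow_add; f_equal; lia).
    replace (K * K' * (M ^ k * M ^ (n - k)))%R with (K * M ^ k * (K' * M ^ (n - k)))%R by ring.
    apply Rmult_le_compat; try apply Cmod_ge_0.
    + eapply Rle_trans; [apply Ha|]. apply Rmult_le_compat_l; [exact HK|apply pow_incr; lra].
    + eapply Rle_trans; [apply Hb|]. apply Rmult_le_compat_l; [exact HK'|apply pow_incr; lra].
  - rewrite rsum_const, Rpow_mult_distr. pose proof (pow_succ_le n).
    replace (K * K' * (2 ^ n * M ^ n))%R with (2 ^ n * (K * K' * M ^ n))%R by ring. apply Rmult_le_compat_r; [|assumption].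
    apply Rmult_le_pos; [apply Rmult_le_pos; assumption|apply pow_le; lra].
Qed.

Lemma geom_bounded_dom (a : nat -> C) : geom_bounded a -> exists rho, (0 < rho)%R /\
  forall q, (Cmod q < rho)%R -> exists b, summable b /\ forall n, (Cmod (a n * Cpow q n) <= b n)%R.
Proof.
  intros [K [R1 [HK [HR Ha]]]]. assert (Pi : (0 < / R1)%R) by (apply Rinv_0_lt_compat; exact HR). exists (/ R1)%R. split; [exact Pi|].
  intros q Hq. exists (fun n => (K * (R1 * Cmod q) ^ n)%R). split.
  - apply summable_geom; [|exact HK]. pose proof (Cmod_ge_0 q). split; [apply Rmult_le_pos; lra|].
    rewrite <- (Rinv_r R1) by lra. apply Rmult_lt_compat_l; assumption.
  - intros n. rewrite Cmod_mult, Cmod_pow, Rpow_mult_distr, <- Rmult_assoc.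
    apply Rmult_le_compat_r; [apply pow_le, Cmod_ge_0|apply Ha].
Qed.

Lemma conv_pow (a b : nat -> C) (q : C) (n : nat) :
  conv (fun k => a k * Cpow q k) (fun k => b k * Cpow q k) n = conv a b n * Cpow q n.
Proof.
  unfold conv. rewrite Cmult_comm, <- csum_scal. apply csum_ext. intros k Hk.
  replace (Cpow q n) with (Cpow q k * Cpow q (n - k)) by (rewrite <- Cpow_add_r; f_equal; lia). ring.
Qed.

Lemma series_near_0_mult (F G : C -> C) (a b : nat -> C) : geom_bounded a -> geom_bounded b -> series_near_0 F a -> series_near_0 G b ->
  series_near_0 (fun q => F q * G q) (conv a b).
Proof.
  intros Ga Gb [r1 [Hr1 H1]] [r2 [Hr2 H2]].
  destruct (geom_bounded_dom a Ga) as [r3 [Hr3 H3]]. destruct (geom_bounded_dom b Gb) as [r4 [Hr4 H4]].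
  exists (Rmin (Rmin r1 r2) (Rmin r3 r4)). split; [repeat apply Rmin_glb_lt; assumption|]. intros q [Hq0 Hq].
  pose proof (Rmin_l (Rmin r1 r2) (Rmin r3 r4)). pose proof (Rmin_r (Rmin r1 r2) (Rmin r3 r4)).
  pose proof (Rmin_l r1 r2). pose proof (Rmin_r r1 r2). pose proof (Rmin_l r3 r4). pose proof (Rmin_r r3 r4).
  destruct (H3 q ltac:(lra)) as [ba [Sa Ba]]. destruct (H4 q ltac:(lra)) as [bb [Sb Bb]].
  eapply Cser_ext; [apply conv_pow|].
  apply Cser_conv with ba bb; try assumption; [apply H1; lra|apply H2; lra].
Qed.

Lemma analytic_near_0_mult (F G : C -> C) : analytic_near_0 F -> analytic_near_0 G -> analytic_near_0 (fun q => F q * G q).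
Proof.
  intros [a [Ga Ha]] [b [Gb Hb]]. exists (conv a b). split; [apply geom_bounded_conv; assumption|apply series_near_0_mult; assumption].
Qed.

Lemma analytic_near_0_const (c : C) : analytic_near_0 (fun _ => c).
Proof.
  exists (fun n => match n with O => c | S _ => 0 end). split.
  - exists (Cmod c), 1%R. split; [apply Cmod_ge_0|]. split; [lra|]. intros [|n]; rewrite pow1, Rmult_1_r; [lra|rewrite Cmod_0; apply Cmod_ge_0].
  - exists 1%R. split; [lra|]. intros q _.
    assert (S : Cser (fun n => match n with O => c | S _ => 0 end * Cpow q n) (csum (fun n => match n with O => c | S _ => 0 end * Cpow q n) 1)).
    { apply Cser_finite. intros [|n] Hn; [lia|ring]. }
    replace (csum (fun n => match n with O => c | S _ => 0 end * Cpow q n) 1) with c in S by (simpl; ring). exact S.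
Qed.

Lemma analytic_near_0_pow (F : C -> C) (e : nat) : analytic_near_0 F -> analytic_near_0 (fun q => Cpow (F q) e).
Proof. intros H. induction e; simpl; [apply analytic_near_0_const|apply analytic_near_0_mult; assumption]. Qed.

(* Course-of-values recursion: [inv_table a n] is only meaningful at indices <= n. *)
Fixpoint inv_table (a : nat -> C) (n : nat) : nat -> C :=
  match n with
  | O => fun _ => / a O
  | S m => fun j => if le_lt_dec j m then inv_table a m j
                    else - / a O * csum (fun k => a (S k) * inv_table a m (m - k)%nat) (S m)
  end.

Definition inv_coef (a : nat -> C) (n : nat) : C := inv_table a n n.

Lemma inv_table_stable (a : nat -> C) (n j : nat) : (j <= n)%nat -> inv_table a n j = inv_coef a j.
Proof.
  intros H. induction H as [|n H IH]; [reflexivity|]. simpl. destruct (le_lt_dec j n); [exact IH|lia].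
Qed.

Lemma inv_coef_S (a : nat -> C) (n : nat) :
  inv_coef a (S n) = - / a O * csum (fun k => a (S k) * inv_coef a (n - k)%nat) (S n).
Proof.
  unfold inv_coef at 1. unfold inv_table; fold inv_table. destruct (le_lt_dec (S n) n); [lia|].
  f_equal. apply csum_ext. intros k Hk. rewrite inv_table_stable by lia. reflexivity.
Qed.

Lemma conv_S (a b : nat -> C) (n : nat) : conv a b (S n) = a O * b (S n) + csum (fun k => a (S k) * b (n - k)%nat) (S n).
Proof.
  unfold conv. pose proof (csum_shift (fun k => a k * b (S n - k)%nat) (S n)) as E. cbv beta in E.
  change (csum (fun k => a k * b (S n - k)%nat) (S (S n))) with (csum (fun k => a k * b (S n - k)%nat) (S n) + a (S n) * b (S n - S n)%nat).
  rewrite <- E. replace (S n - 0)%nat with (S n) by lia. rewrite Cplus_comm. f_equal.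
Qed.

Lemma conv_inv (a : nat -> C) (n : nat) : a O <> 0 -> conv a (inv_coef a) n = match n with O => RtoC 1 | S _ => RtoC 0 end.
Proof.
  intros H. destruct n as [|n]; [unfold conv; simpl; unfold inv_coef; simpl; field; exact H|].
  rewrite conv_S, inv_coef_S. field. exact H.
Qed.

(** The rate S1 = R1 (1 + L K) is chosen so that L K R1 = S1 - R1. The geometric sum from the
    recursion then telescopes to S1^(n+1) - R1^(n+1). *)
Lemma geom_bounded_inv (a : nat -> C) : geom_bounded a -> a O <> 0 -> geom_bounded (inv_coef a).
Proof.
  intros [K [R1 [HK [HR Ha]]]] H0. set (L := Cmod (/ a O)).
  assert (HL : (0 < L)%R). { unfold L. apply Cmod_gt_0. intros E. apply C1_nz. rewrite <- (Cinv_r (a O) H0), E. ring. }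
  assert (HLK : (0 <= L * K)%R) by (apply Rmult_le_pos; lra).
  set (S1 := (R1 + R1 * (L * K))%R). assert (HS : (0 < S1)%R) by (unfold S1; nra).
  exists L, S1. split; [lra|]. split; [exact HS|].
  assert (Gm : forall n, (L * K * rsum (fun k => R1 ^ S k * S1 ^ (n - k)) (S n) <= S1 ^ S n)%R).
  { intros n. assert (E : forall m, (m <= S n)%nat -> (L * K * rsum (fun k => R1 ^ S k * S1 ^ (n - k)) m = S1 ^ S n - R1 ^ m * S1 ^ (S n - m))%R).
    { induction m; intros Hm; [simpl; ring|].
      change (rsum (fun k => R1 ^ S k * S1 ^ (n - k)) (S m))%R with (rsum (fun k => R1 ^ S k * S1 ^ (n - k)) m + R1 ^ S m * S1 ^ (n - m))%R.
      rewrite Rmult_plus_distr_l, IHm by lia.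
      replace (S n - m)%nat with (S (n - m)) by lia. replace (S n - S m)%nat with (n - m)%nat by lia.
      change (S1 ^ S (n - m))%R with (S1 * S1 ^ (n - m))%R. change (R1 ^ S m)%R with (R1 * R1 ^ m)%R.
      generalize (S1 ^ (n - m))%R (S1 ^ S n)%R. intros x y. unfold S1. ring. }
    rewrite E by lia. pose proof (pow_le R1 (S n) ltac:(lra)). pose proof (pow_le S1 (S n - S n) ltac:(lra)).
    pose proof (Rmult_le_pos _ _ H H1). lra. }
  intros n. induction n as [n IH] using (well_founded_induction lt_wf). destruct n as [|n].
  - unfold inv_coef. simpl. fold L. lra.
  - rewrite inv_coef_S, Cmod_mult, Cmod_opp. fold L. apply Rmult_le_compat_l; [lra|].
    eapply Rle_trans; [|apply Gm].
    eapply Rle_trans; [apply csum_bound with (b := fun k => (L * K * (R1 ^ S k * S1 ^ (n - k)))%R)|rewrite rsum_scal; lra].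
    intros k Hk. rewrite Cmod_mult. pose proof (Ha (S k)). pose proof (IH (n - k)%nat ltac:(lia)).
    replace (L * K * (R1 ^ S k * S1 ^ (n - k)))%R with (K * R1 ^ S k * (L * S1 ^ (n - k)))%R by ring.
    apply Rmult_le_compat; auto using Cmod_ge_0.
Qed.

Lemma analytic_near_0_inv (F : C -> C) (a : nat -> C) : geom_bounded a -> series_near_0 F a -> a O <> 0 ->
  exists rho, (0 < rho)%R /\ exists G, analytic_near_0 G /\ forall q, (0 < Cmod q < rho)%R -> F q * G q = 1.
Proof.
  intros Ga Ha H0. pose proof (geom_bounded_inv a Ga H0) as Gi.
  destruct (geom_bounded_dom _ Gi) as [r1 [Hr1 D]].
  set (G := fun q => epsilon (inhabits (RtoC 0)) (Cser (fun n => inv_coef a n * Cpow q n))).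
  assert (HG : series_near_0 G (inv_coef a)).
  { exists r1. split; [exact Hr1|]. intros q [_ Hq]. unfold G. apply epsilon_spec.
    destruct (D q Hq) as [b [Sb Hb]]. apply dom_ser with b; assumption. }
  destruct (series_near_0_mult F G a (inv_coef a) Ga Gi Ha HG) as [rho [Hrho H]].
  exists rho. split; [exact Hrho|]. exists G. split; [exists (inv_coef a); split; assumption|].
  intros q Hq. apply (Cser_unique _ _ _ (H q Hq)).
  replace (RtoC 1) with (csum (fun n => conv a (inv_coef a) n * Cpow q n) 1).
  - apply Cser_finite. intros [|n] Hn; [lia|]. rewrite conv_inv by exact H0. ring.
  - simpl. rewrite conv_inv by exact H0. ring.
Qed.

Lemma Cser_shift (a : nat -> C) (s : C) (m : nat) : (forall k, (k < m)%nat -> a k = 0) -> Cser a s -> Cser (fun k => a (k + m)%nat) s.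
Proof.
  intros Hz H. apply Ccv_ext with (fun n => csum a (n + m)).
  - intros n. induction n; simpl.
    + clear H. induction m; [reflexivity|]. simpl. rewrite IHm by (intros; apply Hz; lia). rewrite Hz by lia. ring.
    + rewrite IHn. reflexivity.
  - apply (Ccv_subseq (csum a) s (fun n => (n + m)%nat)); [intros; lia|exact H].
Qed.

(** Factor out of F2 its order of vanishing m; the remaining series has a nonzero constant term and
    can be inverted. The nonvanishing hypothesis only excludes that all coefficients of F2 are
    zero. *)
Lemma analytic_near_0_quotient (F1 F2 : C -> C) : analytic_near_0 F1 -> analytic_near_0 F2 ->
  (forall rho, (0 < rho)%R -> exists q, (0 < Cmod q < rho)%R /\ F2 q <> 0) ->
  exists m rho G, (0 < rho)%R /\ analytic_near_0 G /\ forall q, (0 < Cmod q < rho)%R -> F1 q / F2 q = / Cpow q m * G q.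
Proof.
  intros H1 [a [Ga [r2 [Hr2 H2]]]] Hnz.
  assert (Ex : exists m, a m <> 0 /\ forall k, (k < m)%nat -> a k = 0).
  { assert (Ne : exists n, a n <> 0).
    { apply NNPP. intros N. destruct (Hnz r2 Hr2) as [q [Hq Q]]. apply Q.
      apply (Cser_unique _ _ _ (H2 q Hq)). replace (RtoC 0) with (csum (fun n => a n * Cpow q n) 0) by reflexivity.
      apply Cser_finite. intros k _. replace (a k) with (RtoC 0); [ring|].
      apply NNPP. intros E. apply N. exists k. intros E'. apply E. symmetry. exact E'. }
    destruct Ne as [n Hn]. revert Hn. induction n as [n IH] using (well_founded_induction lt_wf). intros Hn.
    destruct (classic (exists k, (k < n)%nat /\ a k <> 0)) as [[k [Hk Hk']]|N]; [apply (IH k Hk Hk')|].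
    exists n. split; [exact Hn|]. intros k Hk. apply NNPP. intros E. apply N. exists k. auto. }
  destruct Ex as [m [Hm Hz]].
  set (a' := fun k => a (k + m)%nat).
  assert (Ga' : geom_bounded a').
  { destruct Ga as [K [R1 [HK [HR Ha]]]]. exists (K * R1 ^ m)%R, R1. split; [apply Rmult_le_pos; [exact HK|apply pow_le; lra]|]. split; [exact HR|].
    intros n. unfold a'. eapply Rle_trans; [apply Ha|]. rewrite pow_add. right. ring. }
  assert (Ha' : series_near_0 (fun q => F2 q / Cpow q m) a').
  { exists r2. split; [exact Hr2|]. intros q Hq. assert (Nq : q <> 0) by (apply Cmod_gt_0, Hq).
    assert (Nqm : Cpow q m <> 0) by (apply Cpow_nz, Nq).
    pose proof (Cser_shift (fun k => a k * Cpow q k) (F2 q) m ltac:(intros k Hk; cbv beta; rewrite Hz by exact Hk; ring) (H2 q Hq)) as S.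
    apply (Cser_scal (/ Cpow q m)) in S.
    replace (F2 q / Cpow q m) with (/ Cpow q m * F2 q) by (unfold Cdiv; ring).
    eapply Cser_ext; [|exact S]. intros k. cbv beta. unfold a'. rewrite Cpow_add_r. field. exact Nqm. }
  destruct (analytic_near_0_inv _ a' Ga' Ha' Hm) as [rho [Hrho [G [HG E]]]].
  exists m, rho, (fun q => F1 q * G q). split; [exact Hrho|]. split; [apply analytic_near_0_mult; assumption|].
  intros q Hq. specialize (E q Hq). assert (Nq : q <> 0) by (apply Cmod_gt_0, Hq).
  assert (Nqm : Cpow q m <> 0) by (apply Cpow_nz, Nq).
  assert (N2 : F2 q <> 0). { intros Z0. apply C1_nz. rewrite <- E, Z0. field. exact Nqm. }
  replace (F1 q / F2 q) with (F1 q / F2 q * (F2 q / Cpow q m * G q)) by (rewrite E; ring).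
  field. split; assumption.
Qed.

Lemma csum_indicator (c : C) (e : nat) (q : C) :
  Cser (fun m => (if Nat.eq_dec e m then c else 0) * Cpow q m) (c * Cpow q e).
Proof.
  replace (c * Cpow q e) with (csum (fun m => (if Nat.eq_dec e m then c else 0) * Cpow q m) (S e)).
  - apply Cser_finite. intros k Hk. destruct (Nat.eq_dec e k); [lia|ring].
  - simpl. destruct (Nat.eq_dec e e); [|lia].
    replace (csum (fun m => (if Nat.eq_dec e m then c else 0) * Cpow q m) e) with (RtoC 0); [ring|].
    assert (Z0 : forall n, (n <= e)%nat -> csum (fun m => (if Nat.eq_dec e m then c else 0) * Cpow q m) n = 0).
    { induction n; intros Hn; [reflexivity|]. simpl. rewrite IHn by lia. destruct (Nat.eq_dec e n); [lia|ring]. }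
    symmetry. apply Z0. lia.
Qed.

Definition sparse_coef (E : Z -> nat) (ph : Z -> C) (m : nat) (k : Z) : C := if Nat.eq_dec (E k) m then ph k else 0.

(** Collects the terms of a theta-like series by exponent. The condition on E means that exponent m
    occurs only for |k| <= m + c, so the coefficient of q^m is a finite sum, of size linear in m. *)
Lemma analytic_near_0_sparse (E : Z -> nat) (ph : Z -> C) (c : nat) (F : C -> C) :
  (forall k, (Z.abs_nat k <= E k + c)%nat) -> (forall k, (Cmod (ph k) <= 1)%R) ->
  (forall q, (0 < Cmod q < 1)%R -> zser (fun k => ph k * Cpow q (E k)) (F q)) -> analytic_near_0 F.
Proof.
  intros HE Hph HF.
  set (cf := fun K m => csum (sym (sparse_coef E ph m)) K).
  (* The first m + c + 1 symmetric terms already contain every k with exponent m, so the truncated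
     coefficients are constant from there on. *)
  assert (St : forall m K, (m + c + 1 <= K)%nat -> cf K m = cf (m + c + 1)%nat m).
  { intros m K HK. unfold cf. induction HK as [|K HK IH]; [reflexivity|]. simpl csum. rewrite IH.
    replace (sym (sparse_coef E ph m) K) with (RtoC 0); [ring|]. destruct K as [|K]; [lia|]. rewrite sym_S. unfold sparse_coef.
    pose proof (HE (Z.of_nat (S K))). pose proof (HE (- Z.of_nat (S K))%Z).
    destruct (Nat.eq_dec (E (Z.of_nat (S K))) m); [lia|]. destruct (Nat.eq_dec (E (- Z.of_nat (S K))%Z) m); [lia|]. ring. }
  assert (Bd0 : forall K m, (Cmod (cf K m) <= 2 * INR K)%R).
  { intros K m. unfold cf. eapply Rle_trans; [apply csum_bound with (b := fun _ => 2%R)|rewrite rsum_const; lra].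
    assert (B1 : forall k, (Cmod (sparse_coef E ph m k) <= 1)%R).
    { intros k. unfold sparse_coef. destruct (Nat.eq_dec (E k) m); [apply Hph|rewrite Cmod_0; lra]. }
    intros [|k] _; [unfold sym; specialize (B1 0%Z); lra|]. rewrite sym_S. eapply Rle_trans; [apply Cmod_triangle|].
    pose proof (B1 (Z.of_nat (S k))). pose proof (B1 (- Z.of_nat (S k))%Z). lra. }
  set (M := (2 * (INR c + 1))%R).
  assert (HM : (0 <= M)%R) by (unfold M; pose proof (pos_INR c); lra).
  assert (Bd : forall K m, (Cmod (cf K m) <= M * 2 ^ m)%R).
  { intros K m.
    assert (Q : (2 * INR (m + c + 1) <= M * 2 ^ m)%R).
    { pose proof (pow_succ_le m) as P. rewrite S_INR in P. rewrite !plus_INR. simpl INR. unfold M.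
      pose proof (pos_INR m). pose proof (pos_INR c). nra. }
    destruct (le_lt_dec (m + c + 1) K) as [L|L].
    - rewrite St by exact L. eapply Rle_trans; [apply Bd0|exact Q].
    - eapply Rle_trans; [apply Bd0|]. eapply Rle_trans; [|exact Q]. apply Rmult_le_compat_l; [lra|]. apply le_INR. lia. }
  exists (fun m => cf (m + c + 1)%nat m). split.
  - exists M, 2%R. split; [exact HM|]. split; [lra|]. intros n. apply Bd.
  - exists (1/2)%R. split; [lra|]. intros q [Hq0 Hq].
    assert (Ps : forall K, Cser (fun m => cf K m * Cpow q m) (csum (sym (fun k => ph k * Cpow q (E k))) K)).
    { intros K. induction K.
      - apply (Cser_finite (fun m => cf 0%nat m * Cpow q m) 0). intros k _. unfold cf. simpl. ring.
      - simpl csum. apply Cser_ext with (fun m => cf K m * Cpow q m + sym (sparse_coef E ph m) K * Cpow q m).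
        { intros m. unfold cf. simpl. ring. }
        apply Cser_plus; [exact IHK|]. destruct K as [|K].
        + apply csum_indicator.
        + rewrite sym_S. eapply Cser_ext; [|apply Cser_plus; apply csum_indicator]. intros m. cbv beta. rewrite sym_S. unfold sparse_coef. ring. }
    assert (D : summable (fun m => (M * (2 * Cmod q) ^ m)%R)) by (apply summable_geom; [split; [|lra]; pose proof (Cmod_ge_0 q); lra|exact HM]).
    assert (Dm : forall K m, (Cmod (cf K m * Cpow q m) <= M * (2 * Cmod q) ^ m)%R).
    { intros K m. rewrite Cmod_mult, Cmod_pow, Rpow_mult_distr, <- Rmult_assoc. apply Rmult_le_compat_r; [apply pow_le, Cmod_ge_0|apply Bd]. }
    destruct (dom_ser (fun m => cf (m + c + 1)%nat m * Cpow q m) _ D (fun m => Dm _ m)) as [s Hs].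
    replace (F q) with s; [exact Hs|].
    assert (L : Ccv (csum (sym (fun k => ph k * Cpow q (E k)))) s).
    { apply tannery with (a := fun K m => cf K m * Cpow q m) (l := fun m => cf (m + c + 1)%nat m * Cpow q m) (b := fun m => (M * (2 * Cmod q) ^ m)%R); auto.
      intros m eps He. exists (m + c + 1)%nat. intros K HK. rewrite (St m K HK).
      match goal with |- (Cmod (?x - ?x) < _)%R => replace (x - x) with (RtoC 0) by ring end. rewrite Cmod_0. exact He. }
    apply (Ccv_unique _ _ _ L). apply HF. lra.
Qed.

(** * Expansions at the cusps *)

Lemma pow_decr (r : R) (m n : nat) : (0 <= r <= 1)%R -> (m <= n)%nat -> (r ^ n <= r ^ m)%R.
Proof.
  intros Hr H. induction H; [lra|]. simpl. pose proof (pow_le r m0 ltac:(lra)). nra.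
Qed.

(** For x1 = j/(2N) the exponent (k - 1/2 + x1)^2/2 equals (2Nk - N + j)^2/(8 N^2). With width 8 N^2
    D it becomes the natural number A X^2, while B and y2 only enter the phases [ph], of modulus
    1. *)
Lemma klein_qexp (A B D N j : Z) (y2 : R) : (0 < A)%Z -> (0 < D)%Z -> (0 < N)%Z ->
  exists F, analytic_near_0 F /\ forall tau, in_H tau ->
    klein (IZR j / (2 * IZR N)) y2 ((zc A * tau + zc B) / zc D) = F (qe (tau / zc (8 * N * N * D))).
Proof.
  intros HA HD HN. set (x1 := (IZR j / (2 * IZR N))%R).
  set (X := fun k : Z => (2 * N * k - N + j)%Z).
  set (E := fun k : Z => Z.to_nat (A * (X k * X k))).
  set (ph := fun k : Z => qe (RtoC ((IZR k - 1 / 2 + x1) ^ 2 / 2 * (IZR B / IZR D) + (x1 * y2 / 2 + (IZR k - 1 / 2) * y2 + IZR k / 2)))).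
  set (c := Z.to_nat (N + Z.abs j)).
  assert (HE : forall k, (Z.abs_nat k <= E k + c)%nat).
  { intros k. unfold E, c. apply Nat2Z.inj_le. rewrite Nat2Z.inj_add, Zabs2Nat.id_abs, !Z2Nat.id by nia.
    assert (H1 : (Z.abs (X k) <= A * (X k * X k))%Z) by nia. unfold X in *. nia. }
  assert (Hph : forall k, Cmod (ph k) = 1%R).
  { intros k. unfold ph. rewrite Cmod_qe, im_RtoC. replace (- (2 * PI * 0))%R with 0%R by ring. apply exp_0. }
  set (F := fun q => zsum (fun k => ph k * Cpow q (E k))).
  assert (HF : forall q, (0 < Cmod q < 1)%R -> zser (fun k => ph k * Cpow q (E k)) (F q)).
  { intros q Hq. apply zsum_zser with (fun n => (/ Cmod q ^ c * Cmod q ^ n)%R).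
    - apply summable_geom; [lra|]. left. apply Rinv_0_lt_compat, pow_lt. lra.
    - intros k. rewrite Cmod_mult, Hph, Rmult_1_l, Cmod_pow. pose proof (pow_lt (Cmod q) c ltac:(lra)).
      apply Rmult_le_reg_l with (Cmod q ^ c)%R; [lra|]. rewrite <- Rmult_assoc, Rinv_r, Rmult_1_l by lra.
      rewrite <- pow_add. apply pow_decr; [lra|]. specialize (HE k). lia. }
  exists F. split.
  - apply analytic_near_0_sparse with E ph c; [exact HE| |exact HF]. intros k. rewrite Hph. lra.
  - intros tau Ht. unfold klein, F. f_equal. apply functional_extensionality. intros k.
    unfold klein_term, ph. rewrite qe_pow, <- qe_plus. f_equal.
    assert (EE : INR (E k) = (IZR A * ((2 * IZR N * IZR k - IZR N + IZR j) * (2 * IZR N * IZR k - IZR N + IZR j)))%R).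
    { unfold E, X. rewrite INR_IZR_INZ, Z2Nat.id by (apply Z.mul_nonneg_nonneg; [lia|apply Z.square_nonneg]). repeat rewrite ?mult_IZR, ?plus_IZR, ?minus_IZR. reflexivity. }
    rewrite EE.
    assert (NR : IZR N <> 0%R) by (apply IZR_lt in HN; lra). assert (DR : IZR D <> 0%R) by (apply IZR_lt in HD; lra).
    assert (NC : zc N <> 0) by (intros Q; apply RtoC_inj in Q; auto). assert (DC : zc D <> 0) by (intros Q; apply RtoC_inj in Q; auto).
    replace ((IZR k - 1 / 2 + x1) ^ 2 / 2)%R with ((2 * IZR N * IZR k - IZR N + IZR j) * (2 * IZR N * IZR k - IZR N + IZR j) / (8 * IZR N * IZR N))%R
      by (unfold x1; field; exact NR).
    set (Y := (2 * IZR N * IZR k - IZR N + IZR j)%R).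
    rewrite (RtoC_div (Y * Y)) by nra.
    rewrite (RtoC_plus (_ * _)), (RtoC_mult (_ / _)), (RtoC_div (Y * Y)), (RtoC_div (IZR B)) by (assumption || nra).
    rewrite !mult_IZR, !RtoC_mult. field. split; assumption.
Qed.

(** Factors the product of diag(N, 1) with the given matrix as an element of SL2(Z) times the upper
    triangular matrix (A, B; 0, D). Here A is the gcd of the first column, Bezout coefficients
    complete the unimodular factor, and A D = N. *)
Lemma hermite_form (N a b c d : Z) : (0 < N)%Z -> SL2Z a b c d -> exists p r s t A B D : Z,
  SL2Z p r s t /\ (0 < A)%Z /\ (0 < D)%Z /\ (N * a = p * A)%Z /\ (c = s * A)%Z /\ (N * b = p * B + r * D)%Z /\ (d = s * B + t * D)%Z.
Proof.
  unfold SL2Z. intros HN H. set (g := Z.gcd (N * a) c).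
  assert (Hg : (0 < g)%Z).
  { pose proof (Z.gcd_nonneg (N * a) c). fold g in H0. destruct (Z.eq_dec g 0) as [E|E]; [|lia].
    apply Z.gcd_eq_0 in E. destruct E as [E1 E2]. subst c. assert (a = 0)%Z by nia. subst a. lia. }
  destruct (Z.gcd_divide_l (N * a) c) as [p Hp]. destruct (Z.gcd_divide_r (N * a) c) as [s Hs]. fold g in Hp, Hs.
  destruct (Z.gcd_bezout (N * a) c g eq_refl) as [u [v Huv]].
  assert (E1 : (u * p + v * s = 1)%Z).
  { apply (Z.mul_reg_r _ _ g); [lia|]. transitivity (u * (p * g) + v * (s * g))%Z; [ring|]. rewrite <- Hp, <- Hs. lia. }
  exists p, (- v)%Z, s, u, g, (u * (N * b) + v * d)%Z, (p * d - s * (N * b))%Z.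
  assert (DN : ((p * d - s * (N * b)) * g = N)%Z).
  { transitivity ((p * g) * d - (s * g) * (N * b))%Z; [ring|]. rewrite <- Hp, <- Hs. rewrite <- (Z.mul_1_r N) at 3. rewrite <- H. ring. }
  split; [lia|]. split; [exact Hg|]. split; [nia|]. split; [exact Hp|]. split; [exact Hs|]. split.
  - transitivity ((u * p + v * s) * (N * b))%Z; [rewrite E1; ring|ring].
  - transitivity ((u * p + v * s) * d)%Z; [rewrite E1; ring|ring].
Qed.

Lemma cusp_neighbourhood (h rho : R) : (0 < h)%R -> (0 < rho)%R -> exists y0, (0 <= y0)%R /\
  forall tau, (y0 < Im tau)%R -> (0 < Cmod (qe (tau / RtoC h)) < rho)%R.
Proof.
  intros Hh Hr. pose proof PI_RGT_0 as P. exists (Rmax 0 (- (h * ln rho / (2 * PI)))). split; [apply Rmax_l|].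
  intros tau Ht. pose proof (Rmax_r 0 (- (h * ln rho / (2 * PI)))) as M.
  rewrite Cmod_qe. split; [apply exp_pos|]. rewrite <- (exp_ln rho) by exact Hr. apply exp_increasing.
  replace (Im (tau / RtoC h)) with (Im tau / h)%R by (unfold Cdiv; rewrite <- RtoC_inv by lra; rewrite im_scal_r; reflexivity).
  assert (L : (- (h * ln rho / (2 * PI)) < Im tau)%R) by lra.
  apply Rmult_lt_compat_l with (r := (2 * PI / h)%R) in L; [|apply Rdiv_lt_0_compat; lra].
  replace (2 * PI / h * - (h * ln rho / (2 * PI)))%R with (- ln rho)%R in L by (field; lra).
  replace (2 * PI / h * Im tau)%R with (2 * PI * (Im tau / h))%R in L by (field; lra). lra.
Qed.

Lemma Czpow_opp (q : C) (n : nat) : Czpow q (- Z.of_nat n) = / Cpow q n.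
Proof.
  destruct n as [|n]; [simpl; field|]. simpl Z.of_nat. simpl Z.opp. unfold Czpow. rewrite SuccNat2Pos.id_succ. reflexivity.
Qed.

Lemma klein_quot_cusps (N u1 v1 u2 v2 : Z) (kappa : C) (e : nat) (f : C -> C) : (0 < N)%Z -> ~ (N | u2)%Z ->
  (forall tau, in_H tau -> f tau = Cpow (kappa * klein_quot N u1 v1 u2 v2 tau) e) -> meromorphic_at_cusps f.
Proof.
  intros HN Hu Hf a b c d H.
  destruct (hermite_form N a b c d HN H) as [p [r [s [t [A [B [D [H' [HA [HD [E1 [E2 [E3 E4]]]]]]]]]]]]].
  assert (NR : IZR N <> 0%R) by (apply IZR_lt in HN; lra). assert (DR : (0 < IZR D)%R) by (apply IZR_lt in HD; lra).
  assert (DC : zc D <> 0) by (intros Q; apply RtoC_inj in Q; lra).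
  set (h := (8 * N * N * D)%Z). assert (Hh : (0 < h)%Z) by (unfold h; nia).
  pose (tp := fun tau => (zc A * tau + zc B) / zc D).
  assert (Htp : forall tau, in_H tau -> in_H (tp tau)).
  { intros tau Ht. unfold tp, in_H, Cdiv in *. rewrite <- RtoC_inv by lra. rewrite im_scal_r.
    apply Rmult_lt_0_compat; [|apply Rinv_0_lt_compat; exact DR]. apply IZR_lt in HA. destruct tau as [x y]. simpl in *. nra. }
  assert (Hm : forall tau, in_H tau -> zc N * mob a b c d tau = mob p r s t (tp tau)).
  { intros tau Ht. pose proof (mob_den_nz _ _ _ _ tau H Ht) as Nz. pose proof (mob_den_nz _ _ _ _ (tp tau) H' (Htp tau Ht)) as Nz'.
    assert (Q : zc c * tau + zc d = (zc s * tp tau + zc t) * zc D).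
    { rewrite E2, E4. unfold tp. push_RtoC. field. exact DC. }
    unfold mob. apply (Cmult_reg_l (zc c * tau + zc d)); [exact Nz|].
    transitivity ((zc p * tp tau + zc r) * zc D); [|rewrite Q; field; exact Nz'].
    transitivity (zc (N * a) * tau + zc (N * b)); [push_RtoC; field; exact Nz|]. rewrite E1, E3. unfold tp. push_RtoC. field. exact DC. }
  assert (X : forall u v, exists F, analytic_near_0 F /\ forall tau, in_H tau ->
    klein (IZR u / IZR N * IZR p + IZR v / 2 * IZR s) (IZR u / IZR N * IZR r + IZR v / 2 * IZR t) (tp tau) = F (qe (tau / zc h))).
  { intros u v. destruct (klein_qexp A B D N (2 * u * p + N * v * s) (IZR u / IZR N * IZR r + IZR v / 2 * IZR t) HA HD HN) as [F [PF HF]].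
    exists F. split; [exact PF|]. intros tau Ht. fold h in HF. rewrite <- (HF tau Ht). unfold tp. f_equal.
    repeat rewrite ?mult_IZR, ?plus_IZR. field. exact NR. }
  destruct (X u1 v1) as [F1 [P1 HF1]]. destruct (X u2 v2) as [F2 [P2 HF2]]. clear X.
  assert (K : forall tau, in_H tau -> klein_quot N u1 v1 u2 v2 (mob a b c d tau) = F1 (qe (tau / zc h)) / F2 (qe (tau / zc h)) /\ F2 (qe (tau / zc h)) <> 0).
  { intros tau Ht. destruct (klein_covariant_SL2Z _ _ _ _ H' _ (Htp tau Ht)) as [C0 [N0 E]].
    pose proof (klein_quot_den_nz N u2 v2 (zc N * mob a b c d tau) HN Hu (in_H_scale N _ HN (in_H_mob _ _ _ _ _ H Ht))) as Nd.
    unfold klein_quot. rewrite Hm in * by exact Ht. rewrite !E in *. rewrite HF1, HF2 in * by exact Ht.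
    assert (N2 : F2 (qe (tau / zc h)) <> 0) by (intros Z0; apply Nd; rewrite Z0; ring).
    split; [field; split; assumption|exact N2]. }
  assert (HhR : (0 < IZR h)%R) by (apply IZR_lt in Hh; exact Hh).
  destruct (analytic_near_0_quotient F1 F2 P1 P2) as [m [rho [G [Hrho [PG HG]]]]].
  { intros rho Hrho. destruct (cusp_neighbourhood (IZR h) rho HhR Hrho) as [y0 [Hy0 Hq]].
    (* The value of q at i (y0 + 1): F2 is nonzero at every q coming from H, because the Klein form
       in the denominator is. *)
    exists (qe ((0, y0 + 1)%R / zc h)). split; [apply Hq; simpl; lra|]. apply K. unfold in_H. simpl. lra. }
  destruct (analytic_near_0_pow _ e (analytic_near_0_mult _ _ (analytic_near_0_const kappa) PG)) as [coef [_ [rho' [Hrho' HC]]]].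
  destruct (cusp_neighbourhood (IZR h) (Rmin rho rho') HhR ltac:(apply Rmin_glb_lt; assumption)) as [y0 [Hy0 Hq]].
  exists (Z.to_pos h), (- Z.of_nat (m * e))%Z, coef, y0. intros tau Ht. rewrite Z2Pos.id by exact Hh. cbv zeta.
  replace (Cexp (2 * RtoC PI * Ci * tau / RtoC (IZR h))) with (qe (tau / zc h)) by (unfold qe; f_equal; unfold Cdiv; ring).
  specialize (Hq tau Ht). pose proof (Rmin_l rho rho'). pose proof (Rmin_r rho rho').
  assert (HtH : in_H tau) by (unfold in_H; lra).
  set (q := qe (tau / zc h)) in *.
  exists (Cpow (kappa * G q) e). split; [apply Cser_is_series, HC; lra|].
  rewrite (Hf _ (in_H_mob _ _ _ _ _ H HtH)). destruct (K tau HtH) as [-> _]. fold q. rewrite HG by lra.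
  rewrite Czpow_opp. assert (Nq : Cpow q m <> 0) by (apply Cpow_nz, qe_nz).
  replace (Cpow q (m * e)) with (Cpow (Cpow q m) e).
  - rewrite <- (Cpow_inv (Cpow q m) e) by exact Nq. rewrite <- Cpow_mult_l. f_equal. ring.
  - clear. induction e; [rewrite Nat.mul_0_r; reflexivity|]. rewrite Nat.mul_succ_r, Cpow_add_r, Cpow_S, IHe. ring.
Qed.

(** * The four functions *)

Lemma klein_modular (Gamma : Z -> Z -> Z -> Z -> Prop) (N u1 v1 u2 v2 : Z) (kappa : C) (e : nat) (f : C -> C) :
  (0 < N)%Z -> ~ (N | u2)%Z -> (forall tau, in_H tau -> f tau = Cpow (kappa * klein_quot N u1 v1 u2 v2 tau) e) ->
  (forall a b c d, Gamma a b c d -> SL2Z a b c d /\ exists c' m1 m2 n1 n2 l, (c = N * c')%Z /\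
    (2 * u1 * a + N * v1 * c' = 2 * u1 + 2 * N * m1)%Z /\ (2 * u1 * b + v1 * d = v1 + 2 * m2)%Z /\
    (2 * u2 * a + N * v2 * c' = 2 * u2 + 2 * N * n1)%Z /\ (2 * u2 * b + v2 * d = v2 + 2 * n2)%Z /\
    (INR e * (translation_phase (IZR u1 / IZR N) (IZR v1 / 2) m1 m2 - translation_phase (IZR u2 / IZR N) (IZR v2 / 2) n1 n2) = IZR l)%R) ->
  modular_function Gamma f.
Proof.
  intros HN Hu Hf HG. split; [|split].
  - apply klein_quot_meromorphic with N u1 v1 u2 v2 kappa e; assumption.
  - intros a b c d Hg z0 Hz0. exists (Im z0). split; [exact Hz0|]. intros z Hz.
    assert (Hz' : in_H z) by (apply near_in_H with z0, Hz).
    destruct (HG a b c d Hg) as [H [c' [m1 [m2 [n1 [n2 [l [-> [E1 [E2 [E3 [E4 El]]]]]]]]]]]].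
    rewrite (Hf _ (in_H_mob _ _ _ _ _ H Hz')), (Hf z Hz').
    apply klein_quot_invariant with m1 m2 n1 n2 l; assumption.
  - apply klein_quot_cusps with N u1 v1 u2 v2 kappa e; assumption.
Qed.

(** The shift from v to v + 1 is the half period between a Klein form, which vanishes at lattice
    points, and Th, which vanishes at 1/2. *)
Lemma Th_klein (N a v : Z) (tau : C) : (0 < N)%Z -> in_H tau ->
  Th (zc a * tau + zc (v + 1) / 2) (zc N * tau) =
    qe (- (zc N * tau / 8) - RtoC ((IZR a / IZR N - 1) / 2) * (zc a * tau + zc v / 2)) * klein (IZR a / IZR N) (IZR v / 2) (zc N * tau).
Proof.
  intros HN Ht. assert (NR : IZR N <> 0%R) by (apply IZR_lt in HN; lra).
  assert (NC : zc N <> 0) by (intros Q; apply RtoC_inj in Q; auto).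
  rewrite (klein_Th _ _ (zc N * tau) (zc a * tau + zc v / 2)).
  - rewrite Cmult_assoc, <- qe_plus.
    replace (- (zc N * tau / 8) - RtoC ((IZR a / IZR N - 1) / 2) * (zc a * tau + zc v / 2) + (zc N * tau / 8 + RtoC ((IZR a / IZR N - 1) / 2) * (zc a * tau + zc v / 2))) with (RtoC 0) by ring.
    rewrite qe_0, Cmult_1_l. f_equal. push_RtoC. field.
  - apply in_H_scale; assumption.
  - rewrite (RtoC_div (IZR a)) by exact NR. push_RtoC. field. exact NC.
Qed.

Definition klein_quot_const (N a1 v1 a2 v2 : Z) : C :=
  qe (RtoC ((IZR a2 / IZR N - 1) * IZR v2 / 4 - (IZR a1 / IZR N - 1) * IZR v1 / 4)).

(** The relation defining s makes the power of q cancel the tau-dependent parts of the two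
    exponential prefactors, so only the constant [klein_quot_const] is left. *)
Lemma Th_ratio (N a1 v1 a2 v2 s : Z) (tau : C) : (0 < N)%Z -> ~ (N | a2)%Z -> in_H tau ->
  (2 * N * s + a2 * a2 - a1 * a1 + N * (a1 - a2) = 0)%Z ->
  qe (zc s * tau) * (Th (zc a1 * tau + zc (v1 + 1) / 2) (zc N * tau) / Th (zc a2 * tau + zc (v2 + 1) / 2) (zc N * tau))
   = klein_quot_const N a1 v1 a2 v2 * klein_quot N a1 v1 a2 v2 tau.
Proof.
  intros HN Ha Ht Hs. assert (NR : IZR N <> 0%R) by (apply IZR_lt in HN; lra).
  assert (NC : zc N <> 0) by (intros Q; apply RtoC_inj in Q; auto).
  rewrite !Th_klein by assumption. pose proof (klein_quot_den_nz N a2 v2 _ HN Ha (in_H_scale N tau HN Ht)) as Nd. unfold klein_quot.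
  set (k1 := klein (IZR a1 / IZR N) (IZR v1 / 2) (zc N * tau)). set (k2 := klein (IZR a2 / IZR N) (IZR v2 / 2) (zc N * tau)) in *.
  set (p1 := - (zc N * tau / 8) - RtoC ((IZR a1 / IZR N - 1) / 2) * (zc a1 * tau + zc v1 / 2)).
  set (p2 := - (zc N * tau / 8) - RtoC ((IZR a2 / IZR N - 1) / 2) * (zc a2 * tau + zc v2 / 2)).
  replace (qe (zc s * tau) * (qe p1 * k1 / (qe p2 * k2))) with (qe (zc s * tau) * qe p1 / qe p2 * (k1 / k2)) by (field; auto using qe_nz).
  rewrite <- qe_plus, <- qe_minus. f_equal. unfold klein_quot_const. f_equal. unfold p1, p2.
  assert (Es : zc s = (zc a1 * zc a1 - zc a2 * zc a2 - zc N * (zc a1 - zc a2)) / (2 * zc N)).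
  { apply (f_equal IZR) in Hs. repeat rewrite ?plus_IZR, ?minus_IZR, ?mult_IZR in Hs.
    replace (IZR s) with ((IZR a1 * IZR a1 - IZR a2 * IZR a2 - IZR N * (IZR a1 - IZR a2)) / (2 * IZR N))%R.
    - rewrite RtoC_div by lra. push_RtoC. reflexivity.
    - apply Rmult_eq_reg_r with (2 * IZR N)%R; [|lra]. unfold Rdiv. rewrite Rmult_assoc, Rinv_l by lra. lra. }
  rewrite Es. rewrite !(RtoC_div (_ - _)), !RtoC_minus, !RtoC_div by lra. rewrite !RtoC_mult, !RtoC_minus, !RtoC_div by exact NR. field. exact NC.
Qed.

Lemma zser_zero : zser (fun _ => 0) 0.
Proof. apply (Cser_finite (sym (fun _ => RtoC 0)) 0). intros [|k] _; unfold sym; ring. Qed.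

Lemma Th_term_half (z t : C) (k : Z) : Th_term (z + 1 / 2) t k = qe (zc k / 2) * Th_term z t k.
Proof. unfold Th_term. rewrite <- qe_plus. f_equal. field. Qed.

Lemma qe_even_half (m : Z) : qe (zc (2 * m) / 2) = 1.
Proof. rewrite <- (qe_int m). f_equal. push_RtoC. field. Qed.

Lemma qe_odd_half (m : Z) : qe (zc (2 * m + 1) / 2) = - (1).
Proof. replace (zc (2 * m + 1) / 2) with (1 / 2 + zc m) by (push_RtoC; field). rewrite qe_period. apply qe_half. Qed.

Lemma in_H_4 (t : C) : in_H t -> in_H (4 * t).
Proof. apply (in_H_scale 4). lia. Qed.

Lemma Th_sum_dom (z t c : C) : in_H t -> exists b, summable b /\ zdom (fun k => Th_term z t k + c * Th_term (z + 1 / 2) t k) b.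
Proof.
  intros Ht. destruct (Th_term_zdom z t Ht) as [b [Hb Hd]]. destruct (Th_term_zdom (z + 1 / 2) t Ht) as [b' [Hb' Hd']].
  exists (fun n => (b n + Cmod c * b' n)%R). split; [apply summable_plus; [exact Hb|apply summable_scal; [apply Cmod_ge_0|exact Hb']]|].
  intros k. eapply Rle_trans; [apply Cmod_triangle|]. rewrite Cmod_mult.
  apply Rplus_le_compat; [apply Hd|]. apply Rmult_le_compat_l; [apply Cmod_ge_0|apply Hd'].
Qed.

(** Adding 1/2 to z multiplies the k-th term by (-1)^k, so odd terms cancel. For k = 2m the exponent
    2mz + m(2m-1)t equals m(2z+t) + (m(m-1)/2)(4t). *)
Lemma Th_add_half (z t : C) : in_H t -> Th z t + Th (z + 1 / 2) t = 2 * Th (2 * z + t) (4 * t).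
Proof.
  intros Ht. destruct (Th_sum_dom z t 1 Ht) as [b [Hb Hd]].
  replace (Th z t + Th (z + 1 / 2) t) with (Th z t + 1 * Th (z + 1 / 2) t) by ring.
  apply (zser_unique (fun k => Th_term z t k + 1 * Th_term (z + 1 / 2) t k)).
  { apply zser_plus; [|apply zser_scal]; apply Th_zser, Ht. }
  replace (2 * Th (2 * z + t) (4 * t)) with (2 * Th (2 * z + t) (4 * t) + 0) by ring.
  apply zser_even_odd with b; [exact Hb|exact Hd| |].
  - eapply zser_ext; [|apply (zser_scal 2), Th_zser, in_H_4, Ht]. intros m. cbv beta. rewrite Th_term_half, qe_even_half.
    replace (Th_term (2 * z + t) (4 * t) m) with (Th_term z t (2 * m)); [ring|]. unfold Th_term. f_equal. push_RtoC. field.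
  - eapply zser_ext; [|apply zser_zero]. intros m. cbv beta. rewrite Th_term_half, qe_odd_half. ring.
Qed.

(** Now the odd terms survive: for k = 2m+1 the exponent is z + m(2z+3t) + (m(m-1)/2)(4t). *)
Lemma Th_sub_half (z t : C) : in_H t -> Th z t - Th (z + 1 / 2) t = 2 * qe z * Th (2 * z + 3 * t) (4 * t).
Proof.
  intros Ht. destruct (Th_sum_dom z t (- (1)) Ht) as [b [Hb Hd]].
  replace (Th z t - Th (z + 1 / 2) t) with (Th z t + - (1) * Th (z + 1 / 2) t) by ring.
  apply (zser_unique (fun k => Th_term z t k + - (1) * Th_term (z + 1 / 2) t k)).
  { apply zser_plus; [|apply zser_scal]; apply Th_zser, Ht. }
  replace (2 * qe z * Th (2 * z + 3 * t) (4 * t)) with (0 + 2 * qe z * Th (2 * z + 3 * t) (4 * t)) by ring.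
  apply zser_even_odd with b; [exact Hb|exact Hd| |].
  - eapply zser_ext; [|apply zser_zero]. intros m. cbv beta. rewrite Th_term_half, qe_even_half. ring.
  - eapply zser_ext; [|apply (zser_scal (2 * qe z)), Th_zser, in_H_4, Ht]. intros m. cbv beta. rewrite Th_term_half, qe_odd_half.
    replace (Th_term z t (2 * m + 1)) with (qe z * Th_term (2 * z + 3 * t) (4 * t) m); [ring|]. unfold Th_term. rewrite <- qe_plus. f_equal. push_RtoC. field.
Qed.

Definition prodP (tau : C) (a b : nat) : C :=
  qpoch_inf (- Cpow (qe tau) a) (Cpow (qe tau) (a + b)) * qpoch_inf (- Cpow (qe tau) b) (Cpow (qe tau) (a + b)).

Definition prodM (tau : C) (a b : nat) : C :=
  qpoch_inf (Cpow (qe tau) a) (Cpow (qe tau) (a + b)) * qpoch_inf (Cpow (qe tau) b) (Cpow (qe tau) (a + b)).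

Lemma theta_products (tau : C) (a b : nat) : in_H tau -> (0 < a + b)%nat -> exists c : C,
  Th (RtoC (INR a) * tau) (RtoC (INR (a + b)) * tau) = c * prodP tau a b /\
  Th (RtoC (INR a) * tau + 1 / 2) (RtoC (INR (a + b)) * tau) = c * prodM tau a b.
Proof.
  intros Ht Hab. set (t := RtoC (INR (a + b)) * tau).
  assert (Ht' : in_H t).
  { unfold t. rewrite INR_IZR_INZ. apply in_H_scale; [lia|exact Ht]. }
  exists (qpoch_inf (qe t) (qe t)). unfold prodP, prodM. rewrite !qe_pow. fold t.
  assert (Eb : t - RtoC (INR a) * tau = RtoC (INR b) * tau) by (unfold t; rewrite plus_INR, RtoC_plus; ring).
  split; rewrite jacobi_triple by exact Ht'; [rewrite Eb; reflexivity|].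
  replace (- qe (RtoC (INR a) * tau + 1 / 2)) with (qe (RtoC (INR a) * tau)) by (rewrite qe_plus, qe_half; ring).
  replace (t - (RtoC (INR a) * tau + 1 / 2)) with (RtoC (INR b) * tau - 1 / 2) by (rewrite <- Eb; ring).
  replace (- qe (RtoC (INR b) * tau - 1 / 2)) with (qe (RtoC (INR b) * tau)); [reflexivity|].
  rewrite qe_minus, qe_half. field.
Qed.

Lemma Th_nz_mult (a N : Z) (v tau : C) : (0 < N)%Z -> ~ (N | a)%Z -> in_H tau -> Im v = 0%R -> Th (zc a * tau + v) (zc N * tau) <> 0.
Proof.
  intros HN Ha Ht Hv. apply Th_nz; [apply in_H_scale; assumption|]. intros n E. apply Ha. exists (- n)%Z.
  unfold in_H in Ht. destruct tau as [x y], v as [v1 v2]. simpl in *. subst v2.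
  assert (Q : (IZR (a + n * N) * y = 0)%R) by (rewrite plus_IZR, mult_IZR; lra).
  apply Rmult_integral in Q. destruct Q as [Q|Q]; [|lra]. apply eq_IZR in Q. lia.
Qed.

Lemma prod_quotient (tau : C) (a b : nat) : in_H tau -> ~ (Z.of_nat (a + b) | Z.of_nat a)%Z ->
  let N := Z.of_nat (a + b) in
  prodP tau a b / prodM tau a b = klein_quot_const N (Z.of_nat a) (-1) (Z.of_nat a) 0 * klein_quot N (Z.of_nat a) (-1) (Z.of_nat a) 0 tau.
Proof.
  intros Ht Hd N.
  assert (Hab : (0 < a + b)%nat).
  { destruct (Nat.eq_dec (a + b) 0) as [E|E]; [|lia]. exfalso. apply Hd. replace a with O by lia. simpl. apply Z.divide_0_r. }
  rewrite <- (Th_ratio N _ _ _ _ 0 tau); [|unfold N; lia|exact Hd|exact Ht|ring].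
  destruct (theta_products tau a b Ht Hab) as [c [E1 E2]]. rewrite !INR_IZR_INZ in E1, E2. fold N in E1, E2.
  replace (zc (Z.of_nat a) * tau + zc (-1 + 1) / 2) with (zc (Z.of_nat a) * tau) by (simpl; field).
  replace (zc (0 + 1)) with (RtoC 1) by reflexivity.
  assert (Nz : Th (zc (Z.of_nat a) * tau + 1 / 2) (zc N * tau) <> 0).
  { apply Th_nz_mult; [unfold N; lia|exact Hd|exact Ht|simpl; field]. }
  rewrite E1, E2 in *. replace (0 * tau) with (RtoC 0) by ring. rewrite qe_0.
  assert (c <> 0) by (intros Q; apply Nz; rewrite Q; ring).
  assert (prodM tau a b <> 0) by (intros Q; apply Nz; rewrite Q; ring).
  field. split; assumption.
Qed.

(** With z = a tau and t = N tau, the sum and difference formulas give theta functions at (2a+N) tau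
    and (2a+3N) tau over the lattice of 4N tau. The factor qe z from the difference is the power s =
    a in [Th_ratio]. *)
Lemma prod_diff_over_sum (tau : C) (a b : nat) : in_H tau -> ~ (4 * Z.of_nat (a + b) | 2 * Z.of_nat a + Z.of_nat (a + b))%Z ->
  let N := Z.of_nat (a + b) in let a' := Z.of_nat a in
  (prodP tau a b - prodM tau a b) / (prodP tau a b + prodM tau a b)
  = klein_quot_const (4 * N) (2 * a' + 3 * N) (-1) (2 * a' + N) (-1) * klein_quot (4 * N) (2 * a' + 3 * N) (-1) (2 * a' + N) (-1) tau.
Proof.
  intros Ht Hd N a'. fold N a' in Hd.
  assert (Hab : (0 < a + b)%nat).
  { destruct (Nat.eq_dec (a + b) 0) as [E|E]; [|lia]. exfalso. apply Hd. unfold N, a'. rewrite E. replace a with O by lia. simpl. apply Z.divide_0_r. }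
  rewrite <- (Th_ratio (4 * N) _ _ _ _ a' tau); [|unfold N; lia|exact Hd|exact Ht|ring].
  destruct (theta_products tau a b Ht Hab) as [c [E1 E2]]. rewrite !INR_IZR_INZ in E1, E2. fold N a' in E1, E2.
  assert (HN : in_H (zc N * tau)) by (apply in_H_scale; [unfold N; lia|exact Ht]).
  pose proof (Th_add_half (zc a' * tau) (zc N * tau) HN) as P. pose proof (Th_sub_half (zc a' * tau) (zc N * tau) HN) as M.
  replace (2 * (zc a' * tau) + zc N * tau) with (zc (2 * a' + N) * tau + zc (-1 + 1) / 2) in P by (push_RtoC; field).
  replace (2 * (zc a' * tau) + 3 * (zc N * tau)) with (zc (2 * a' + 3 * N) * tau + zc (-1 + 1) / 2) in M by (push_RtoC; field).
  replace (4 * (zc N * tau)) with (zc (4 * N) * tau) in P, M by (push_RtoC; ring).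
  rewrite E1, E2 in P, M.
  assert (Nz : Th (zc (2 * a' + N) * tau + zc (-1 + 1) / 2) (zc (4 * N) * tau) <> 0).
  { apply Th_nz_mult; [unfold N; lia|exact Hd|exact Ht|simpl; field]. }
  set (A := Th (zc (2 * a' + 3 * N) * tau + zc (-1 + 1) / 2) (zc (4 * N) * tau)) in *.
  set (B := Th (zc (2 * a' + N) * tau + zc (-1 + 1) / 2) (zc (4 * N) * tau)) in *.
  set (p := prodP tau a b) in *. set (m := prodM tau a b) in *.
  assert (P' : c * (p + m) = 2 * B) by (rewrite <- P; ring).
  assert (N2 : 2 * B <> 0) by (apply Cmult_neq_0; [intros Q; injection Q; lra|exact Nz]).
  assert (Nc : c <> 0) by (intros Q; apply N2; rewrite <- P', Q; ring).
  assert (Npm : p + m <> 0) by (intros Q; apply N2; rewrite <- P', Q; ring).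
  apply (Cmult_reg_l (2 * B)); [exact N2|]. rewrite <- P' at 1.
  transitivity (c * p - c * m); [field; exact Npm|]. rewrite M. field. exact Nz.
Qed.

Lemma Gamma1_param (N a b c d : Z) : (0 < N)%Z -> Gamma1 N a b c d ->
  SL2Z a b c d /\ exists a1 c1 d1, (a = 1 + N * a1 /\ c = N * c1 /\ d = 1 + N * d1)%Z.
Proof.
  intros HN [H [Ha [Hd Hc]]]. split; [exact H|].
  assert (D : forall x, (x mod N = 1 mod N)%Z -> exists y, x = (1 + N * y)%Z).
  { intros x Hx. exists (x / N - 1 / N)%Z. pose proof (Z.div_mod x N ltac:(lia)). pose proof (Z.div_mod 1 N ltac:(lia)). lia. }
  destruct (D a Ha) as [a1 ->]. destruct (D d Hd) as [d1 ->]. exists a1, (c / N)%Z, d1.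
  repeat split. pose proof (Z.div_mod c N ltac:(lia)). lia.
Qed.

(** The two forms have second coordinates -1/2 and 0. Their phases differ by m1/4 up to
    half-integers, with m1 = 2 a a1 - c1, so the fourth power is needed to make the phase integral.
    An even c' = 2 c1 makes m1 an integer. *)
Lemma g_modular (a : Z) (kappa : C) (f : C -> C) : ~ (5 | a)%Z ->
  (forall tau, in_H tau -> f tau = Cpow (kappa * klein_quot 5 a (-1) a 0 tau) 4) -> modular_function (Gamma1 10) f.
Proof.
  intros Ha Hf. apply klein_modular with 5%Z a (-1)%Z a 0%Z kappa 4%nat; [lia|exact Ha|exact Hf|].
  intros a0 b c d HG. destruct (Gamma1_param 10 a0 b c d ltac:(lia) HG) as [H [a1 [c1 [d1 [-> [-> ->]]]]]]. split; [exact H|].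
  exists (2 * c1)%Z, (2 * a * a1 - c1)%Z, (a * b - 5 * d1)%Z, (2 * a * a1)%Z, (a * b)%Z.
  exists (-2 * a * d1 + (2 * a * a1 - c1) + 2 * ((2 * a * a1 - c1) * (a * b - 5 * d1) - (2 * a * a1 - c1) - (a * b - 5 * d1))
     - 2 * ((2 * a * a1) * (a * b) - 2 * a * a1 - a * b))%Z.
  repeat split; try ring.
  unfold translation_phase. simpl INR. repeat rewrite ?plus_IZR, ?minus_IZR, ?mult_IZR. field.
Qed.

Lemma T_modular (a2 : Z) (kappa : C) (f : C -> C) : (a2 = 7 \/ a2 = 9)%Z ->
  (forall tau, in_H tau -> f tau = Cpow (kappa * klein_quot 20 (a2 + 10) (-1) a2 (-1) tau) 1) -> modular_function (Gamma1 40) f.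
Proof.
  intros Ha Hf. apply klein_modular with 20%Z (a2 + 10)%Z (-1)%Z a2 (-1)%Z kappa 1%nat; [lia| |exact Hf|].
  { intros [k Hk]. lia. }
  intros a0 b c d HG. destruct (Gamma1_param 40 a0 b c d ltac:(lia) HG) as [H [a1 [c1 [d1 [-> [-> ->]]]]]]. split; [exact H|].
  exists (2 * c1)%Z, (2 * (a2 + 10) * a1 - c1)%Z, ((a2 + 10) * b - 20 * d1)%Z, (2 * a2 * a1 - c1)%Z, (a2 * b - 20 * d1)%Z.
  destruct Ha as [-> | ->].
  - exists (6 * b - 5 * d1 + 5 * a1 + 240 * a1 * b - 200 * a1 * d1 - 5 * b * c1 - 10 * a1 - 5 * b)%Z.
    repeat split; try ring.
    unfold translation_phase. simpl INR. repeat rewrite ?plus_IZR, ?minus_IZR, ?mult_IZR. field.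
  - exists (7 * b - 5 * d1 + 5 * a1 + 280 * a1 * b - 200 * a1 * d1 - 5 * b * c1 - 10 * a1 - 5 * b)%Z.
    repeat split; try ring.
    unfold translation_phase. simpl INR. repeat rewrite ?plus_IZR, ?minus_IZR, ?mult_IZR. field.
Qed.

Lemma Cpow_1_r (x : C) : Cpow x 1 = x.
Proof. simpl. ring. Qed.

Theorem theorem3p4 :
  modular_function (Gamma1 10) (fun tau => Cpow (g1 tau) 4) /\
  modular_function (Gamma1 10) (fun tau => Cpow (g2 tau) 4) /\
  modular_function (Gamma1 40) T1 /\
  modular_function (Gamma1 40) T2.
Proof.
  assert (D : forall m n : Z, (0 < n < m)%Z -> ~ (m | n)%Z) by (intros m n H Q; apply Z.divide_pos_le in Q; lia).
  split; [|split; [|split]].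
  - apply g_modular with 1%Z (klein_quot_const 5 1 (-1) 1 0); [apply D; lia|]. intros tau Ht.
    (* The definition of [g1] has q where [prodP] has q^1, so a rewriting is required; for the
       exponents 2 and 3 the two sides are convertible. *)
    transitivity (Cpow (prodP tau 1 4 / prodM tau 1 4) 4); [unfold g1, prodP, prodM; rewrite Cpow_1_r; reflexivity|].
    f_equal. apply (prod_quotient tau 1 4 Ht). apply D; lia.
  - apply g_modular with 2%Z (klein_quot_const 5 2 (-1) 2 0); [apply D; lia|]. intros tau Ht.
    change (Cpow (prodP tau 2 3 / prodM tau 2 3) 4 = Cpow (klein_quot_const 5 2 (-1) 2 0 * klein_quot 5 2 (-1) 2 0 tau) 4).
    f_equal. apply (prod_quotient tau 2 3 Ht). apply D; lia.
  (* With N = 5, the numbers 2a + N and 2a + 3N are 7 and 17 for a = 1, and 9 and 19 for a = 2. *)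
  - apply T_modular with 7%Z (klein_quot_const 20 17 (-1) 7 (-1)); [auto|]. intros tau Ht. rewrite Cpow_1_r.
    transitivity ((prodP tau 1 4 - prodM tau 1 4) / (prodP tau 1 4 + prodM tau 1 4)).
    + unfold T1, prodP, prodM. rewrite Cpow_1_r. reflexivity.
    + apply (prod_diff_over_sum tau 1 4 Ht). apply D; lia.
  - apply T_modular with 9%Z (klein_quot_const 20 19 (-1) 9 (-1)); [auto|]. intros tau Ht. rewrite Cpow_1_r.
    apply (prod_diff_over_sum tau 2 3 Ht). apply D; lia.
Qed.
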